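(* Let $T_\epsilon$, $\epsilon\in V$, be a family of maps satisfying the standing assumptions listed in the context, with $\gamma\in(0,1)$, and let $h^*=F_0\hat h^*+Q\hat h$ be the linear response of the (non-normalized) invariant density of $T=T_0$. Then for every $\tau>0$ there exist an integer $l^*\ge 0$, truncation levels $k=k(\eta)$, and a sequence of finite rank operators $\hat L_\eta:L^1(\Delta)\to L^1(\Delta)$ (indexed by mesh sizes $\eta=\frac{1}{2M}$, $M\in\mathbb N$), each having an invariant density $\hat h_\eta\in C^1(\Delta)$ (that is, $\hat L_\eta\hat h_\eta=\hat h_\eta$, $\int_\Delta\hat h_\eta\,dm=1$), such that for all sufficiently small $\eta>0$ and all sufficiently large $N^*$, the function $$h^*_\eta:=F_0^{\mathrm{app}}\hat h^*_\eta+Q^{\mathrm{app}}\hat h_\eta$$ satisfies $$\|h^*_\eta-h^*\|_{1}\le\tau ,$$ where $\|\cdot\|_1$ is the norm of $L^1([0,1])$, and $\hat h_\eta^*$, $F_0^{\mathrm{app}}$, $Q^{\mathrm{app}}$ are built from $\hat h_\eta,k,\eta,l^*,N^*$ as described in the context.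
   Context: Notation: $m$ is Lebesgue measure, $V$ a neighbourhood of $0\in\mathbb R$, $\Delta=[\tfrac12,1]$, $\Delta^c=[0,1]\setminus\Delta$; $'$ and $^{(j)}$ denote derivatives in the space variable. **The maps.** For $\epsilon\in V$, $T_\epsilon:[0,1]\to[0,1]$ is non-singular with respect to $m$, with two onto branches $T_{0,\epsilon}:[0,\frac12]\to[0,1]$ and $T_{1,\epsilon}:[\frac12,1]\to[0,1]$ with inverse branches $g_{0,\epsilon},g_{1,\epsilon}$. For $i=0,1$ and $j=0,1,2$ the derivatives $\partial_\epsilon g^{(j)}_{i,\epsilon}$ exist and $\partial_\epsilon g^{(j)}_{i,\epsilon}=(\partial_\epsilon g_{i,\epsilon})^{(j)}$. $T_\epsilon$ has a unique (up to multiplication) absolutely continuous invariant measure (possibly $\sigma$-finite), with density $h_\epsilon$. $\hat T_\epsilon$ is the first return map of $T_\epsilon$ to $\Delta$: $\hat T_\epsilon(x)=T_\epsilon^{R_\epsilon(x)}(x)$, $R_\epsilon(x)=\inf\{n\ge1:T^n_\epsilon(x)\in\Delta\}$; it has a unique (up to multiplication) absolutely continuous invariant measure, with continuous density $\hat h_\epsilon$. $\Omega$ is the set of words $\omega=10^n$, $n\ge0$; the length is $|\omega|=n+1$; $g_{\omega,\epsilon}=g_{1,\epsilon}\circ g_{0,\epsilon}^n$. The cylinders $[\omega]_\epsilon=g_{\omega,\epsilon}(\Delta)$ form a partition (mod 0) of $\Delta$, and the $g_{\omega,\epsilon}|_\Delta$ are the inverse branches of $\hat T_\epsilon$. An index $\epsilon$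 is dropped when $\epsilon=0$. $\mathcal B$ is the Banach space of continuous functions on $(0,1]$ with norm $\|f\|_{\mathcal B}=\sup_{x\in(0,1]}|x^\gamma f(x)|$, for a fixed $\gamma\in(0,1)$. Assume $$\sup_\omega\sup_{\epsilon\in V}\sup_{x\in[0,1]}|g'_{\omega,\epsilon}(x)|<\infty,\qquad \sup_\omega\sup_{\epsilon\in V}\sup_{x\in[0,1]}|\partial_\epsilon g_{\omega,\epsilon}(x)|<\infty,$$ $$\sum_\omega\sup_{\epsilon\in V}\|g'_{\omega,\epsilon}\|_{\mathcal B}<\infty,\qquad\sum_\omega\sup_{\epsilon\in V}\|\partial_\epsilon g'_{\omega,\epsilon}\|_{\mathcal B}<\infty .$$ The induced maps moreover satisfy: on each interior of a cylinder $\hat T_\epsilon$ is $C^3$, onto $\Delta$, and uniformly expanding ($\inf_\omega\inf|\hat T_{\omega,\epsilon}'|>1$); $\partial_\epsilon g^{(j)}_{\omega,\epsilon}=(\partial_\epsilon g_{\omega,\epsilon})^{(j)}$ for $j=0,1,2$; $\sup_\omega\sup_{\epsilon}\sup_{x\in\Delta}|g''_{\omega,\epsilon}(x)/g'_{\omega,\epsilon}(x)|<\infty$; $\sum_\omega\sup_\epsilon\sup_{x\in\Delta}|g^{(i)}_{\omega,\epsilon}(x)|<\infty$ for $i=2,3$; $\sum_\omega\sup_\epsilon\sup_{x\in\Delta}|\partial_\epsilon g^{(i)}_{\omega,\epsilon}(x)|<\infty$ for $i=1,2$. **Linear response.** $\hat L\Phi=\sum_{\omega\in\Omega}\Phi\circ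 g_\omega\, g_\omega'$ on $L^1(\Delta)$ is the transfer operator of $\hat T=\hat T_0$; $\hat h$ is its invariant density, $\int_\Delta\hat h\,dm=1$. Put $$A_0=-\Big(\frac{\partial_\epsilon\hat T_\epsilon}{\hat T_\epsilon'}\Big)\Big|_{\epsilon=0},\quad B_0=\Big(\frac{\partial_\epsilon\hat T_\epsilon\cdot\hat T_\epsilon''}{(\hat T_\epsilon')^2}-\frac{\partial_\epsilon\hat T'_\epsilon}{\hat T'_\epsilon}\Big)\Big|_{\epsilon=0},\quad W=\hat L[A_0\hat h'+B_0\hat h],\quad \hat h^*=(I-\hat L)^{-1}W ,$$ the inverse being taken on zero-average functions. With $a_\omega=\partial_\epsilon g_{\omega,\epsilon}|_{\epsilon=0}$, $b_\omega=\partial_\epsilon g'_{\omega,\epsilon}|_{\epsilon=0}$, define functions on $[0,1]$ $$F_0\Phi=1_\Delta\Phi+(1-1_\Delta)\sum_{\omega\in\Omega}\Phi\circ g_\omega\,g_\omega',\qquad Q\Phi=(1-1_\Delta)\sum_{\omega\in\Omega}\big(\Phi'\circ g_\omega\cdot a_\omega g'_\omega+\Phi\circ g_\omega\cdot b_\omega\big),$$ and $h^*=F_0\hat h^*+Q\hat h$. $F_0^{\mathrm{app}}$ and $Q^{\mathrm{app}}$ are given by the same formulas with the sums restricted to $|\omega|\le N^*$. **Approximation of $\hat h^*$.** Let $\delta_k=m\big(\bigcup_{n\ge k}[10^n]\big)$ and assume $\frac12$ is in the closure of $\bigcup_{n\ge k}[10^n]$ (so up to measure zero this set is $[\frac12,\frac12+\delta_k)$).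 $\hat T_{\delta_k}$ equals $\hat T$ on $[\frac12+\delta_k,1]$ and $x\mapsto\frac12\delta_k^{-1}(x-\frac12)+\frac12$ on $[\frac12,\frac12+\delta_k)$; its transfer operator is $$\hat L_{\delta_k}\Phi(x)=\sum_{\omega=10^n,\,n<k}\Phi\circ g_\omega(x)g'_\omega(x)+2\delta_k\,\Phi\big(\delta_k(2x-1)+\tfrac12\big).$$ For $\eta=\frac1{2M}$ let $x_i=\frac12+i\eta$ ($0\le i\le M$), $I_i=[x_i,x_{i+1}]$ ($0\le i\le M-1$), $\phi_i(x)=\max\{0,1-|x-x_i|/\eta\}$, $\Pi f=\sum_{i=0}^M f(x_i)\phi_i$ on $C^0(\Delta)$, $\hat L_h=\Pi\hat L_{\delta_k}\Pi$, and let $$\hat P_hf=\hat L_hf+\frac1{m(\Delta)}\Big(\int_\Delta f\,dm-\int_\Delta\hat L_hf\,dm\Big)\cdot 1,$$ which preserves integrals. With points $\zeta=\zeta_{\omega,i}$ chosen arbitrarily in $g_\omega(I_i)$, let $$a_i=\sum_{\omega=10^n,\,n<k}\frac1\eta\int_{g_\omega(I_i)}\big(A_0(z)\hat h_\eta'(\zeta)+B_0(z)\hat h_\eta(\zeta)\big)dz+\frac1\eta\int_{\delta_k(2I_i-1)+\frac12}\big(A_0\hat h_\eta'+B_0\hat h_\eta\big)(z)\,dz,$$ $$W_h=a_0\phi_0+\sum_{i=1}^{M-1}\frac{a_{i-1}+a_i}2\,\phi_i+a_{M-1}\phi_M,\qquad \hat h^*_\eta=\sum_{n=0}^{l^*}\hat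 P_h^nW_h .$$ *)

(* Defs.v *)
From HB Require Import structures.
From mathcomp Require Import all_boot all_order all_algebra.
From mathcomp Require Import all_classical all_reals all_analysis.

Set Implicit Arguments.
Unset Strict Implicit.
Unset Printing Implicit Defensive.

Import Order.TTheory GRing.Theory Num.Theory.
Import numFieldNormedType.Exports.

Local Open Scope classical_set_scope.
Local Open Scope ring_scope.

Section Calculus.
Context {R : realType}.
Implicit Types (D S V : set R) (f : R -> R) (u : R -> R -> R) (e x : R).

Definition mu := @lebesgue_measure R.

Definition I01 : set R := `[0, 1]%classic.
Definition Delta : set R := `[2^-1, 1]%classic.

(* Derivatives relative to a set [D]: two-sided at interior points of [D],
   one-sided at the end points of an interval. *)
Definition quotient f x : R -> R := fun y => (f y - f x) / (y - x).

Definition derivable_in D f x : Prop :=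
  cvg (quotient f x y @[y --> within D (x^')]).

Definition der D f x : R := lim (quotient f x y @[y --> within D (x^')]).

Definition dern D (j : nat) f : R -> R := iter j (der D) f.

Definition C1 D f : Prop :=
  (forall x, D x -> derivable_in D f x) /\ {within D, continuous (der D f)}.

(* For a family [u], the first argument is the parameter epsilon. *)
Definition pd u e x : R := derive1 (fun e' => u e' x) e.

Definition pderivable u e x : Prop := derivable (fun e' => u e' x) e 1.

(* At the points of [S] the derivatives of [u e] and [pd u e] up to order [k],
   relative to [D], exist, and the space and parameter derivatives commute. *)
Definition eps_smooth V D S (k : nat) u : Prop :=
  forall e x, V e -> S x ->
    (forall j, (j < k)%N ->
       derivable_in D (dern D j (u e)) x /\
       derivable_in D (dern D j (pd u e)) x) /\
    (forall j, (j <= k)%N ->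
       pderivable (fun e' => dern D j (u e')) e x /\
       pd (fun e' => dern D j (u e')) e x = dern D j (pd u e) x).

Definition sup_on (I : Type) (A : set I) (f : I -> \bar R) : \bar R :=
  ereal_sup [set f i | i in A].

Definition sup_norm S f : \bar R := sup_on S (fun x => `|f x|%:E).

Definition B_norm (gamma : R) f : \bar R :=
  sup_norm `]0, 1]%classic (fun x => x `^ gamma * f x).

Definition in_B (gamma : R) f : Prop :=
  {within `]0, 1]%classic, continuous f} /\ (B_norm gamma f < +oo)%E.

(* [d] is the real-valued density of a nonzero sigma-finite measure on [X],
   absolutely continuous and invariant under [f]. *)
Definition acim (X : set R) f (d : R -> R) : Prop :=
  [/\ measurable_fun X d,
      (forall x, X x -> 0 <= d x),
      (0 < \int[mu]_(x in X) (d x)%:E)%E &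
      forall A, measurable A -> A `<=` X ->
        (\int[mu]_(x in X `&` f @^-1` A) (d x)%:E =
         \int[mu]_(x in A) (d x)%:E)%E].

Definition L1 (f : R -> R) : Prop := mu.-integrable Delta (EFin \o f).

Definition L1_eq (f g : R -> R) : Prop :=
  {ae mu, forall x, Delta x -> f x = g x}.

(* Elements of L^1(Delta) are represented by functions, equality being
   [L1_eq]; linearity and boundedness make [Lam] compatible with [L1_eq]. *)
Definition finite_rank_operator (Lam : (R -> R) -> (R -> R)) : Prop :=
  [/\ (forall f, L1 f -> L1 (Lam f)),
      (forall (c : R) f g, L1 f -> L1 g ->
         L1_eq (Lam (fun x => c * f x + g x))
               (fun x => c * Lam f x + Lam g x)),
      (exists C : R, forall f, L1 f ->
         (\int[mu]_(x in Delta) `|Lam f x|%:E <=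
          C%:E * \int[mu]_(x in Delta) `|f x|%:E)%E) &
      exists (r : nat) (b : 'I_r -> R -> R), (forall j, L1 (b j)) /\
        forall f, L1 f -> exists c : 'I_r -> R,
          L1_eq (Lam f) (fun x => \sum_(j < r) c j * b j x)].

Definition invariant_density (Lam : (R -> R) -> (R -> R)) (d : R -> R) : Prop :=
  [/\ C1 Delta d, L1_eq (Lam d) d & \int[mu]_(x in Delta) d x = 1].

End Calculus.

(* The first argument of each function is the parameter epsilon, the second one
   the space variable. *)
Record map_family (R : realType) := MapFamily {
  Tmap : R -> R -> R;
  branch0 : R -> R -> R;
  branch1 : R -> R -> R;
  g0 : R -> R -> R;
  g1 : R -> R -> R;
  dens : R -> R -> R;     (* density of the a.c.i.m. of [Tmap] *)
  hhat : R -> R -> R      (* density of the a.c.i.m. of the induced map *)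
}.

Section Induced.
Context {R : realType}.
Variable F : map_family R.
Implicit Types (e x : R) (n : nat).

Definition is_return_time e x n : Prop :=
  [/\ (0 < n)%N, Delta (iter n (Tmap F e) x) &
      forall m, (0 < m < n)%N -> ~ Delta (iter m (Tmap F e) x)].

(* The value is 0 at the (negligible) points which never return to [Delta]. *)
Definition return_time e x : nat := xget 0%N [set n | is_return_time e x n].

Definition induced e x : R := iter (return_time e x) (Tmap F e) x.

(* The word 1 0^n is encoded by n; its length is n + 1. *)
Definition g_word n e x : R := g1 F e (iter n (g0 F e) x).

Definition dg_word n e : R -> R := der I01 (g_word n e).

Definition cyl n e : set R := g_word n e @` Delta.

End Induced.

Record standing_assumptions (R : realType) (V : set R) (gamma : R)
    (F : map_family R) : Prop := {
  V_open : open V;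
  V_0 : V 0;

  T_range : forall e x, V e -> I01 x -> I01 (Tmap F e x);
  T_measurable : forall e, V e -> measurable_fun I01 (Tmap F e);
  T_nonsingular : forall e A, V e -> measurable A -> A `<=` I01 ->
    mu A = 0%E -> mu (I01 `&` Tmap F e @^-1` A) = 0%E;
  T_branch0 : forall e (x : R), V e -> 0 <= x < 2^-1 -> Tmap F e x = branch0 F e x;
  T_branch1 : forall e (x : R), V e -> 2^-1 < x <= 1 -> Tmap F e x = branch1 F e x;
  T_half : forall e, V e ->
    Tmap F e 2^-1 = branch0 F e 2^-1 \/ Tmap F e 2^-1 = branch1 F e 2^-1;
  branch0_bij : forall e, V e -> set_bij `[0, 2^-1]%classic I01 (branch0 F e);
  branch1_bij : forall e, V e -> set_bij `[2^-1, 1]%classic I01 (branch1 F e);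
  g0_inverse : forall e x, V e -> I01 x ->
    0 <= g0 F e x <= 2^-1 /\ branch0 F e (g0 F e x) = x;
  g1_inverse : forall e x, V e -> I01 x ->
    2^-1 <= g1 F e x <= 1 /\ branch1 F e (g1 F e x) = x;

  (* Second derivatives are not required at the neutral fixed point 0, where
     they do not exist for the usual intermittent maps. *)
  g0_smooth : eps_smooth V I01 I01 1 (g0 F) /\
              eps_smooth V I01 `]0, 1]%classic 2 (g0 F);
  g1_smooth : eps_smooth V I01 I01 1 (g1 F) /\
              eps_smooth V I01 `]0, 1]%classic 2 (g1 F);

  dens_acim : forall e, V e -> acim I01 (Tmap F e) (dens F e);
  dens_unique : forall e d, V e -> acim I01 (Tmap F e) d ->
    exists c, {ae mu, forall x, I01 x -> d x = c * dens F e x};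

  hhat_continuous : forall e, V e -> {within Delta, continuous (hhat F e)};
  hhat_acim : forall e, V e -> acim Delta (induced F e) (hhat F e);
  (* Uniqueness among finite measures; [dens_unique] is uniqueness among
     sigma-finite ones. *)
  hhat_unique : forall e d, V e -> L1 d -> acim Delta (induced F e) d ->
    exists c, L1_eq d (fun x => c * hhat F e x);
  hhat_normalized : \int[mu]_(x in Delta) hhat F 0 x = 1;

  cyl_sub : forall n e, V e -> cyl F n e `<=` Delta;
  cyl_disjoint : forall (n m : nat) e, V e -> n != m ->
    mu (cyl F n e `&` cyl F m e) = 0%E;
  cyl_cover : forall e, V e -> mu (Delta `\` \bigcup_n cyl F n e) = 0%E;
  g_word_inverse : forall n e (x : R), V e -> (Delta°)%classic x ->
    induced F e (g_word F n e x) = x;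

  g_word_pderivable : forall n e x, V e -> I01 x ->
    pderivable (g_word F n) e x;
  dg_word_pderivable : forall n e (x : R), V e -> 0 < x <= 1 ->
    pderivable (dg_word F n) e x;
  dg_word_in_B : forall n e, V e -> in_B gamma (dg_word F n e);
  pd_dg_word_in_B : forall n e, V e -> in_B gamma (pd (dg_word F n) e);
  sup_dg_word :
    (sup_on setT (fun n => sup_on V (fun e =>
       sup_norm I01 (dg_word F n e))) < +oo)%E;
  sup_pd_g_word :
    (sup_on setT (fun n => sup_on V (fun e =>
       sup_norm I01 (pd (g_word F n) e))) < +oo)%E;
  sum_dg_word :
    (\sum_(0 <= n <oo) sup_on V (fun e =>
       B_norm gamma (dg_word F n e)) < +oo)%E;
  sum_pd_dg_word :
    (\sum_(0 <= n <oo) sup_on V (fun e =>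
       B_norm gamma (pd (dg_word F n) e)) < +oo)%E;

  induced_C3 : forall n e (x : R), V e -> ((cyl F n e)°)%classic x ->
    (forall j, (j < 3)%N -> derivable (derive1n j (induced F e)) x 1) /\
    {for x, continuous (derive1n 3 (induced F e))};
  (* "Onto Delta" up to the end points, the cylinder being taken open. *)
  induced_onto : forall n e, V e ->
    induced F e @` ((cyl F n e)°)%classic = (Delta°)%classic;
  induced_expanding : forall e, V e -> exists2 lambda : R, 1 < lambda &
    forall n (x : R), ((cyl F n e)°)%classic x -> lambda <= `|derive1 (induced F e) x|;

  g_word_smooth : forall n, eps_smooth V Delta Delta 2 (g_word F n);
  g_word_derivable3 : forall n e x, V e -> Delta x ->
    derivable_in Delta (dern Delta 2 (g_word F n e)) x;
  bounded_distortion :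
    (sup_on setT (fun n => sup_on V (fun e =>
       sup_norm Delta (fun x =>
         (dern Delta 2 (g_word F n e) x / dern Delta 1 (g_word F n e) x)%R)))
     < +oo)%E;
  sum_dern_g_word : forall i, (2 <= i <= 3)%N ->
    (\sum_(0 <= n <oo) sup_on V (fun e =>
       sup_norm Delta (dern Delta i (g_word F n e))) < +oo)%E;
  sum_pd_dern_g_word : forall i, (1 <= i <= 2)%N ->
    (\sum_(0 <= n <oo) sup_on V (fun e =>
       sup_norm Delta (pd (fun e' => dern Delta i (g_word F n e')) e))
     < +oo)%E;

  half_in_closure : forall k : nat,
    closure (\bigcup_(n in [set n | (k <= n)%N]) cyl F n 0) (2^-1 : R)
}.

Section LinearResponse.
Context {R : realType}.
Variable F : map_family R.
Implicit Types (x : R) (n k i M N : nat) (f Phi : R -> R).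

Definition total_sum (u : nat -> R) : R := limn (series u).
Definition partial_sum N (u : nat -> R) : R := \sum_(n < N) u n.

Definition Lhat Phi x : R :=
  total_sum (fun n => Phi (g_word F n 0 x) * dg_word F n 0 x).

Definition A0 x : R := - (pd (induced F) 0 x / derive1 (induced F 0) x).

Definition B0 x : R :=
  pd (induced F) 0 x * derive1n 2 (induced F 0) x / (derive1 (induced F 0) x) ^+ 2
  - pd (fun e => derive1 (induced F e)) 0 x / derive1 (induced F 0) x.

Definition Wsource : R -> R :=
  Lhat (fun x => A0 x * der Delta (hhat F 0) x + B0 x * hhat F 0 x).

(* [hs] is the image of [Wsource] under the inverse of I - Lhat on the
   zero-average functions of L^1(Delta). *)
Definition is_induced_response (hs : R -> R) : Prop :=
  [/\ L1 hs, \int[mu]_(x in Delta) hs x = 0 &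
      L1_eq (fun x => hs x - Lhat hs x) Wsource].

Definition a_word n : R -> R := pd (g_word F n) 0.
Definition b_word n : R -> R := pd (dg_word F n) 0.

(* [sigma] is the summation over the words: [total_sum], or [partial_sum N] for
   the words of length at most [N]. *)
Definition F0 (sigma : (nat -> R) -> R) Phi x : R :=
  \1_Delta x * Phi x +
  (1 - \1_Delta x) *
    sigma (fun n => Phi (g_word F n 0 x) * dg_word F n 0 x).

Definition Q (sigma : (nat -> R) -> R) Phi x : R :=
  (1 - \1_Delta x) *
    sigma (fun n =>
      der Delta Phi (g_word F n 0 x) * (a_word n x * dg_word F n 0 x)
      + Phi (g_word F n 0 x) * b_word n x).

Definition response (hs : R -> R) x : R :=
  F0 total_sum hs x + Q total_sum (hhat F 0) x.

Definition delta k : R :=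
  fine (mu (\bigcup_(n in [set n | (k <= n)%N]) cyl F n 0)).

Definition affine_branch k x : R := delta k * (2 * x - 1) + 2^-1.

(* Transfer operator of the map which equals the induced map on
   [1/2 + delta k, 1] and is affine from [1/2, 1/2 + delta k) onto Delta. *)
Definition Lhat_delta k Phi x : R :=
  \sum_(n < k) Phi (g_word F n 0 x) * dg_word F n 0 x
  + 2 * delta k * Phi (affine_branch k x).

Definition mesh M : R := (2 * M%:R)^-1.
Definition node M i : R := 2^-1 + i%:R * mesh M.
Definition cell M i : set R := `[node M i, node M i.+1]%classic.
Definition hat M i x : R := Num.max 0 (1 - `|x - node M i| / mesh M).
Definition interp M f x : R := \sum_(i < M.+1) f (node M i) * hat M i x.

Definition Lh M k f : R -> R := interp M (Lhat_delta k (interp M f)).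

Definition Ph M k f x : R :=
  Lh M k f x +
  (fine (mu (@Delta R)))^-1 *
    (\int[mu]_(y in Delta) f y - \int[mu]_(y in Delta) Lh M k f y).

Definition admissible M k (zeta : nat -> nat -> R) : Prop :=
  forall n i, (n < k)%N -> (i < M)%N ->
    (g_word F n 0 @` cell M i) (zeta n i).

Definition coef M k (h : R -> R) (zeta : nat -> nat -> R) i : R :=
  \sum_(n < k) (mesh M)^-1 *
    \int[mu]_(z in g_word F n 0 @` cell M i)
      (A0 z * der Delta h (zeta n i) + B0 z * h (zeta n i))
  + (mesh M)^-1 *
    \int[mu]_(z in affine_branch k @` cell M i)
      (A0 z * der Delta h z + B0 z * h z).

Definition Wh M k h zeta x : R :=
  coef M k h zeta 0 * hat M 0 x
  + \sum_(1 <= i < M)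
      (coef M k h zeta i.-1 + coef M k h zeta i) / 2 * hat M i x
  + coef M k h zeta M.-1 * hat M M x.

Definition induced_response_approx M k (l : nat) h zeta x : R :=
  \sum_(n < l.+1) iter n (Ph M k) (Wh M k h zeta) x.

Definition response_approx M k (l : nat) N h zeta x : R :=
  F0 (partial_sum N) (induced_response_approx M k l h zeta) x
  + Q (partial_sum N) h x.

End LinearResponse.

(* Main.v *)
Require Import Defs.
From HB Require Import structures.
From mathcomp Require Import all_boot all_order all_algebra.
From mathcomp Require Import all_classical all_reals all_analysis.
From mathcomp Require Import measurable_realfun.
From mathcomp Require Import ring lra.

(** The operators of the theorem are free, and the invariant density [hhat F 0]
    of the induced map is itself continuously differentiable. It is therefore
    taken as [heta M] for every mesh, with the operator of rank one that sends
    [f] to its integral times this density. The error then comes only from the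
    discretization of the source and of the transfer operator, from the length
    of the Neumann series, and from the number of words.

    The inverse branches of the induced map contract uniformly and have bounded
    distortion. Its transfer operator [L] maps a cone of functions with
    Lipschitz logarithm into a smaller cone of the same kind, so that each step
    can subtract a fixed proportion of the mass as a constant
    ([cone_subtract]). Hence the iterates of a Lipschitz function of zero
    average decay exponentially, in supremum norm and in Lipschitz constant
    ([zero_mean_decay]). The same estimate produces the invariant density as a
    limit of iterates. Its derivative is Lipschitz, because quadratic Taylor
    bounds survive the iteration ([density_taylor]). By uniqueness it is
    [hhat F 0] ([hhat_density]).

    The functions [A0] and [B0] may be irregular near [1/2]. Implicit
    differentiation of [T e (g_word F n e y) = y] in the parameter gives
    [A0 (g y) = a y] and [B0 (g y) * g' y = b y], where [a] and [b] are the
    parameter derivatives of the branch [g] and of its derivative ([A0_word],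
    [B0_word]). So [Wsource F] agrees inside [Delta] with a uniformly convergent
    series of Lipschitz functions, [source], and the series of the [L^n source]
    converges to a Lipschitz function, [potential]. The given response equals
    [potential] almost everywhere ([response_potential]): the difference is an
    integrable fixed point of [L] of zero average. Its positive part is a fixed
    point too, hence an invariant density, and uniqueness leaves only zero
    ([zero_mean_fixed]).

    For a fixed number of steps, the discretized iterates follow [L^n source] up
    to a multiple of the mesh size ([Wh_close], [iterates_close]), when the
    truncation level makes the tails of finitely many convergent series smaller
    than the square of the mesh size. Thus the number of steps is fixed by the
    exponential decay, and then the mesh size is taken small.

    Outside [Delta], the sums that define the response are dominated by
    summable constants times [x `^ (- gamma)], which is integrable because
    [gamma < 1] ([response_pointwise], [powRN_integrable]). The equality almost
    everywhere on [Delta] is carried to [[0, 1]] by the branches: a point that a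
    branch sends into a null set either belongs to a null set or gives the
    branch a zero derivative ([ae_pullback]). *)


Set Implicit Arguments.
Unset Strict Implicit.
Unset Printing Implicit Defensive.

Import Order.TTheory GRing.Theory Num.Theory.
Import numFieldNormedType.Exports.

Local Open Scope classical_set_scope.
Local Open Scope ring_scope.

(** * Dominated series *)

Section Series.
Context {R : realType}.
Implicit Types (u v s : nat -> R).

Lemma dominated_cvg_series u s :
  (forall n, `|u n| <= s n) -> cvgn (series s) -> cvgn (series u).
Proof.
move=> us cs; apply: (@normed_cvg R R^o).
apply: (series_le_cvg _ _ us cs) => // n.
exact: le_trans (us n).
Qed.

Lemma normr_total_sum_le u s :
  (forall n, `|u n| <= s n) -> cvgn (series s) ->
  `|total_sum u| <= total_sum s.
Proof.
move=> us cs.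
have cn : cvgn [normed series u].
  by apply: (series_le_cvg _ _ us cs) => // n; exact: le_trans (us n).
apply: (le_trans (@lim_series_norm R R^o _ cn)).
exact: lim_series_le.
Qed.

Lemma total_sumD u v : cvgn (series u) -> cvgn (series v) ->
  total_sum (fun n => u n + v n) = total_sum u + total_sum v.
Proof. by move=> cu cv; rewrite -(lim_seriesD cu cv). Qed.

Lemma total_sumB u v : cvgn (series u) -> cvgn (series v) ->
  total_sum (fun n => u n - v n) = total_sum u - total_sum v.
Proof. by move=> cu cv; rewrite -(lim_seriesB cu cv). Qed.

Lemma total_sumZ c u : cvgn (series u) ->
  total_sum (fun n => c * u n) = c * total_sum u.
Proof. by move=> cu; rewrite -[RHS](@lim_seriesZ R u c cu). Qed.

Lemma cvg_seriesD u v : cvgn (series u) -> cvgn (series v) ->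
  cvgn (series (fun n => u n + v n)).
Proof. by move=> cu cv; have := is_cvg_seriesD cu cv. Qed.

Lemma cvg_seriesZ c u : cvgn (series u) -> cvgn (series (fun n => c * u n)).
Proof. by move=> cu; have := @is_cvg_seriesZ R u c cu. Qed.

Lemma ler_total_sum u v : cvgn (series u) -> cvgn (series v) ->
  (forall n, u n <= v n) -> total_sum u <= total_sum v.
Proof. exact: lim_series_le. Qed.

Lemma eq_total_sum u v : u =1 v -> total_sum u = total_sum v.
Proof. by move=> /funext ->. Qed.

Definition tail s N : R := total_sum s - partial_sum N s.

Lemma partial_sumE N s : partial_sum N s = series s N.
Proof. by rewrite /partial_sum /series/= big_mkord. Qed.

Lemma partial_sum_le_total s N : (forall n, 0 <= s n) -> cvgn (series s) ->
  partial_sum N s <= total_sum s.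
Proof.
move=> s0 cs; rewrite partial_sumE.
by apply: nondecreasing_cvgn_le => //; exact: nondecreasing_series.
Qed.

Lemma term_le_total s n : (forall n, 0 <= s n) -> cvgn (series s) ->
  s n <= total_sum s.
Proof.
move=> s0 cs; apply: le_trans (partial_sum_le_total n.+1 s0 cs).
by rewrite /partial_sum big_ord_recr/= lerDr sumr_ge0.
Qed.

Lemma total_sum_ge0 s : (forall n, 0 <= s n) -> cvgn (series s) ->
  0 <= total_sum s.
Proof. by move=> s0 cs; exact: le_trans (s0 0%N) (term_le_total 0 s0 cs). Qed.

Lemma tail_ge0 s N : (forall n, 0 <= s n) -> cvgn (series s) -> 0 <= tail s N.
Proof. by move=> s0 cs; rewrite subr_ge0 partial_sum_le_total. Qed.

Lemma tail_small s e : cvgn (series s) -> 0 < e ->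
  exists N0, forall N, (N0 <= N)%N -> tail s N <= e.
Proof.
move=> cs e0; have := cs => /cvgrPdist_le /(_ _ e0) [N0 _ H].
exists N0 => N N0N; rewrite /tail partial_sumE.
exact: le_trans (ler_norm _) (H _ N0N).
Qed.

Lemma total_sum_truncated u N :
  cvgn (series (fun n => if (n < N)%N then u n else 0)) /\
  total_sum (fun n => if (n < N)%N then u n else 0) = partial_sum N u.
Proof.
pose y n := if (n < N)%N then u n else 0.
have H : series y @ \oo --> partial_sum N u.
  apply: cvg_near_cst; exists N => //= n Nn.
  rewrite /series/= (big_cat_nat (n := N))//= [X in _ + X]big_nat_cond [X in _ + X]big1 ?addr0.
    by rewrite big_mkord; apply: eq_bigr => i _; rewrite /y ltn_ord.
  by move=> i /andP[/andP[Ni _] _]; rewrite /y ltnNge Ni.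
by split; [exact: cvgP H | exact: cvg_lim H].
Qed.

Lemma tail_dominated u s N : (forall n, `|u n| <= s n) -> cvgn (series s) ->
  `|total_sum u - partial_sum N u| <= tail s N.
Proof.
move=> us cs.
have cu := dominated_cvg_series us cs.
have [cus <-] := total_sum_truncated u N; have [css sE] := total_sum_truncated s N.
rewrite /tail -sE -!total_sumB//; apply: normr_total_sum_le.
  by move=> n; case: ifP => _; rewrite ?subrr ?normr0 ?subr0.
by have := is_cvg_seriesB cs css.
Qed.

Lemma tail_le u s N : (forall n, 0 <= u n) -> (forall n, u n <= s n) ->
  cvgn (series s) -> tail u N <= tail s N.
Proof.
move=> u0 us cs; apply: le_trans (ler_norm _) _; apply: tail_dominated => // n.
by rewrite ger0_norm.
Qed.

Lemma fin_summable (S : nat -> \bar R) : (forall n, 0 <= S n)%E ->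
  (\sum_(0 <= n <oo) S n < +oo)%E ->
  exists s, [/\ forall n, 0 <= s n, cvgn (series s) & forall n, S n = (s n)%:E].
Proof.
move=> S0 Soo.
have Sfin n : (S n < +oo)%E.
  apply: le_lt_trans Soo.
  apply: le_trans (nneseries_lim_ge n.+1 (fun k _ _ => S0 k)).
  by rewrite big_nat_recr//=; apply: leeDr; exact: sume_ge0.
have SE n : S n = (fine (S n))%:E.
  by rewrite fineK// ge0_fin_numE.
exists (fun n => fine (S n)); split => //.
- by move=> n; exact: fine_ge0.
- apply: nnseries_is_cvg => [n|]; first exact: fine_ge0.
  by under eq_eseriesr do rewrite -SE.
Qed.

Lemma nneseries_total_sum s : (forall n, 0 <= s n) -> cvgn (series s) ->
  (\sum_(0 <= n <oo) (s n)%:E = (total_sum s)%:E)%E.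
Proof.
move=> s0 cs; apply: cvg_lim => //.
rewrite (_ : (fun _ => _) = EFin \o series s); last first.
  by apply/funext => n /=; rewrite sumEFin.
by apply: cvg_EFin; [exact: nearW|exact: cs].
Qed.

Lemma nneseries_tail s N : (forall n, 0 <= s n) -> cvgn (series s) ->
  (\sum_(0 <= n <oo) (if (n < N)%N then 0 else s n)%:E = (tail s N)%:E)%E.
Proof.
move=> s0 cs; have [ct tE] := total_sum_truncated s N.
have E : (fun n => if (n < N)%N then 0 else s n) =1
    (fun n => s n - (if (n < N)%N then s n else 0)).
  by move=> n; case: ifP; rewrite ?subrr ?subr0.
rewrite nneseries_total_sum.
- by rewrite (eq_total_sum E) total_sumB// tE.
- by move=> n; case: ifP.
- apply: (dominated_cvg_series (s := s)) => // n.
  by case: ifP; rewrite ?normr0// ger0_norm.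
Qed.

End Series.

Section SupNorms.
Context {R : realType}.

Lemma sup_on_le (I : Type) (A : set I) (f : I -> \bar R) i :
  A i -> (f i <= sup_on A f)%E.
Proof. by move=> Ai; apply: ereal_sup_ubound; exists i. Qed.

Lemma sup_on_ge0 (I : Type) (A : set I) (f : I -> \bar R) :
  A !=set0 -> (forall i, A i -> 0 <= f i)%E -> (0 <= sup_on A f)%E.
Proof. by move=> [i Ai] f0; exact: le_trans (f0 _ Ai) (sup_on_le _ Ai). Qed.

Lemma sup_norm_ge0 (S : set R) (f : R -> R) : S !=set0 -> (0 <= sup_norm S f)%E.
Proof. by move=> S0; apply: sup_on_ge0 => // x _; rewrite lee_fin. Qed.

Lemma summable_sup_norm (V S : set R) (f : nat -> R -> R -> R) :
  V !=set0 -> S !=set0 ->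
  (\sum_(0 <= n <oo) sup_on V (fun e => sup_norm S (f n e)) < +oo)%E ->
  exists s : nat -> R, [/\ forall n, 0 <= s n, cvgn (series s) &
     forall n e x, V e -> S x -> `|f n e x| <= s n].
Proof.
move=> V0 S0 /(fin_summable _)[n|s [s0 cs sE]].
  by apply: sup_on_ge0 => // e _; exact: sup_norm_ge0.
exists s; split => // n e x Ve Sx; rewrite -lee_fin -sE.
apply: le_trans (sup_on_le _ Ve).
exact: (@sup_on_le _ _ (fun x => `|f n e x|%:E)).
Qed.

Lemma bounded_sup_norm (V S : set R) (f : nat -> R -> R -> R) :
  (sup_on setT (fun n => sup_on V (fun e => sup_norm S (f n e))) < +oo)%E ->
  exists2 C : R, 0 <= C & forall n e x, V e -> S x -> `|f n e x| <= C.
Proof.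
move=> foo.
set C := sup_on _ _ in foo.
exists (Num.max 0 (fine C)); first by rewrite le_max lexx.
move=> n e x Ve Sx.
have H : (`|f n e x|%:E <= C)%E.
  apply: le_trans (@sup_on_le _ setT _ n I).
  apply: le_trans (sup_on_le _ Ve).
  exact: (@sup_on_le _ _ (fun x => `|f n e x|%:E)).
rewrite le_max; apply/orP; right; rewrite -lee_fin fineK//.
rewrite ge0_fin_numE//; exact: le_trans H.
Qed.

End SupNorms.

(** * Lebesgue integrals: comparison and change of variables *)

Section LowerIntegral.
Local Open Scope ereal_scope.
Context d (T : measurableType d) (R : realType) (m : {measure set T -> \bar R}).
Implicit Types (D : set T) (f g : T -> \bar R).

(** The integral of a nonnegative function is the supremum of the integrals of
    the simple functions below it, hence monotone. This form is meant for
    integrands defined by limits and derivatives. *)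
Lemma le_nonneg_integral D f g :
  (forall x, D x -> 0 <= f x) -> (forall x, D x -> f x <= g x) ->
  \int[m]_(x in D) f x <= \int[m]_(x in D) g x.
Proof.
move=> f0 fg.
have g0 x : D x -> 0 <= g x by move=> Dx; exact: le_trans (f0 _ Dx) (fg _ Dx).
rewrite !ge0_integralE//; apply: le_ereal_sup => _ [h hf <-]; exists h => //.
move=> x; apply: le_trans (hf x) _; rewrite !patchE; case: ifPn => // /set_mem.
exact: fg.
Qed.

Lemma le_ae_nonneg_integral D f g (N : set T) : measurable D -> measurable N ->
  m N = 0 ->
  (forall x, D x -> 0 <= f x) -> (forall x, D x -> 0 <= g x) ->
  measurable_fun D g ->
  (forall x, D x -> ~ N x -> f x <= g x) ->
  \int[m]_(x in D) f x <= \int[m]_(x in D) g x.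
Proof.
move=> mD mN N0 f0 g0 mg fg.
pose g' x := if x \in N then +oo else g x.
apply: (@le_trans _ _ (\int[m]_(x in D) g' x)).
  apply: le_nonneg_integral => // x Dx; rewrite /g'; case: ifPn => [_|].
    exact: leey.
  by rewrite notin_setE; exact: fg.
rewrite le_eqVlt; apply/orP; left; apply/eqP; apply: ge0_ae_eq_integral => //.
- apply: measurable_fun_if => //.
    apply: (measurable_fun_bool true) => //.
    rewrite (_ : _ @^-1` _ = N); first exact: measurableI.
    by apply/seteqP; split => x /=; [move/set_mem|move/mem_set].
  by apply: measurable_funS mg => //; exact: subIsetl.
- by move=> x Dx; rewrite /g'; case: ifPn => // _; exact: g0.
- exists N; split => // x /=; apply: contra_notP => Nx Dx.
  by rewrite /g'; case: ifPn => // /set_mem.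
Qed.

End LowerIntegral.

Section PushedDensity.
Local Open Scope ereal_scope.
Context d d' (T : measurableType d) (U : measurableType d') (R : realType).
Variables (m : {measure set T -> \bar R}) (f : T -> R) (p : T -> U).
Hypotheses (mf : measurable_fun setT f) (f0 : forall x, (0 <= f x)%R).
Hypothesis mp : measurable_fun setT p.

Definition pushed_density of measurable_fun setT f & (forall x, 0 <= f x)%R
    & measurable_fun setT p :=
  fun A : set U => \int[m]_(x in p @^-1` A) (f x)%:E.

Local Notation nu := (pushed_density mf f0 mp).

Let preimage_measurable A : measurable A -> measurable (p @^-1` A).
Proof. by move=> mA; rewrite -[X in measurable X]setTI; exact: mp. Qed.

Let nu0 : nu set0 = 0.
Proof. by rewrite /pushed_density preimage_set0 integral_set0. Qed.

Let nu_ge0 A : 0 <= nu A.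
Proof. by apply: integral_ge0 => x _; rewrite lee_fin. Qed.

Let nu_additive : semi_sigma_additive nu.
Proof.
move=> A mA tA mUA; rewrite /pushed_density preimage_bigcup.
rewrite ge0_integral_bigcup//.
- apply: is_cvg_ereal_nneg_natsum_cond => n _ _.
  by apply: integral_ge0 => x _; rewrite lee_fin.
- by move=> n; exact: preimage_measurable.
- by apply/measurable_EFinP; exact: measurable_funTS.
- by move=> x _; rewrite lee_fin.
- apply/trivIsetP => i j _ _ ij; rewrite -preimage_setI.
  by move/trivIsetP : tA => /(_ _ _ I I ij) ->//; rewrite preimage_set0.
Qed.

HB.instance Definition _ := isMeasure.Build _ _ _ nu nu0 nu_ge0 nu_additive.

Import HBNNSimple.

Lemma integral_pushed_density (phi : U -> \bar R) :
  measurable_fun setT phi -> (forall x, 0 <= phi x) ->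
  \int[nu]_y phi y = \int[m]_x (phi (p x) * (f x)%:E).
Proof.
move=> mphi phi0.
pose h := nnsfun_approx measurableT mphi.
have hcvg x : EFin \o (h^~ x) @ \oo --> phi x by exact: cvg_nnsfun_approx.
have hnd x : {homo h^~ x : n k / (n <= k)%N >-> (n <= k)%R}.
  by move=> n k nk; exact/lefP/nd_nnsfun_approx.
have mfE : measurable_fun setT (EFin \o f) by exact/measurable_EFinP.
have mhE n : measurable_fun setT (fun x => (h n (p x))%:E).
  apply/measurable_EFinP; apply: measurableT_comp => //; exact: measurable_funP.
have simple n : \int[nu]_x (h n x)%:E = \int[m]_x ((h n (p x))%:E * (f x)%:E).
  rewrite integralT_nnsfun sintegralE.
  have hE x : (h n (p x))%:E * (f x)%:E = \sum_(y \in range (h n))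
      (y%:E * ((\1_(h n @^-1` [set y]) (p x))%:E * (f x)%:E)).
    rewrite fimfunE -fsumEFin// ge0_mule_fsuml.
      by apply: eq_fsbigr => y _; rewrite EFinM muleA.
    by move=> y; rewrite EFinM; exact: nnfun_muleindic_ge0.
  under [RHS]eq_integral => x _ do rewrite hE.
  have mI y : measurable_fun setT
      (fun x => (\1_(h n @^-1` [set y]) (p x))%:E * (f x)%:E : \bar R).
    apply: emeasurable_funM => //; apply/measurable_EFinP.
    by apply: measurableT_comp => //; exact: measurable_indic.
  rewrite ge0_integral_fsum//.
  - apply: eq_fsbigr => y yh.
    have y0 : 0 <= y%:E by move: yh => /set_mem[x _ <-]; rewrite lee_fin.
    rewrite ge0_integralZl//.
    + congr (_ * _); rewrite /= /pushed_density integral_mkcond.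
      apply: eq_integral => x _; rewrite patchE indicE.
      have -> : (x \in p @^-1` (h n @^-1` [set y])) = (p x \in h n @^-1` [set y]).
        by apply/idP/idP; rewrite !inE.
      by case: ifPn => _; rewrite ?mul1e ?mul0e.
    + by move=> x _; rewrite mule_ge0// lee_fin.
  - by move=> y; apply: emeasurable_funM.
  - move=> y x _; rewrite muleA mule_ge0 ?lee_fin//.
    exact: nnfun_muleindic_ge0.
transitivity (limn (fun n => \int[nu]_x (h n x)%:E)).
  rewrite -monotone_convergence//.
  - by apply: eq_integral => x _; apply/esym/cvg_lim => //; exact: hcvg.
  - by move=> n; exact/measurable_EFinP/measurable_funP.
  - by move=> n x _; rewrite lee_fin.
  - by move=> x _ n k nk; rewrite lee_fin hnd.
under eq_fun do rewrite simple.
rewrite -monotone_convergence//.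
- apply: eq_integral => x _; apply/cvg_lim => //.
  by apply: cvgeZr => //; exact: hcvg.
- by move=> n; exact: emeasurable_funM.
- by move=> n x _; rewrite mule_ge0// lee_fin.
- by move=> x _ n k nk; rewrite lee_wpmul2r ?lee_fin// hnd.
Qed.

End PushedDensity.

Section ChangeOfVariables.
Local Open Scope ereal_scope.
Context {R : realType}.
Variables (g d : R -> R) (a b : R).
Hypothesis ab : (a < b)%R.
Hypothesis g_incr : {in `[a, b] &, {homo g : x y / (x < y)%R}}.
Hypothesis g_cont : {within `[a, b], continuous g}.
Hypothesis d_cont : {within `[a, b], continuous d}.
Hypothesis d_ge0 : forall x, x \in `[a, b] -> (0 <= d x)%R.
Hypothesis g_deriv : forall x, x \in `]a, b[ -> is_derive (x : R) 1%R g (d x).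

Let J : set R := `]a, b]%classic.
Let gJ : set R := `]g a, g b]%classic.

Let JE x : J x -> x \in `[a, b].
Proof. by rewrite /J/= !in_itv/= => /andP[/ltW -> ->]. Qed.

Let aI : a \in `[a, b]. Proof. by rewrite in_itv/= lexx ltW. Qed.
Let bI : b \in `[a, b]. Proof. by rewrite in_itv/= lexx ltW. Qed.

Let g_mono : {in `[a, b] &, {mono g : x y / (x < y)%R}}.
Proof. by apply: leW_mono_in; exact: le_mono_in. Qed.

Let g_monoW : {in `[a, b] &, {mono g : x y / (x <= y)%R}}.
Proof. exact: le_mono_in. Qed.

Let measurable_restr (f : R -> R) : {within `[a, b], continuous f} ->
  measurable_fun J f.
Proof.
move=> cf; apply: (@measurable_funS _ _ _ _ `[a, b]%classic) => //.
  by apply: subspace_continuous_measurable_fun.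
Qed.

Let FTC c e : c \in `[a, b] -> e \in `[a, b] -> (c < e)%R ->
  \int[mu]_(x in `]c, e]) (d x)%:E = (g e - g c)%:E.
Proof.
move=> /[!in_itv]/= /andP[ac cb] /andP[ae eb] ce.
have sub : `[c, e] `<=` `[a, b].
  by apply: subset_itv; rewrite bnd_simp.
have dce : {within `[c, e], continuous d} by exact: continuous_subspaceW d_cont.
have gce : {within `[c, e], continuous g} by exact: continuous_subspaceW g_cont.
rewrite integral_itv_obnd_cbnd; last first.
  apply/measurable_EFinP; apply: (@measurable_funS _ _ _ _ `[c, e]%classic) => //.
    exact: subset_itv_oc_cc.
  exact: subspace_continuous_measurable_fun.
rewrite EFinB; apply: continuous_FTC2 => //.
- split.
  + move=> x /[!in_itv]/= /andP[cx xe]; apply: ex_derive.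
    by apply: g_deriv; rewrite in_itv/= (le_lt_trans ac cx) (lt_le_trans xe eb).
  + by move/(continuous_within_itvP _ ce) : gce => [].
  + by move/(continuous_within_itvP _ ce) : gce => [].
- move=> x /[!in_itv]/= /andP[cx xe]; rewrite derive1E; apply: derive_val.
  by apply: g_deriv; rewrite in_itv/= (le_lt_trans ac cx) (lt_le_trans xe eb).
Qed.



Let gT : R -> R := g \_ J.
Let dT : R -> R := d \_ J.

Let mgT : measurable_fun setT gT.
Proof.
by apply/(measurable_restrictT _ (measurable_itv _)); exact: measurable_restr.
Qed.

Let mdT : measurable_fun setT dT.
Proof.
by apply/(measurable_restrictT _ (measurable_itv _)); exact: measurable_restr.
Qed.

Let dT0 x : (0 <= dT x)%R.
Proof.
by rewrite /dT patchE; case: ifPn => // /set_mem Jx; apply: d_ge0; exact: JE.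
Qed.



Let nu := @pushed_density _ _ (measurableTypeR R) (measurableTypeR R) R mu
  dT gT mdT dT0 mgT.
Let mgJ : measurable gJ. Proof. exact: measurable_itv. Qed.

Let nuE (A : set (measurableTypeR R)) : measurable A ->
  nu A = \int[mu]_(x in J `&` g @^-1` A) (d x)%:E.
Proof.
move=> mA; rewrite /nu /pushed_density.
rewrite integral_mkcond [RHS]integral_mkcond; apply: eq_integral => x _.
rewrite /dT /gT !patchE; have [xJ|xJ] := boolP (x \in J).
  have -> : (x \in patch (fun=> point) J g @^-1` A) = (x \in J `&` g @^-1` A).
    apply/idP/idP; rewrite !inE/= patchE xJ; last by case.
    by split => //; exact/set_mem.
  by [].
by rewrite if_same memNset// => -[/mem_set Jx]; move: xJ; rewrite Jx.
Qed.

Let gJ_J x : J x -> gJ (g x).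
Proof.
move=> Jx; have xI := JE Jx; move: Jx; rewrite /J /gJ/= !in_itv/= => /andP[ax xb].
by rewrite g_mono ?ax ?g_monoW.
Qed.

Let nu_ocitv c e : nu `]c, e]%classic = mu (`]c, e]%classic `&` gJ).
Proof.
rewrite nuE//.
pose c' := Num.max c (g a); pose e' := Num.min e (g b).
have ceE : `]c, e]%classic `&` gJ = `]c', e']%classic.
  apply/seteqP; split => x; rewrite /gJ/= !in_itv/= gt_max le_min.
    by move=> [/andP[-> ->]] /andP[-> ->].
  by move=> /andP[/andP[-> ->] /andP[-> ->]].
have JgE : J `&` g @^-1` `]c, e]%classic = J `&` g @^-1` `]c', e']%classic.
  rewrite -ceE preimage_setI setIA; apply/seteqP; split => x; last by case.
  by move=> [Jx cx]; do !split => //; exact: gJ_J.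
rewrite ceE JgE /mu lebesgue_measure_itv/= lte_fin.
case: ltP => [ce|ec]; last first.
  rewrite (_ : _ `&` _ = set0) ?integral_set0//.
  rewrite -subset0 => x [Jx]; rewrite /= in_itv/= => /andP[cx xe].
  by have := lt_le_trans cx (le_trans xe ec); rewrite ltxx.
have IVTg v : (g a <= v <= g b)%R -> exists2 x, x \in `[a, b] & g x = v.
  move=> avb; apply: (IVT (ltW ab)) => //.
  by rewrite min_l ?max_r// g_monoW// ltW.
have [x xI gx] : exists2 x, x \in `[a, b] & g x = c'.
  apply: IVTg; rewrite le_max lexx orbT/=.
  by rewrite (le_trans (ltW ce))// ge_min lexx orbT.
have [y yI gy] : exists2 x, x \in `[a, b] & g x = e'.
  apply: IVTg; rewrite ge_min lexx orbT andbT.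
  by rewrite (le_trans _ (ltW ce))// le_max lexx orbT.
have xy : (x < y)%R by rewrite -g_mono// gx gy.
rewrite -gx -gy -EFinB -FTC//; congr integral.
apply/seteqP; split => z; rewrite /J/= !in_itv/=.
  move=> [/andP[az zb]]; have zI : z \in `[a, b] by rewrite in_itv/= zb ltW.
  by rewrite g_mono// g_monoW.
move=> /andP[xz zy]; have zI : z \in `[a, b].
  move: xI yI; rewrite !in_itv/= => /andP[ax _] /andP[_ yb].
  by rewrite (le_trans ax (ltW xz)) (le_trans zy yb).
rewrite g_mono// g_monoW// xz zy; split => //.
move: xI zI; rewrite !in_itv/= => /andP[ax _] /andP[_ ->].
by rewrite (le_lt_trans ax xz).
Qed.

Let mu_nu (A : set (measurableTypeR R)) : measurable A -> A `<=` gJ -> nu A = mu A.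
Proof.
move=> mA AgJ.
have -> : mu A = measure_add nu (mrestr mu (measurableC mgJ)) A.
  apply: lebesgue_measure_unique => // X [[c e] _ <-].
  apply: (etrans _ (esym (measure_addE nu (mrestr mu (measurableC mgJ)) _))).
  rewrite [LHS](@measureDI _ _ _ mu _ gJ)//.
  by rewrite addeC; congr (_ + _); exact/esym/nu_ocitv.
rewrite measure_addE /= /mrestr (_ : A `&` ~` gJ = set0) ?measure0 ?adde0//.
by rewrite -subset0 => x [/AgJ].
Qed.

(** Both sides are measures of the set integrated over: for half-open intervals
    they agree by the fundamental theorem of calculus, hence they agree for
    all Borel sets and then for all integrands. *)
Lemma ge0_change_of_variables (phi : R -> \bar R) :
  measurable_fun `]g a, g b]%classic phi ->
  (forall y, y \in `]g a, g b] -> 0 <= phi y) ->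
  \int[mu]_(x in `]a, b]) (phi (g x) * (d x)%:E) =
  \int[mu]_(y in `]g a, g b]) phi y.
Proof.
move=> mphi phi0.
pose phiT := phi \_ gJ.
have mphiT : measurable_fun setT phiT by apply/(measurable_restrictT _ mgJ).
have phiT0 y : 0 <= phiT y.
  by rewrite /phiT patchE; case: ifPn => // /set_mem; exact: phi0.
transitivity (\int[nu]_x phiT x).
  rewrite integral_pushed_density//.
  rewrite [LHS]integral_mkcond; apply: eq_integral => x _.
  rewrite /gT /dT /phiT !patchE; case: ifPn => [/set_mem Jx|]; last by rewrite mule0.
  by case: ifPn => // /negP[]; apply: mem_set; exact: gJ_J.
rewrite /phiT -integral_mkcond; apply: eq_measure_integral => A mA AgJ.
exact: mu_nu.
Qed.

End ChangeOfVariables.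

(** * Transfer operators of full-branch expanding maps *)

Section DeltaFunctions.
Context {R : realType}.
Implicit Types (f g : R -> R) (x y K B : R).

Definition bounded_by B f := forall x, Delta x -> `|f x| <= B.

Definition lipschitz_by K f :=
  forall x y, Delta x -> Delta y -> `|f x - f y| <= K * `|x - y|.

Definition mean f : R := \int[mu]_(x in Delta) f x.

Lemma DeltaP x : Delta x <-> 2^-1 <= x <= 1.
Proof. by rewrite /Delta/= in_itv. Qed.

Lemma Delta1 : Delta (1 : R).
Proof. by apply/DeltaP; lra. Qed.

Lemma Delta_dist x y : Delta x -> Delta y -> `|x - y| <= 1.
Proof. by move=> /DeltaP ? /DeltaP ?; rewrite ler_norml; lra. Qed.

Lemma measurable_Delta : measurable (@Delta R : set (measurableTypeR R)).
Proof. exact: measurable_itv. Qed.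

Lemma mu_Delta : mu (@Delta R) = (2^-1)%:E.
Proof.
rewrite /mu /Delta lebesgue_measure_itv/= lte_fin ifT; last by lra.
by rewrite -EFinD; congr EFin; lra.
Qed.

Lemma continuous_Delta_integrable f : {within Delta, continuous f} -> L1 f.
Proof.
by move=> cf; apply: continuous_compact_integrable => //; exact: segment_compact.
Qed.

Lemma lipschitz_continuous (A : set R) K f :
  (forall x y, A x -> A y -> `|f x - f y| <= K * `|x - y|) ->
  {within A, continuous f}.
Proof.
move=> fK; apply/subspace_continuousP => x Ax.
have K0 : 0 < `|K| + 1 by rewrite ltr_pwDr.
apply/cvgrPdist_le => e e0.
rewrite near_withinE; near=> y => Ay.
apply: (le_trans (fK _ _ Ax Ay)).
apply: (@le_trans _ _ ((`|K| + 1) * `|x - y|)).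
  by rewrite ler_wpM2r// (le_trans (ler_norm K))// lerDl.
rewrite mulrC -ler_pdivlMr//; near: y.
by apply: cvgr_dist_le => //; rewrite divr_gt0.
Unshelve. all: by end_near. Qed.

Lemma lipschitz_by_continuous K f :
  lipschitz_by K f -> {within Delta, continuous f}.
Proof. exact: lipschitz_continuous. Qed.

Lemma lipschitz_by_L1 K f : lipschitz_by K f -> L1 f.
Proof. by move/lipschitz_by_continuous/continuous_Delta_integrable. Qed.

Lemma mean_cst c : mean (fun=> c) = c / 2.
Proof. rewrite /mean (Rintegral_cst _ measurable_Delta).
congr (_ * _); transitivity (fine (2^-1)%:E : R) => //.
by congr fine; exact: mu_Delta.
Qed.

Lemma L1_cst c : L1 (fun=> c : R).
Proof. by apply: (@lipschitz_by_L1 0) => x y _ _; rewrite subrr normr0 mul0r. Qed.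

Lemma L1D f g : L1 f -> L1 g -> L1 (fun x => f x + g x).
Proof. by move=> hf hg; exact: (integrableD measurable_Delta hf hg). Qed.

Lemma L1Z c f : L1 f -> L1 (fun x => c * f x).
Proof. by move=> hf; exact: (integrableZl measurable_Delta c hf). Qed.

Lemma L1B f g : L1 f -> L1 g -> L1 (fun x => f x - g x).
Proof. by move=> hf hg; exact: (integrableB measurable_Delta hf hg). Qed.

Lemma meanD f g : L1 f -> L1 g -> mean (fun x => f x + g x) = mean f + mean g.
Proof. exact: (RintegralD measurable_Delta). Qed.

Lemma meanB f g : L1 f -> L1 g -> mean (fun x => f x - g x) = mean f - mean g.
Proof. exact: (RintegralB measurable_Delta). Qed.

Lemma meanZ c f : L1 f -> mean (fun x => c * f x) = c * mean f.
Proof. exact: (RintegralZl c measurable_Delta). Qed.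

Lemma eq_mean f g : (forall x, Delta x -> f x = g x) -> mean f = mean g.
Proof. by move=> fg; apply: eq_Rintegral => x /set_mem; exact: fg. Qed.

Lemma ler_mean f g : L1 f -> L1 g ->
  (forall x, Delta x -> f x <= g x) -> mean f <= mean g.
Proof. exact: (le_Rintegral measurable_Delta). Qed.

Lemma mean_bound f B : L1 f -> bounded_by B f -> `|mean f| <= B / 2.
Proof.
move=> hf fB; rewrite ler_norml; apply/andP; split.
  rewrite -mulNr -mean_cst; apply: ler_mean => //; first exact: L1_cst.
  by move=> x /fB; rewrite ler_norml => /andP[].
rewrite -mean_cst; apply: ler_mean => //; first exact: L1_cst.
by move=> x /fB; rewrite ler_norml => /andP[].
Qed.

Lemma bounded_byD B C f g : bounded_by B f -> bounded_by C g ->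
  bounded_by (B + C) (fun x => f x + g x).
Proof. by move=> fB gC x Dx; rewrite (le_trans (ler_normD _ _))// lerD ?fB ?gC. Qed.

Lemma bounded_byB B C f g : bounded_by B f -> bounded_by C g ->
  bounded_by (B + C) (fun x => f x - g x).
Proof. by move=> fB gC x Dx; rewrite (le_trans (ler_normB _ _))// lerD ?fB ?gC. Qed.

Lemma lipschitz_byD B C f g : lipschitz_by B f -> lipschitz_by C g ->
  lipschitz_by (B + C) (fun x => f x + g x).
Proof.
move=> fB gC x y Dx Dy; rewrite mulrDl opprD addrACA.
by rewrite (le_trans (ler_normD _ _))// lerD ?fB ?gC.
Qed.

Lemma lipschitz_byB B C f g : lipschitz_by B f -> lipschitz_by C g ->
  lipschitz_by (B + C) (fun x => f x - g x).
Proof.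
move=> fB gC x y Dx Dy; rewrite mulrDl opprB.
rewrite (_ : _ - _ + _ = (f x - f y) - (g x - g y)); last by lra.
by rewrite (le_trans (ler_normB _ _))// lerD ?fB ?gC.
Qed.

Lemma lipschitz_by_cst c : lipschitz_by 0 (fun=> c : R).
Proof. by move=> x y _ _; rewrite subrr normr0 mul0r. Qed.

Lemma expR_sub1_le (t : R) : expR t - 1 <= t * expR t.
Proof.
have := expR_ge1Dx (- t).
rewrite -(ler_pM2r (expR_gt0 t)) -expRD addNr expR0; lra.
Qed.

End DeltaFunctions.

(** [G n], [G1 n] and [G2 n] are the inverse branches of the map with their first
    two derivatives, [s] dominates the branches, [rho] is the contraction rate
    and [D] the distortion. *)
Record expanding_system (R : realType) (G G1 G2 : nat -> R -> R)
    (s : nat -> R) (rho D : R) : Prop := {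
  es_Delta : forall n x, Delta x -> Delta (G n x);
  es_rho : 0 <= rho < 1;
  es_D : 0 <= D;
  es_s_ge0 : forall n, 0 <= s n;
  es_s_cvg : cvgn (series s);
  es_contract : forall n x y, Delta x -> Delta y ->
    `|G n x - G n y| <= rho * `|x - y|;
  es_G1_ge0 : forall n x, Delta x -> 0 <= G1 n x;
  es_G1_rho : forall n x, Delta x -> G1 n x <= rho;
  es_G1_s : forall n x, Delta x -> G1 n x <= s n;
  es_G1_lip : forall n, lipschitz_by (s n) (G1 n);
  es_distortion : forall n x y, Delta x -> Delta y ->
    G1 n x <= expR (D * `|x - y|) * G1 n y;
  es_G2_D : forall n x, Delta x -> `|G2 n x| <= D * G1 n x;
  es_taylor0 : forall n x y, Delta x -> Delta y ->
    `|G n y - G n x - G1 n x * (y - x)| <= s n * (y - x) ^+ 2;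
  es_taylor1 : forall n x y, Delta x -> Delta y ->
    `|G1 n y - G1 n x - G2 n x * (y - x)| <= s n * (y - x) ^+ 2;
  es_mean : forall f : R -> R, {within Delta, continuous f} ->
    mean (fun x => total_sum (fun n => f (G n x) * G1 n x)) = mean f
}.

Section TransferOperator.
Context {R : realType} {G G1 G2 : nat -> R -> R} {s : nat -> R} {rho D : R}.
Hypothesis ES : expanding_system G G1 G2 s rho D.
Implicit Types (f g w : R -> R) (x y K B : R) (n : nat).

Definition transfer (G G1 : nat -> R -> R) f x : R :=
  total_sum (fun n => f (G n x) * G1 n x).

Local Notation L := (transfer G G1).
Local Notation S := (total_sum s).

Let s0 := es_s_ge0 ES.
Let cs := es_s_cvg ES.

Let rho0 : 0 <= rho. Proof. by case/andP: (es_rho ES). Qed.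
Let rho1 : rho < 1. Proof. by case/andP: (es_rho ES). Qed.
Let D0 := es_D ES.

Lemma S_ge0 : 0 <= S. Proof. exact: total_sum_ge0. Qed.

Lemma normr_G1 n x : Delta x -> `|G1 n x| <= s n.
Proof. by move=> Dx; rewrite ger0_norm ?(es_G1_s ES)// (es_G1_ge0 ES). Qed.

Lemma transfer_term_bound B f n x : bounded_by B f -> Delta x ->
  `|f (G n x) * G1 n x| <= B * s n.
Proof.
move=> fB Dx; rewrite normrM ler_pM//; last exact: normr_G1.
by apply: fB; exact: (es_Delta ES).
Qed.

Lemma transfer_cvg B f x : bounded_by B f -> Delta x ->
  cvgn (series (fun n => f (G n x) * G1 n x)).
Proof.
move=> fB Dx; apply: (@dominated_cvg_series _ _ (fun n => B * s n)).
  by move=> n; exact: transfer_term_bound.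
exact: cvg_seriesZ.
Qed.

Lemma transfer_bounded B f : bounded_by B f -> bounded_by (S * B) (L f).
Proof.
move=> fB x Dx; rewrite mulrC -total_sumZ//; apply: normr_total_sum_le.
  by move=> n; exact: transfer_term_bound.
exact: cvg_seriesZ.
Qed.

Lemma eq_transfer f g : (forall x, Delta x -> f x = g x) ->
  forall x, Delta x -> L f x = L g x.
Proof.
by move=> fg x Dx; apply: eq_total_sum => n; rewrite fg//; exact: (es_Delta ES).
Qed.

Lemma transferD B C f g x : bounded_by B f -> bounded_by C g -> Delta x ->
  L (fun y => f y + g y) x = L f x + L g x.
Proof.
move=> fB gC Dx; rewrite -total_sumD; [|exact: transfer_cvg fB _|exact: transfer_cvg gC _].
by apply: eq_total_sum => n; rewrite mulrDl.
Qed.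

Lemma transferB B C f g x : bounded_by B f -> bounded_by C g -> Delta x ->
  L (fun y => f y - g y) x = L f x - L g x.
Proof.
move=> fB gC Dx; rewrite -total_sumB; [|exact: transfer_cvg fB _|exact: transfer_cvg gC _].
by apply: eq_total_sum => n; rewrite mulrBl.
Qed.

Lemma transfer_lipschitz B K f : 0 <= B -> 0 <= K -> bounded_by B f ->
  lipschitz_by K f -> lipschitz_by (S * (K + B)) (L f).
Proof.
move=> B0 K0 fB fK x y Dx Dy.
rewrite -total_sumB; [|exact: transfer_cvg fB _|exact: transfer_cvg fB _].
have -> : S * (K + B) * `|x - y| = total_sum (fun n => (K + B) * `|x - y| * s n).
  by rewrite total_sumZ//; ring.
apply: normr_total_sum_le; last exact: cvg_seriesZ.
move=> n.
have -> : f (G n x) * G1 n x - f (G n y) * G1 n y =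
  (f (G n x) - f (G n y)) * G1 n x + f (G n y) * (G1 n x - G1 n y) by ring.
apply: (le_trans (ler_normD _ _)); rewrite !normrM -mulrA mulrDl.
have DGx := es_Delta ES n Dx; have DGy := es_Delta ES n Dy.
apply: lerD.
  rewrite mulrA; apply: ler_pM => //; last exact: normr_G1.
  apply: (le_trans (fK _ _ DGx DGy)); rewrite ler_wpM2l//.
  apply: (le_trans (es_contract ES n Dx Dy)).
  by rewrite ler_piMl// ltW.
rewrite [`|x - y| * _]mulrC; apply: ler_pM => //; first exact: fB.
exact: (es_G1_lip ES).
Qed.

Lemma mean_transfer f : {within Delta, continuous f} -> mean (L f) = mean f.
Proof. exact: (es_mean ES). Qed.

(** The Lipschitz condition on the logarithm, in a form that allows zeros. *)
Definition log_lipschitz K f := (forall x, Delta x -> 0 <= f x) /\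
  forall x y, Delta x -> Delta y -> f x <= expR (K * `|x - y|) * f y.

Lemma log_lipschitz_le K K' f : K <= K' -> log_lipschitz K f -> log_lipschitz K' f.
Proof.
move=> KK' [f0 fK]; split => // x y Dx Dy; apply: (le_trans (fK _ _ Dx Dy)).
by rewrite ler_wpM2r ?f0// ler_expR ler_wpM2r.
Qed.

Lemma log_lipschitz_ratio K f x y : 0 <= K -> log_lipschitz K f ->
  Delta x -> Delta y -> f x <= expR K * f y.
Proof.
move=> K0 [f0 fK] Dx Dy; apply: (le_trans (fK _ _ Dx Dy)).
by rewrite ler_wpM2r ?f0// ler_expR ler_piMr// Delta_dist.
Qed.

Lemma log_lipschitz_bounded0 K f : 0 <= K -> log_lipschitz K f ->
  bounded_by (expR K * f 1) f.
Proof.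
move=> K0 fK x Dx; rewrite ger0_norm; last by case: fK => + _; apply.
by apply: log_lipschitz_ratio => //; exact: Delta1.
Qed.

Lemma log_lipschitz_lipschitz K f B : 0 <= K -> log_lipschitz K f ->
  bounded_by B f -> lipschitz_by (K * expR K * B) f.
Proof.
move=> K0 [f0 fK] fB.
have half x y : Delta x -> Delta y -> f x - f y <= K * expR K * B * `|x - y|.
  move=> Dx Dy.
  have Kd : 0 <= K * `|x - y| by rewrite mulr_ge0.
  apply: (@le_trans _ _ ((expR (K * `|x - y|) - 1) * f y)).
    by rewrite mulrBl mul1r lerB ?fK.
  apply: (@le_trans _ _ (K * `|x - y| * expR K * B)); last first.
    by rewrite le_eqVlt; apply/orP; left; apply/eqP; ring.
  apply: ler_pM; rewrite ?f0//.
  - by rewrite subr_ge0 -expR0 ler_expR.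
  - apply: (le_trans (expR_sub1_le _)).
    by rewrite ler_wpM2l// ler_expR ler_piMr// Delta_dist.
  - exact: le_trans (ler_norm _) (fB _ Dy).
move=> x y Dx Dy; rewrite ler_norml half// andbT lerNl opprB distrC.
exact: half.
Qed.

Lemma log_lipschitz_L1 K f : 0 <= K -> log_lipschitz K f -> L1 f.
Proof.
move=> K0 fK; apply: lipschitz_by_L1.
exact: log_lipschitz_lipschitz K0 fK (log_lipschitz_bounded0 K0 fK).
Qed.

Lemma log_lipschitz_continuous K f : 0 <= K -> log_lipschitz K f ->
  {within Delta, continuous f}.
Proof.
move=> K0 fK; apply: lipschitz_by_continuous.
exact: log_lipschitz_lipschitz K0 fK (log_lipschitz_bounded0 K0 fK).
Qed.

Lemma log_lipschitz_le_mean K f x : 0 <= K -> log_lipschitz K f -> Delta x ->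
  f x <= 2 * expR K * mean f.
Proof.
move=> K0 fK Dx.
have f1 := log_lipschitz_L1 K0 fK.
suff : f x / 2 <= expR K * mean f by lra.
rewrite -meanZ// -mean_cst; apply: ler_mean; [exact: L1_cst|exact: L1Z|].
by move=> y Dy; exact: log_lipschitz_ratio.
Qed.

Lemma log_lipschitz_ge_mean K f x : 0 <= K -> log_lipschitz K f -> Delta x ->
  2 * mean f <= expR K * f x.
Proof.
move=> K0 fK Dx.
have f1 := log_lipschitz_L1 K0 fK.
suff : mean f <= expR K * f x / 2 by lra.
rewrite -mean_cst; apply: ler_mean; [by []|exact: L1_cst|].
by move=> y Dy; exact: log_lipschitz_ratio.
Qed.

Lemma log_lipschitz_mean_ge0 K f : 0 <= K -> log_lipschitz K f -> 0 <= mean f.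
Proof.
move=> K0 fK; have : mean (fun=> 0 : R) = 0 by rewrite mean_cst mul0r.
move=> <-; apply: ler_mean; [exact: L1_cst|exact: log_lipschitz_L1 fK|].
by case: fK.
Qed.

Lemma transfer_ge0 f x : (forall y, Delta y -> 0 <= f y) -> Delta x ->
  (exists B, bounded_by B f) -> 0 <= L f x.
Proof.
move=> f0 Dx [B fB]; apply: total_sum_ge0; last exact: transfer_cvg fB Dx.
by move=> n; rewrite mulr_ge0 ?f0 ?(es_G1_ge0 ES)//; exact: (es_Delta ES).
Qed.

(** Contraction of the branches improves the constant of the cone, up to the
    distortion. *)
Lemma transfer_log_lipschitz K f : 0 <= K -> log_lipschitz K f ->
  log_lipschitz (rho * K + D) (L f).
Proof.
move=> K0 fK; have fB := log_lipschitz_bounded0 K0 fK.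
have [f0 fK'] := fK; split.
  by move=> x Dx; apply: transfer_ge0 => //; exists (expR K * f 1).
move=> x y Dx Dy; rewrite /transfer -total_sumZ; last exact: transfer_cvg fB Dy.
apply: ler_total_sum; [exact: transfer_cvg fB Dx| |].
  by apply: cvg_seriesZ; exact: transfer_cvg fB Dy.
move=> n; rewrite mulrDl expRD mulrACA.
have DGx := es_Delta ES n Dx; have DGy := es_Delta ES n Dy.
apply: ler_pM; [exact: f0|exact: (es_G1_ge0 ES)| |exact: (es_distortion ES)].
apply: (le_trans (fK' _ _ DGx DGy)); rewrite ler_wpM2r ?f0// ler_expR.
by rewrite [rho * K]mulrC -mulrA ler_wpM2l// (es_contract ES).
Qed.

(** The constant of a cone that the transfer operator maps into a smaller one;
    the gap between the two constants is 1. *)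
Definition cone_cst : R := (D + 1) / (1 - rho).
Local Notation K := cone_cst.

Let rho1B : 0 < 1 - rho. Proof. by rewrite subr_gt0. Qed.

Lemma cone_cst_ge1 : 1 <= K.
Proof. by rewrite /cone_cst ler_pdivlMr// mul1r; move: rho0 D0; lra. Qed.

Let K0 : 0 <= K. Proof. exact: le_trans cone_cst_ge1. Qed.
Let Kgt0 : 0 < K. Proof. exact: lt_le_trans cone_cst_ge1. Qed.

Lemma cone_cst_gap : rho * K + D = K - 1.
Proof.
suff : (1 - rho) * K = D + 1 by lra.
by rewrite /cone_cst mulrC divfK// gt_eqF.
Qed.

Lemma cone_transfer f : log_lipschitz K f -> log_lipschitz K (L f).
Proof.
move=> fK; apply: (@log_lipschitz_le (rho * K + D)).
  by rewrite cone_cst_gap; lra.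
exact: transfer_log_lipschitz.
Qed.

Lemma cone_mean_transfer f : log_lipschitz K f -> mean (L f) = mean f.
Proof. by move=> fK; apply: mean_transfer; exact: log_lipschitz_continuous fK. Qed.

Definition cone_loss : R := 2 * expR (- (2 * K)) / K.
Definition cone_rate : R := 1 - cone_loss / 2.
Local Notation kappa := cone_loss.
Local Notation q := cone_rate.

Lemma cone_loss_gt0 : 0 < kappa.
Proof. by rewrite /cone_loss divr_gt0// mulr_gt0// expR_gt0. Qed.

Lemma cone_rate_itv : 0 <= q < 1.
Proof.
rewrite /cone_rate; have k0 := cone_loss_gt0; apply/andP; split; last by lra.
rewrite /cone_loss subr_ge0 mulrAC ler_pdivrMr// mul1r.
rewrite mulrC mulrA mulVf ?mul1r//; apply: le_trans cone_cst_ge1.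
by rewrite expR_le1 oppr_le0 mulr_ge0.
Qed.

Let q0 : 0 <= q. Proof. by case/andP: cone_rate_itv. Qed.
Let q1 : q < 1. Proof. by case/andP: cone_rate_itv. Qed.

(** Since the image of the cone lies in a smaller cone, a definite proportion of
    the mass can be removed from the image, as a constant, without leaving the
    cone. *)
Lemma cone_subtract f : log_lipschitz K f ->
  log_lipschitz K (fun x => L f x - kappa * mean f).
Proof.
move=> fK; have [F0 FK] := transfer_log_lipschitz K0 fK.
have LK := cone_transfer fK.
rewrite cone_cst_gap in FK.
set c := kappa * mean f.
have mf0 : 0 <= mean f by exact: log_lipschitz_mean_ge0 fK.
have c0 : 0 <= c by rewrite mulr_ge0// ltW// cone_loss_gt0.
have cLe y : Delta y -> c * (K * expR K) <= L f y.
  move=> Dy; have := log_lipschitz_ge_mean K0 LK Dy.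
  rewrite (cone_mean_transfer fK) => H.
  rewrite -(ler_pM2l (expR_gt0 K)); apply: le_trans H.
  rewrite /c /cone_loss le_eqVlt; apply/orP; left; apply/eqP.
  have -> : - (2 * K) = - K - K by ring.
  rewrite expRD.
  transitivity (2 * mean f * ((expR (- K) * expR K) * (expR (- K) * expR K))).
    by field; rewrite gt_eqF.
  by rewrite -expRD addNr expR0 !mulr1.
have cF y : Delta y -> c <= L f y.
  move=> Dy; apply: le_trans (cLe _ Dy); rewrite ler_peMr//.
  rewrite -[leLHS]mulr1 ler_pM// ?cone_cst_ge1// -expR0 ler_expR//.
split => [x Dx|x y Dx Dy]; first by rewrite subr_ge0 cF.
set t : R := `|x - y|.
have t0 : 0 <= t by exact: normr_ge0.
have t1 : t <= 1 by exact: Delta_dist.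
rewrite mulrBr lerBlDr; apply: (le_trans (FK _ _ Dx Dy)); rewrite -/t.
(* The gap between the constants of the two cones pays for the subtraction. *)
suff : c * (expR (K * t) - 1) <= (expR (K * t) - expR ((K - 1) * t)) * L f y by lra.
apply: (@le_trans _ _ (t * (c * (K * expR K)))).
  rewrite mulrCA ler_wpM2l//; apply: (le_trans (expR_sub1_le _)).
  rewrite [K * t]mulrC -mulrA ler_wpM2l// ler_wpM2l// ler_expR ler_piMl//.
apply: ler_pM => //; first by rewrite mulr_ge0// mulr_ge0// expR_ge0.
  have -> : K * t = (K - 1) * t + t by ring.
  rewrite expRD -[X in _ <= _ - X]mulr1 -mulrBr.
  apply: (@le_trans _ _ (1 * (expR t - 1))).
    by rewrite mul1r lerBrDr addrC expR_ge1Dx.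
  rewrite ler_wpM2r//; first by rewrite subr_ge0 -expR0 ler_expR.
  by rewrite -[leLHS]expR0 ler_expR mulr_ge0// subr_ge0 cone_cst_ge1.
exact: cLe.
Qed.


Lemma cone_subtract_mean f : log_lipschitz K f ->
  mean (fun x => L f x - kappa * mean f) = q * mean f.
Proof.
move=> fK; rewrite meanB; last exact: L1_cst.
  by rewrite mean_cst cone_mean_transfer// /cone_rate; ring.
exact: log_lipschitz_L1 (cone_transfer fK).
Qed.

Lemma transfer_iter_bounded B f n : bounded_by B f ->
  exists C, bounded_by C (iter n L f).
Proof.
move=> fB; elim: n => [|n [C fC]]; first by exists B.
by exists (S * C) => /=; exact: transfer_bounded.
Qed.

(** Two densities of the same mass lose the same constant at every step, so that
    their difference becomes a difference of two elements of the cone of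
    exponentially small mass. *)
Lemma cone_iter_difference f1 f2 n : log_lipschitz K f1 -> log_lipschitz K f2 ->
  mean f1 = mean f2 ->
  exists p1 p2, [/\ log_lipschitz K p1, log_lipschitz K p2,
    mean p1 = q ^+ n * mean f1, mean p2 = q ^+ n * mean f1 &
    forall x, Delta x -> iter n L f1 x - iter n L f2 x = p1 x - p2 x].
Proof.
move=> f1K f2K f12; elim: n => [|n [p1 [p2 [p1K p2K m1 m2 p12]]]].
  by exists f1, f2; rewrite expr0 !mul1r; split.
exists (fun x => L p1 x - kappa * mean p1), (fun x => L p2 x - kappa * mean p2).
split; [exact: cone_subtract|exact: cone_subtract| | |].
- by rewrite cone_subtract_mean// m1 exprS mulrA.
- by rewrite cone_subtract_mean// m2 exprS mulrA.
move=> x Dx; rewrite m1 m2 opprB addrA subrK /=.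
have b1 := log_lipschitz_bounded0 K0 f1K; have b2 := log_lipschitz_bounded0 K0 f2K.
have [C1 c1] := transfer_iter_bounded n b1.
have [C2 c2] := transfer_iter_bounded n b2.
rewrite -(transferB c1 c2)// (eq_transfer p12)//.
by rewrite (transferB (log_lipschitz_bounded0 K0 p1K) (log_lipschitz_bounded0 K0 p2K)).
Qed.

Lemma iter_difference_decay f1 f2 : log_lipschitz K f1 -> log_lipschitz K f2 ->
  mean f1 = mean f2 -> exists2 C : R, 0 <= C & forall n,
    bounded_by (C * q ^+ n) (fun x => iter n L f1 x - iter n L f2 x) /\
    lipschitz_by (C * q ^+ n) (fun x => iter n L f1 x - iter n L f2 x).
Proof.
move=> f1K f2K f12.
pose A := 2 * expR K * mean f1.
have A0 : 0 <= A.
  by rewrite /A mulr_ge0 ?mulr_ge0 ?expR_ge0// (log_lipschitz_mean_ge0 K0).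
have C10 : 0 <= K * expR K by rewrite mulr_ge0// expR_ge0.
exists (2 * (1 + K * expR K) * A); first by rewrite mulr_ge0// mulr_ge0// addr_ge0.
move=> n; have [p1 [p2 [p1K p2K m1 m2 p12]]] := cone_iter_difference n f1K f2K f12.
have qn0 : 0 <= q ^+ n by rewrite exprn_ge0.
have pB p : log_lipschitz K p -> mean p = q ^+ n * mean f1 ->
    bounded_by (q ^+ n * A) p.
  move=> pK mp x Dx; rewrite ger0_norm; last by case: pK => + _; apply.
  apply: (le_trans (log_lipschitz_le_mean K0 pK Dx)); rewrite mp /A.
  by rewrite le_eqVlt; apply/orP; left; apply/eqP; ring.
have b1 := pB _ p1K m1; have b2 := pB _ p2K m2.
have l1 := log_lipschitz_lipschitz K0 p1K b1.
have l2 := log_lipschitz_lipschitz K0 p2K b2.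
have Aq0 : 0 <= A * q ^+ n by rewrite mulr_ge0.
split.
  move=> x Dx; rewrite p12//; apply: (le_trans (bounded_byB b1 b2 Dx)).
  by have := mulr_ge0 C10 Aq0; lra.
move=> x y Dx Dy; rewrite !p12//; apply: (le_trans (lipschitz_byB l1 l2 Dx Dy)).
rewrite ler_wpM2r//; have := mulr_ge0 C10 Aq0; lra.
Qed.

(** The variation of [w] is absorbed by the added constant, because
    [1 + K * t <= expR (K * t)]. *)
Lemma lipschitz_shift_cone B Lam w : 0 <= Lam -> bounded_by B w ->
  lipschitz_by Lam w -> log_lipschitz K (fun x => w x + (B + Lam)).
Proof.
move=> Lam0 wB wL; split => [x Dx|x y Dx Dy].
  by have := wB _ Dx; rewrite ler_norml => /andP[]; lra.
have := wB _ Dy; rewrite ler_norml => /andP[wy _].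
have := wL _ _ Dx Dy; set t : R := `|x - y| => /(le_trans (ler_norm _)) wxy.
have t0 : 0 <= t by exact: normr_ge0.
apply: (@le_trans _ _ ((1 + K * t) * (w y + (B + Lam)))).
  have wyB : 0 <= w y + B by lra.
  have : 0 <= (w y + B) * (K * t) by rewrite mulr_ge0// mulr_ge0.
  have : Lam * t <= Lam * (K * t).
    by rewrite ler_wpM2l// ler_peMl// cone_cst_ge1.
  lra.
by rewrite ler_wpM2r ?expR_ge1Dx//; lra.
Qed.

Lemma cone_constant c : 0 <= c -> log_lipschitz K (fun=> c).
Proof.
move=> c0; split => // x y Dx Dy; rewrite ler_peMl// -expR0 ler_expR mulr_ge0//.
Qed.

Lemma cone_iter f n : log_lipschitz K f -> log_lipschitz K (iter n L f).
Proof. by move=> fK; elim: n => //= n; exact: cone_transfer. Qed.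

(** Adding a constant to [w] puts it into the cone, where its iterates are
    compared with those of the constant. *)
Lemma zero_mean_decay B Lam w : 0 <= Lam -> bounded_by B w ->
  lipschitz_by Lam w -> mean w = 0 -> exists2 C : R, 0 <= C & forall n,
    bounded_by (C * q ^+ n) (iter n L w) /\
    lipschitz_by (C * q ^+ n) (iter n L w).
Proof.
move=> Lam0 wB wL w0.
have B0 : 0 <= B by apply: le_trans (wB _ Delta1).
pose c := B + Lam.
have cw := lipschitz_shift_cone Lam0 wB wL.
have cc := cone_constant (addr_ge0 B0 Lam0).
have mE : mean (fun x => w x + (B + Lam)) = mean (fun=> B + Lam).
  rewrite meanD ?w0 ?add0r//; [exact: lipschitz_by_L1 wL|exact: L1_cst].
have [C C0 HC] := iter_difference_decay cw cc mE.
exists C => // n; have [] := HC n.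
suff E x : Delta x ->
    iter n L (fun x => w x + (B + Lam)) x - iter n L (fun=> B + Lam) x = iter n L w x.
  by move=> b l; split => [x Dx|x y Dx Dy]; rewrite -?E//; [exact: b|exact: l].
elim: n x => [|n IH] x Dx /=; first by ring.
have [C1 b1] := transfer_iter_bounded n (log_lipschitz_bounded0 K0 cw).
have [C2 b2] := transfer_iter_bounded n (log_lipschitz_bounded0 K0 cc).
by rewrite -(transferB b1 b2)//; apply: eq_transfer.
Qed.


(** The solution of the equation [U - L U = w], as a Neumann series. *)
Definition potential w x : R := total_sum (fun n => iter n L w x).

Let q_series C : cvgn (series (fun n => C * q ^+ n)).
Proof.
by have := @is_cvg_geometric_series R C q; apply; rewrite ger0_norm.
Qed.

Let q_tail C n : C * q ^+ n * (1 - q)^-1 = tail (fun n => C * q ^+ n) n.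
Proof.
have q1' : q != 1 by rewrite lt_eqF.
rewrite /tail partial_sumE.
have -> : series (fun n => C * q ^+ n) n = C * (1 - q ^+ n) / (1 - q).
  by have /(congr1 (fun u => u n)) /= <- := geometric_seriesE C q1'.
have -> : total_sum (fun n => C * q ^+ n) = C / (1 - q).
  by apply/cvg_lim => //; apply: cvg_geometric_series; rewrite ger0_norm.
by ring.
Qed.

Section Potential.
Variables (w : R -> R) (C : R).
Hypothesis C0 : 0 <= C.
Hypothesis w_bound : forall n, bounded_by (C * q ^+ n) (iter n L w).
Hypothesis w_lip : forall n, lipschitz_by (C * q ^+ n) (iter n L w).
Hypothesis w_mean : mean w = 0.

Local Notation U := (potential w).
Let C' : R := C / (1 - q).

Let term_ge0 n : 0 <= C * q ^+ n. Proof. by rewrite mulr_ge0// exprn_ge0. Qed.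

Let U_cvg x : Delta x -> cvgn (series (fun n => iter n L w x)).
Proof.
move=> Dx; apply: (@dominated_cvg_series _ _ (fun n => C * q ^+ n)) => [n|].
  exact: w_bound.
exact: q_series.
Qed.

Let C'E : total_sum (fun n => C * q ^+ n) = C'.
Proof.
by have := q_tail C 0; rewrite /tail /partial_sum big_ord0 subr0 expr0 mulr1 => <-.
Qed.

Lemma potential_bounded : bounded_by C' U.
Proof.
move=> x Dx; rewrite -C'E; apply: normr_total_sum_le; last exact: q_series.
by move=> n; exact: w_bound.
Qed.

Lemma potential_lipschitz : lipschitz_by C' U.
Proof.
move=> x y Dx Dy; rewrite -total_sumB; [|exact: U_cvg|exact: U_cvg].
rewrite -C'E mulrC -total_sumZ; last exact: q_series.
apply: normr_total_sum_le; last by apply: cvg_seriesZ; exact: q_series.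
by move=> n; rewrite mulrC; exact: w_lip.
Qed.

Lemma potential_approx N :
  bounded_by (C' * q ^+ N) (fun x => U x - \sum_(n < N) iter n L w x).
Proof.
move=> x Dx; rewrite -/(partial_sum N _) mulrAC q_tail.
apply: tail_dominated; last exact: q_series.
by move=> n; exact: w_bound.
Qed.

Let iter_L1 n : L1 (iter n L w). Proof. exact: lipschitz_by_L1 (w_lip n). Qed.

Let iter_mean n : mean (iter n L w) = 0.
Proof.
elim: n => // n IH /=; rewrite mean_transfer//.
exact: lipschitz_by_continuous (w_lip n).
Qed.

Let sum_L1 N : L1 (fun x => \sum_(n < N) iter n L w x).
Proof.
elim: N => [|N IH].
  by under [fun _ => _]eq_fun do rewrite big_ord0; exact: L1_cst.
by under [fun _ => _]eq_fun do rewrite big_ord_recr/=; exact: L1D.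
Qed.

Let sum_mean N : mean (fun x => \sum_(n < N) iter n L w x) = 0.
Proof.
elim: N => [|N IH].
  by under [fun _ => _]eq_fun do rewrite big_ord0; rewrite mean_cst mul0r.
under [fun _ => _]eq_fun do rewrite big_ord_recr/=.
by rewrite (meanD (sum_L1 N) (iter_L1 N)) IH iter_mean addr0.
Qed.

Let small_eq0 (A z : R) : (forall N, `|z| <= A * q ^+ N) -> z = 0.
Proof.
move=> zA; apply/eqP; rewrite -normr_le0.
have cv : (fun N => A * q ^+ N) @ \oo --> (0 : R).
  by apply: (@cvg_geometric R A q); rewrite ger0_norm.
rewrite -(cvg_lim _ cv)//; apply: limr_ge; first exact: cvgP cv.
exact: nearW.
Qed.

Lemma potential_mean : mean U = 0.
Proof.
apply: (@small_eq0 (C' / 2)) => N; rewrite -[mean U]subr0 -(sum_mean N).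
rewrite -meanB//; last exact: lipschitz_by_L1 potential_lipschitz.
rewrite mulrAC; apply: mean_bound (@potential_approx N).
by apply: L1B => //; exact: lipschitz_by_L1 potential_lipschitz.
Qed.

Let sum_bounded N : exists B, bounded_by B (fun x => \sum_(n < N) iter n L w x).
Proof.
exists (C' + C' * q ^+ N) => x Dx.
have := bounded_byB potential_bounded (@potential_approx N) Dx.
by rewrite opprB addrC subrK.
Qed.

Lemma potential_transfer x : Delta x -> L U x = U x - w x.
Proof.
move=> Dx; apply/eqP; rewrite -subr_eq0; apply/eqP.
apply: (@small_eq0 (S * C' + C')) => N.
have LS : L (fun x => \sum_(n < N) iter n L w x) x + w x =
    \sum_(n < N.+1) iter n L w x.
  elim: N => [|N IH].
    rewrite big_ord_recr/= big_ord0 add0r.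
    rewrite (_ : L _ x = 0) ?add0r//; apply/cvg_lim => //.
    apply: cvg_near_cst; apply: nearW => n; rewrite /series/=.
    by rewrite big1// => i _; rewrite big_ord0 mul0r.
  rewrite big_ord_recr/= -IH.
  have [B bB] := sum_bounded N.
  under [X in transfer _ _ X]eq_fun do rewrite big_ord_recr/=.
  by rewrite (transferD bB (@w_bound N))//; ring.
have [B bB] := sum_bounded N.
have H1 := transfer_bounded (@potential_approx N) Dx.
rewrite (transferB potential_bounded bB)// in H1.
have H2 := @potential_approx N.+1 x Dx.
rewrite -LS in H2.
have H3 : C' * q ^+ N.+1 <= C' * q ^+ N.
  rewrite ler_wpM2l//; first by rewrite divr_ge0// subr_ge0 ltW.
  by rewrite exprS ler_piMl ?exprn_ge0// ltW.
rewrite (_ : _ - _ = (L U x - L (fun x => \sum_(n < N) iter n L w x) x)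
  - (U x - (L (fun x => \sum_(n < N) iter n L w x) x + w x))); last by ring.
apply: (le_trans (ler_normB _ _)); rewrite mulrDl; apply: lerD.
  by rewrite -mulrA.
exact: le_trans H2 H3.
Qed.

End Potential.

Let L2_lip : log_lipschitz K (fun=> 2). Proof. exact: cone_constant. Qed.

(** The invariant density is the limit of the iterates of a constant, written
    as the sum of their increments. *)
Definition density x : R := 2 + potential (fun x => L (fun=> 2) x - 2) x.

Lemma density_increment_decay : exists2 C : R, 0 <= C & forall n,
    bounded_by (C * q ^+ n) (iter n L (fun x => L (fun=> 2) x - 2)) /\
    lipschitz_by (C * q ^+ n) (iter n L (fun x => L (fun=> 2) x - 2)).
Proof.
have LK := cone_transfer L2_lip.
have lB := log_lipschitz_bounded0 K0 LK.
have lL := log_lipschitz_lipschitz K0 LK lB.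
have cB : bounded_by 2 (fun=> 2 : R) by move=> x _; rewrite ger0_norm.
apply: (zero_mean_decay _ (bounded_byB lB cB) (lipschitz_byB lL (@lipschitz_by_cst _ 2))).
  have L2_ge0 : 0 <= L (fun=> 2) 1 by case: LK => + _; apply; exact: Delta1.
  by rewrite addr0; exact: mulr_ge0 (mulr_ge0 K0 (expR_ge0 _)) (mulr_ge0 (expR_ge0 _) L2_ge0).
rewrite meanB; [|exact: log_lipschitz_L1 LK|exact: L1_cst].
by rewrite cone_mean_transfer// subrr.
Qed.

Lemma iter_increments N x : Delta x ->
  2 + \sum_(n < N) iter n L (fun x => L (fun=> 2) x - 2) x = iter N L (fun=> 2) x.
Proof.
have LK := cone_transfer L2_lip.
elim: N => [|N IH] Dx; first by rewrite big_ord0 addr0.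
rewrite big_ord_recr/= addrA IH//.
suff -> : iter N L (fun x => L (fun=> 2) x - 2) x =
    iter N.+1 L (fun=> 2) x - iter N L (fun=> 2) x by rewrite /=; ring.
elim: N x Dx {IH} => // N IH x Dx.
apply: (etrans (eq_transfer IH Dx)).
have [C1 b1] := transfer_iter_bounded N.+1 (log_lipschitz_bounded0 K0 L2_lip).
have [C2 b2] := transfer_iter_bounded N (log_lipschitz_bounded0 K0 L2_lip).
by rewrite (transferB b1 b2).
Qed.

Lemma density_limit x : Delta x -> iter N L (fun=> 2) x @[N --> \oo] --> density x.
Proof.
move=> Dx; have [C C0 HC] := density_increment_decay.
rewrite /density.
under eq_fun do rewrite -(iter_increments _ Dx).
apply: cvgD; first exact: cvg_cst.
rewrite (_ : (fun N => _) =
    series (fun n => iter n L (fun x => L (fun=> 2) x - 2) x)); last first.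
  by apply/funext => N; exact: partial_sumE.
apply: (@dominated_cvg_series _ _ (fun n => C * q ^+ n)) => [n|].
  by have [b _] := HC n; exact: b.
exact: q_series.
Qed.

End TransferOperator.

(** * The invariant density and its regularity *)

Section InvariantDensity.
Context {R : realType} {G G1 G2 : nat -> R -> R} {s : nat -> R} {rho D : R}.
Hypothesis ES : expanding_system G G1 G2 s rho D.
Implicit Types (f g w v : R -> R) (x y B : R) (n N : nat).

Local Notation L := (transfer G G1).
Local Notation S := (total_sum s).
Local Notation K := (@cone_cst R rho D).
Local Notation q := (@cone_rate R rho D).
Local Notation h := (@density R G G1).

Let s0 := es_s_ge0 ES.
Let cs := es_s_cvg ES.
Let rho0 : 0 <= rho. Proof. by case/andP: (es_rho ES). Qed.
Let rho1 : rho < 1. Proof. by case/andP: (es_rho ES). Qed.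
Let D0 := es_D ES.
Let K1 : 1 <= K. Proof. exact: cone_cst_ge1 ES. Qed.
Let K0 : 0 <= K. Proof. exact: le_trans K1. Qed.

Let L2_lip : log_lipschitz K (fun=> 2).
Proof. exact: (cone_constant ES (ler0n R 2)). Qed.

Let iter_cone n : log_lipschitz K (iter n L (fun=> 2)).
Proof. exact: (cone_iter ES). Qed.

Let iter_mean1 n : mean (iter n L (fun=> 2)) = 1.
Proof.
elim: n => [|n IH] /=; first by rewrite mean_cst divff.
by rewrite (cone_mean_transfer ES).
Qed.

(** An upper bound for the elements of the cone of mean 1. *)
Definition cone_sup : R := 2 * expR K.
Local Notation B := cone_sup.

Let B0 : 0 <= B. Proof. by rewrite mulr_ge0 ?expR_ge0. Qed.

Let iter_bound n : bounded_by B (iter n L (fun=> 2)).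
Proof.
move=> x Dx; rewrite ger0_norm; last by case: (iter_cone n) => + _; apply.
by apply: (le_trans (log_lipschitz_le_mean K0 (iter_cone n) Dx)); rewrite iter_mean1 mulr1.
Qed.

Let q_itv := cone_rate_itv ES.

Lemma density_lipschitz : exists2 Lam : R, 0 <= Lam & lipschitz_by Lam h.
Proof.
have [C C0 HC] := density_increment_decay ES.
exists (C / (1 - q)).
  by case/andP: q_itv => _ q1; rewrite divr_ge0// subr_ge0 ltW.
have := potential_lipschitz ES (fun n => (HC n).1) (fun n => (HC n).2).
move=> H; have := lipschitz_byD (@lipschitz_by_cst _ 2) H.
by rewrite add0r.
Qed.

Lemma density_L1 : L1 h.
Proof. by have [? _] := density_lipschitz; exact: lipschitz_by_L1. Qed.

Let increment_mean : mean (fun x => L (fun=> 2) x - 2) = 0.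
Proof.
rewrite meanB; [|exact: log_lipschitz_L1 (iter_cone 1)|exact: L1_cst].
by rewrite (iter_mean1 1) mean_cst divff ?subrr.
Qed.

Lemma density_mean : mean h = 1.
Proof.
have [C C0 HC] := density_increment_decay ES.
have C1 n := (HC n).1; have C2 n := (HC n).2.
rewrite meanD; [|exact: L1_cst|exact: lipschitz_by_L1 (potential_lipschitz ES C1 C2)].
by rewrite (potential_mean ES C1 C2 increment_mean) mean_cst divff ?addr0.
Qed.

Lemma density_transfer x : Delta x -> L h x = h x.
Proof.
move=> Dx; have [C C0 HC] := density_increment_decay ES.
have C1 n := (HC n).1; have C2 n := (HC n).2.
have b2 : bounded_by 2 (fun=> 2 : R) by move=> ? _; rewrite ger0_norm.
rewrite /density (transferD ES b2 (potential_bounded ES C1))//.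
by rewrite (potential_transfer ES C0 C1)//; ring.
Qed.

Lemma density_cone : log_lipschitz K h.
Proof.
split => [x Dx|x y Dx Dy].
  have cx := density_limit ES Dx; rewrite -(cvg_lim _ cx)//.
  apply: limr_ge; first exact: cvgP cx.
  by apply: nearW => n; case: (iter_cone n) => + _; apply.
have cx := density_limit ES Dx; have cy := density_limit ES Dy.
have cy' : expR (K * `|x - y|) * iter N L (fun=> 2) y @[N --> \oo] -->
    expR (K * `|x - y|) * h y.
  by apply: cvgM => //; exact: cvg_cst.
rewrite -(cvg_lim _ cx)// -(cvg_lim _ cy')//.
apply: ler_lim; [exact: cvgP cx|exact: cvgP cy'|].
by apply: nearW => n; case: (iter_cone n) => _; apply.
Qed.

Lemma density_ge x : Delta x -> 2 * expR (- K) <= h x.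
Proof.
move=> Dx; have := log_lipschitz_ge_mean K0 density_cone Dx.
by rewrite density_mean mulr1 expRN ler_pdivrMr ?expR_gt0// mulrC.
Qed.

(** Second-order regularity: a derivative [v] with a quadratic remainder whose
    constant is proportional to the function, so that it is controlled through
    the positivity of the transfer operator. *)
Definition taylor_cone K2 f v :=
  (forall x, Delta x -> `|v x| <= K * f x) /\
  forall x y, Delta x -> Delta y ->
    `|f y - f x - v x * (y - x)| <= K2 * f y * (y - x) ^+ 2.

Definition transfer_derivative f v x : R :=
  total_sum (fun n => v (G n x) * G1 n x ^+ 2 + f (G n x) * G2 n x).

Definition taylor_cst : R := expR (2 * K) * (1 + 2 * K) * S / (1 - rho ^+ 2).
Local Notation K2 := taylor_cst.

Let rho2 : 0 < 1 - rho ^+ 2.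
Proof. by rewrite subr_gt0 exprn_ilt1. Qed.

Let S0 : 0 <= S. Proof. exact: S_ge0 ES. Qed.

Let K20 : 0 <= K2.
Proof.
rewrite /taylor_cst !mulr_ge0 ?expR_ge0 ?invr_ge0//; last exact: ltW.
by rewrite addr_ge0// mulr_ge0.
Qed.

Lemma taylor_cone_transfer f v : log_lipschitz K f -> mean f = 1 ->
  taylor_cone K2 f v -> taylor_cone K2 (L f) (transfer_derivative f v).
Proof.
move=> fK f1 [vf fT].
have fB : bounded_by B f.
  move=> x Dx; rewrite ger0_norm; last by case: fK => + _; apply.
  by apply: (le_trans (log_lipschitz_le_mean K0 fK Dx)); rewrite f1 mulr1.
have f0 x : Delta x -> 0 <= f x by case: fK => + _; apply.
have Lcvg x : Delta x -> cvgn (series (fun n => f (G n x) * G1 n x)).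
  exact: (transfer_cvg ES fB).
have dterm n x : Delta x ->
    `|v (G n x) * G1 n x ^+ 2 + f (G n x) * G2 n x| <= K * (f (G n x) * G1 n x).
  move=> Dx; have DGx := es_Delta ES n Dx.
  have g0 := es_G1_ge0 ES n Dx; have gr := es_G1_rho ES n Dx.
  apply: (@le_trans _ _ ((rho * K + D) * (f (G n x) * G1 n x))); last first.
    rewrite (cone_cst_gap ES) ler_wpM2r//; first by rewrite mulr_ge0// f0.
    lra.
  apply: (le_trans (ler_normD _ _)); rewrite mulrDl; apply: lerD.
    rewrite normrM [`|_ ^+ 2|]ger0_norm ?exprn_ge0//.
    apply: (@le_trans _ _ ((K * f (G n x)) * (rho * G1 n x))).
      apply: ler_pM => //; first by rewrite exprn_ge0.
        exact: vf.
      by rewrite expr2 ler_wpM2r.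
    by rewrite le_eqVlt; apply/orP; left; apply/eqP; ring.
  rewrite normrM ger0_norm ?f0// mulrCA ler_wpM2l ?f0//.
  exact: (es_G2_D ES).
have dcvg x : Delta x ->
    cvgn (series (fun n => v (G n x) * G1 n x ^+ 2 + f (G n x) * G2 n x)).
  move=> Dx; apply: (@dominated_cvg_series _ _ (fun n => K * (f (G n x) * G1 n x))).
    by move=> n; exact: dterm.
  exact: cvg_seriesZ (Lcvg _ Dx).
split => [x Dx|x y Dx Dy].
  rewrite /transfer -total_sumZ; last exact: Lcvg.
  apply: normr_total_sum_le => [n|]; first exact: dterm.
  exact: cvg_seriesZ (Lcvg _ Dx).
set t : R := y - x.
have LTE : L f y - L f x - transfer_derivative f v x * t = total_sum (fun n =>
    f (G n y) * G1 n y - f (G n x) * G1 n x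
    - t * (v (G n x) * G1 n x ^+ 2 + f (G n x) * G2 n x)).
  rewrite total_sumB; last 2 first.
  - by have := is_cvg_seriesB (Lcvg _ Dy) (Lcvg _ Dx).
  - exact: cvg_seriesZ (dcvg _ Dx).
  rewrite total_sumB; [|exact: Lcvg|exact: Lcvg].
  by rewrite total_sumZ ?[t * _]mulrC//; exact: dcvg.
rewrite LTE.
pose M := B * (1 + 2 * K).
have M0 : 0 <= M by rewrite mulr_ge0// addr_ge0// mulr_ge0.
apply: (@le_trans _ _ (total_sum (fun n =>
    (K2 * rho ^+ 2 * t ^+ 2) * (f (G n y) * G1 n y) + (M * t ^+ 2) * s n))).
  apply: normr_total_sum_le; last first.
    apply: cvg_seriesD; last exact: cvg_seriesZ.
    exact: cvg_seriesZ (Lcvg _ Dy).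
  move=> n.
  have DGx := es_Delta ES n Dx; have DGy := es_Delta ES n Dy.
  have gx0 := es_G1_ge0 ES n Dx; have gy0 := es_G1_ge0 ES n Dy.
  have grx := es_G1_rho ES n Dx.
  have gxy : `|G n y - G n x| <= rho * `|t| by exact: (es_contract ES).
  have T0 := es_taylor0 ES n Dx Dy; have T1 := es_taylor1 ES n Dx Dy.
  rewrite -/t in T0 T1.
  have T2 : `|G1 n y - G1 n x| <= s n * `|t| by exact: (es_G1_lip ES).
  have t2 : t ^+ 2 = `|t| ^+ 2 by rewrite real_normK// num_real.
  rewrite (_ : _ - _ - _ =
    (f (G n y) - f (G n x) - v (G n x) * (G n y - G n x)) * G1 n y
    + (f (G n x) * (G1 n y - G1 n x - G2 n x * t)
    + v (G n x) * ((G n y - G n x) * (G1 n y - G1 n x)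
                   + G1 n x * (G n y - G n x - G1 n x * t)))); last by ring.
  apply: (le_trans (ler_normD _ _)); apply: lerD.
    rewrite normrM [`|G1 n y|]ger0_norm//.
    apply: (@le_trans _ _ (K2 * f (G n y) * (rho ^+ 2 * t ^+ 2) * G1 n y)).
      rewrite ler_wpM2r//; apply: (le_trans (fT _ _ DGx DGy)).
      rewrite ler_wpM2l//; first by rewrite mulr_ge0// f0.
      rewrite t2 -exprMn -[leLHS]real_normK ?num_real//.
      by rewrite ler_pXn2r// nnegrE// mulr_ge0.
    by rewrite le_eqVlt; apply/orP; left; apply/eqP; ring.
  apply: (le_trans (ler_normD _ _)).
  have fxB : f (G n x) <= B by exact: le_trans (ler_norm _) (fB _ DGx).
  apply: (@le_trans _ _ (B * (s n * t ^+ 2) + K * B * (2 * (s n * t ^+ 2)))); last first.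
    by rewrite /M le_eqVlt; apply/orP; left; apply/eqP; ring.
  apply: lerD.
    rewrite normrM ger0_norm ?f0//; apply: ler_pM => //; exact: f0.
  rewrite normrM; apply: ler_pM => //.
    apply: (le_trans (vf _ DGx)); rewrite ler_wpM2l//.
  apply: (le_trans (ler_normD _ _)); rewrite mulr_natl mulr2n; apply: lerD.
    rewrite normrM t2.
    apply: (@le_trans _ _ ((rho * `|t|) * (s n * `|t|))); first exact: ler_pM.
    rewrite (_ : _ * _ = rho * (s n * `|t| ^+ 2)); last by ring.
    by apply: ler_piMl; [rewrite mulr_ge0// exprn_ge0|exact: ltW].
  rewrite normrM [`|G1 n x|]ger0_norm//; apply: (@le_trans _ _ (1 * (s n * t ^+ 2))).
    by apply: ler_pM => //; exact: le_trans grx (ltW rho1).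
  by rewrite mul1r.
rewrite total_sumD; last 2 first.
- exact: cvg_seriesZ (Lcvg _ Dy).
- exact: cvg_seriesZ.
rewrite total_sumZ; last exact: Lcvg.
rewrite total_sumZ// -/(L f y).
have Lfy : 2 <= expR K * L f y.
  have := log_lipschitz_ge_mean K0 (cone_transfer ES fK) Dy.
  by rewrite (cone_mean_transfer ES fK) f1 mulr1.
have MK2 : M * S <= (1 - rho ^+ 2) * K2 * L f y.
  have -> : (1 - rho ^+ 2) * K2 = expR K * expR K * (1 + 2 * K) * S.
    rewrite /taylor_cst mulrC divfK ?gt_eqF// -expRD; congr (expR _ * _ * _).
    by ring.
  rewrite /M /cone_sup.
  have E0 : 0 <= expR K * (1 + 2 * K) * S.
    by rewrite !mulr_ge0 ?expR_ge0// addr_ge0// mulr_ge0.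
  have := ler_wpM2l E0 Lfy; lra.
have t20 : 0 <= t ^+ 2 by rewrite sqr_ge0.
have := ler_wpM2r t20 MK2; lra.
Qed.

Fixpoint iter_derivative n : R -> R :=
  if n is k.+1 then transfer_derivative (iter k L (fun=> 2)) (iter_derivative k)
  else fun=> 0.

Lemma iter_taylor_cone n :
  taylor_cone K2 (iter n L (fun=> 2)) (iter_derivative n).
Proof.
elim: n => [|n IH].
  2: exact: (taylor_cone_transfer (iter_cone n) (iter_mean1 n) IH).
split => [x Dx|x y Dx Dy]; rewrite /=; first by rewrite normr0 mulr_ge0.
by rewrite subrr sub0r mul0r oppr0 normr0 mulr_ge0 ?sqr_ge0// mulr_ge0.
Qed.

(** The derivatives of the iterates are bounded, so that a limit point serves as
    derivative of the limit: the quadratic remainder passes to the limit. *)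
Lemma density_taylor : exists v (C : R), forall x y, Delta x -> Delta y ->
  `|h y - h x - v x * (y - x)| <= C * (y - x) ^+ 2.
Proof.
suff : forall x, exists vx, Delta x -> forall y, Delta y ->
    `|h y - h x - vx * (y - x)| <= K2 * B * (y - x) ^+ 2.
  move=> /choice[v Hv]; exists v, (K2 * B) => x y Dx; exact: Hv.
move=> x; have [Dx|nDx] := pselect (Delta x); last by exists 0.
have bnd : bounded_fun (fun n => iter_derivative n x).
  exists (K * B); split; first exact: num_real.
  move=> M KBM n _ /=; apply: le_trans (ltW KBM).
  have [vb _] := iter_taylor_cone n; apply: (le_trans (vb _ Dx)).
  rewrite ler_wpM2l//; exact: le_trans (ler_norm _) (iter_bound n Dx).
have [phi phi_incr vphi] := bolzano_weierstrass bnd.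
have phi_oo : phi @ \oo --> \oo.
  have phi_ge n : (n <= phi n)%N.
    elim: n => // n IH; apply: (leq_ltn_trans IH).
    by move/increasing_seqP : phi_incr => /(_ n).
  by move=> A [N _ NA]; exists N => // n /= Nn; apply: NA => /=; exact: leq_trans (phi_ge n).
exists (limn ((fun n => iter_derivative n x) \o phi)) => _ y Dy.
have hx := cvg_comp _ _ phi_oo (density_limit ES Dx).
have hy := cvg_comp _ _ phi_oo (density_limit ES Dy).
have H : `|iter (phi n) L (fun=> 2) y - iter (phi n) L (fun=> 2) x
      - iter_derivative (phi n) x * (y - x)| @[n --> \oo] -->
    `|h y - h x - limn ((fun n => iter_derivative n x) \o phi) * (y - x)|.
  apply: cvg_norm; apply: cvgB; first by apply: cvgB; [exact: hy|exact: hx].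
  by apply: cvgM; [exact: vphi|exact: cvg_cst].
rewrite -(cvg_lim _ H)//; apply: limr_le; first exact: cvgP H.
apply: nearW => n; have [_ /(_ _ _ Dx Dy) T] := iter_taylor_cone (phi n).
apply: (le_trans T); rewrite ler_wpM2r ?sqr_ge0// ler_wpM2l//.
exact: le_trans (ler_norm _) (iter_bound _ Dy).
Qed.

End InvariantDensity.

(** * Derivatives relative to a set *)

Section RelativeDerivative.
Context {R : realType}.
Implicit Types (D : set R) (f g : R -> R) (x y l : R).

(** The derivative relative to [D] as a first-order expansion; unlike the limit
    of the quotients it composes and restricts directly. *)
Definition has_der D f x l := forall e : R, 0 < e -> exists2 d : R, 0 < d &
  forall y, D y -> `|y - x| < d -> `|f y - f x - l * (y - x)| <= e * `|y - x|.

Definition limit_pt D x := forall d : R, 0 < d ->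
  exists y, [/\ D y, y != x & `|y - x| < d].

Lemma has_der_quotient D f x l :
  quotient f x y @[y --> within D (x^')] --> l <-> has_der D f x l.
Proof.
split.
  move=> /cvgrPdist_le H e e0; have := H e e0.
  rewrite near_withinE => -[d /= d0 Hd]; exists d => // y Dy yx.
  have [->|yx0] := eqVneq y x; first by rewrite !subrr mulr0 subrr !normr0 mulr0.
  have := Hd y; rewrite /= distrC => /(_ yx yx0 Dy).
  rewrite /quotient distrC => Hy.
  have n0 : 0 < `|y - x| by rewrite normr_gt0 subr_eq0.
  rewrite -ler_pdivrMr// -normf_div; apply: le_trans Hy.
  by rewrite mulrBl mulfK// subr_eq0.
move=> H; apply/cvgrPdist_le => e e0; rewrite near_withinE.
have [d d0 Hd] := H e e0; exists d => //= y; rewrite /= distrC => yx yx0 Dy.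
have n0 : 0 < `|y - x| by rewrite normr_gt0 subr_eq0.
rewrite distrC /quotient; have := Hd y Dy yx.
rewrite -ler_pdivrMr// -normf_div; congr (`|_| <= _).
by rewrite mulrBl mulfK// subr_eq0.
Qed.

Lemma derivable_in_has_der D f x :
  derivable_in D f x -> has_der D f x (der D f x).
Proof. by move=> H; apply/has_der_quotient. Qed.

Lemma within_dnbhs_proper D x : limit_pt D x -> ProperFilter (within D (x^')).
Proof.
move=> accx; split; last exact: within_filter.
move=> [d /= d0 Hd]; have [y [Dy yx ydx]] := accx d d0.
by apply: (Hd y) => //=; rewrite distrC.
Qed.

Lemma has_der_der D f x l : limit_pt D x -> has_der D f x l ->
  derivable_in D f x /\ der D f x = l.
Proof.
move=> accx /has_der_quotient H.
have PF := within_dnbhs_proper accx.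
by split; [apply: cvgP H|apply: cvg_lim H].
Qed.

Lemma has_der_unique D f x l l' : limit_pt D x ->
  has_der D f x l -> has_der D f x l' -> l = l'.
Proof.
by move=> accx /(has_der_der accx)[_ <-] /(has_der_der accx)[_ <-].
Qed.

Lemma has_der_subset D D' f x l : (exists2 r : R, 0 < r &
    forall y, D' y -> `|y - x| < r -> D y) ->
  has_der D f x l -> has_der D' f x l.
Proof.
move=> [r r0 DD'] H e e0; have [d d0 Hd] := H e e0.
exists (Num.min d r); first by rewrite lt_min d0.
by move=> y Dy; rewrite lt_min => /andP[yd yr]; apply: Hd => //; exact: DD'.
Qed.

Lemma eq_has_der D f g x l : (exists2 r : R, 0 < r &
    forall y, D y -> `|y - x| < r -> f y = g y) -> f x = g x ->
  has_der D f x l -> has_der D g x l.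
Proof.
move=> [r r0 fg] fgx H e e0; have [d d0 Hd] := H e e0.
exists (Num.min d r); first by rewrite lt_min d0.
by move=> y Dy; rewrite lt_min => /andP[yd yr]; rewrite -fg// -fgx; exact: Hd.
Qed.

Lemma is_derive_has_der f x l : is_derive x 1 f l <-> has_der setT f x l.
Proof.
rewrite is_derive1_caratheodory; split.
  move=> [g [fg gc gx]] e e0.
  move/cvgrPdist_le : gc => /(_ e e0)[d /= d0 Hd]; exists d => // y _ yx.
  rewrite fg -mulrBl normrM ler_wpM2r// -gx distrC; apply: Hd.
  by rewrite /= distrC.
move=> H; exists (fun z => if z == x then l else (f z - f x) / (z - x)).
split; last by rewrite eqxx.
  move=> z; case: eqVneq => [->|zx]; first by rewrite !subrr mulr0.
  by rewrite divfK// subr_eq0.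
apply/cvgrPdist_le => e e0; have [d d0 Hd] := H e e0.
exists d => //= y; rewrite /= distrC eqxx => yx.
case: eqVneq => [_|yx0]; first by rewrite subrr normr0 ltW.
have n0 : 0 < `|y - x| by rewrite normr_gt0 subr_eq0.
rewrite distrC; have := Hd y I yx; rewrite -ler_pdivrMr// -normf_div.
by rewrite mulrBl mulfK// subr_eq0.
Qed.

Lemma has_der_continuous D f x l : has_der D f x l -> forall e : R, 0 < e ->
  exists2 d : R, 0 < d & forall y, D y -> `|y - x| < d -> `|f y - f x| <= e.
Proof.
move=> H e e0; have [d d0 Hd] := H 1 ltr01.
have l0 : 0 < `|l| + 1 by rewrite ltr_wpDl.
exists (Num.min d (e / (`|l| + 1))); first by rewrite lt_min d0 divr_gt0.
move=> y Dy; rewrite lt_min ltr_pdivlMr// => /andP[yd ye].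
rewrite (_ : f y - f x = (f y - f x - l * (y - x)) + l * (y - x)); last by ring.
apply: (le_trans (ler_normD _ _)); rewrite normrM.
have := Hd y Dy yd; have := ltW ye; rewrite mulrDr mulr1 mul1r => H1 H2.
by apply: le_trans H1; rewrite addrC lerD// mulrC.
Qed.

Lemma has_der_within_continuous D f (df : R -> R) :
  (forall x, D x -> has_der D f x (df x)) -> {within D, continuous f}.
Proof.
move=> H; apply/subspace_continuousP => x Dx.
apply/cvgrPdist_le => e e0; rewrite near_withinE.
have [d d0 Hd] := has_der_continuous (H _ Dx) e0.
by exists d => //= y; rewrite /= distrC => yx Dy; rewrite distrC; exact: Hd.
Qed.

Lemma within_continuousE D f x : {within D, continuous f} -> D x ->
  forall e : R, 0 < e -> exists2 d : R, 0 < d &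
    forall y, D y -> `|y - x| < d -> `|f y - f x| <= e.
Proof.
move=> /subspace_continuousP H Dx e e0.
have /cvgrPdist_le/(_ e e0) := H x Dx; rewrite near_withinE => -[d /= d0 Hd].
by exists d => // y Dy yx; rewrite distrC; apply: Hd => //=; rewrite distrC.
Qed.

End RelativeDerivative.

Section SegmentCalculus.
Context {R : realType}.
Variables (a b : R).
Hypothesis ab : a < b.
Implicit Types (f g df : R -> R) (x y z C : R).

Local Notation I := (`[a, b]%classic : set R).

Lemma segment_limit_pt x : I x -> limit_pt I x.
Proof.
rewrite /= in_itv/= => /andP[ax xb] d d0.
pose r := Num.min (d / 2) ((b - a) / 2).
have r0 : 0 < r by rewrite lt_min !divr_gt0// subr_gt0.
have rd : r < d by rewrite gt_min ltr_pdivrMr// ltr_pMr// ltr1n.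
have rab : r <= (b - a) / 2 by rewrite ge_min lexx orbT.
have [xm|mx] := leP x ((a + b) / 2).
- exists (x + r); split.
  + by rewrite /= in_itv/=; lra.
  + by rewrite -subr_eq0 addrC addKr gt_eqF.
  + by rewrite addrC addKr gtr0_norm.
- exists (x - r); split.
  + by rewrite /= in_itv/=; lra.
  + by rewrite -subr_eq0 addrC addKr oppr_eq0 gt_eqF.
  + by rewrite addrC addKr normrN gtr0_norm.
Qed.

Lemma segment_interior x : a < x < b ->
  exists2 r : R, 0 < r & forall y, `|y - x| < r -> a < y < b.
Proof.
move=> /andP[ax xb]; exists (Num.min (x - a) (b - x)).
  by rewrite lt_min !subr_gt0 ax.
by move=> y; rewrite lt_min !ltr_norml; lra.
Qed.

Lemma segment_is_derive f x l : a < x < b -> has_der I f x l ->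
  is_derive x 1 f l.
Proof.
move=> xab H; apply/is_derive_has_der; apply: has_der_subset H.
have [r r0 Hr] := segment_interior xab; exists r => // y _ /Hr.
by rewrite /= in_itv/= => /andP[/ltW -> /ltW ->].
Qed.

Lemma segment_mvt f df x y : (forall z, I z -> has_der I f z (df z)) ->
  I x -> I y -> exists2 z, I z & f y - f x = df z * (y - x).
Proof.
move=> fder.
have fc : {within I, continuous f} := has_der_within_continuous fder.
have main u v : I u -> I v -> u <= v ->
    exists2 z, I z & f v - f u = df z * (v - u).
  rewrite /= !in_itv/= => /andP[au ub] /andP[av vb] uv.
  have uvI : `[u, v] `<=` I by apply: subset_itv; rewrite bnd_simp.
  have [||z zuv E] := @MVT_segment R f df u v uv.
  - move=> z; rewrite in_itv/= => /andP[uz zv]; apply: segment_is_derive.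
      by rewrite (le_lt_trans au uz) (lt_le_trans zv vb).
    by apply: fder; rewrite /= in_itv/= (le_trans au (ltW uz)) (le_trans (ltW zv) vb).
  - exact: continuous_subspaceW fc.
  by exists z => //; have := uvI _ zuv.
move=> Ix Iy; have [xy|yx] := leP x y; first exact: main.
have [z Iz E] := main _ _ Iy Ix (ltW yx); exists z => //.
by rewrite -opprB E -mulrN opprB.
Qed.

Lemma segment_lipschitz f df C : (forall z, I z -> has_der I f z (df z)) ->
  (forall z, I z -> `|df z| <= C) ->
  forall x y, I x -> I y -> `|f x - f y| <= C * `|x - y|.
Proof.
move=> fder dfC x y Ix Iy; have [z Iz ->] := segment_mvt fder Iy Ix.
by rewrite normrM ler_wpM2r// dfC.
Qed.

Lemma segment_taylor f df C : 0 <= C -> (forall z, I z -> has_der I f z (df z)) ->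
  (forall x y, I x -> I y -> `|df x - df y| <= C * `|x - y|) ->
  forall x y, I x -> I y -> `|f y - f x - df x * (y - x)| <= C * (y - x) ^+ 2.
Proof.
move=> C0 fder dfC x y Ix Iy.
have dC : forall z, I z -> has_der I (fun u => f u - df x * u) z (df z - df x).
  move=> z Iz e e0; have [d d0 Hd] := fder z Iz e e0; exists d => // u Iu uz.
  by have := Hd u Iu uz; congr (`|_| <= _); ring.
have main u v : u <= v -> I u -> I v -> (u = x \/ v = x) ->
    `|f v - f u - df x * (v - u)| <= C * (v - u) ^+ 2.
  move=> uv; rewrite /= !in_itv/= => /andP[au ub] /andP[av vb] uvx.
  have uvI : `[u, v] `<=` I by apply: subset_itv; rewrite bnd_simp.
  have [||z zuv E] := @MVT_segment R f df u v uv.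
  - move=> z; rewrite in_itv/= => /andP[uz zv]; apply: segment_is_derive.
      by rewrite (le_lt_trans au uz) (lt_le_trans zv vb).
    by apply: fder; rewrite /= in_itv/= (le_trans au (ltW uz)) (le_trans (ltW zv) vb).
  - exact: continuous_subspaceW (has_der_within_continuous fder).
  rewrite E -mulrBl normrM; have Iz := uvI _ zuv.
  have zx : `|z - x| <= v - u.
    move: zuv; rewrite in_itv/= ler_norml => /andP[uz zv].
    by case: uvx => <-; lra.
  rewrite [`|v - u|]ger0_norm ?subr_ge0// expr2 mulrA ler_wpM2r ?subr_ge0//.
  by apply: (le_trans (dfC _ _ Iz Ix)); rewrite ler_wpM2l.
have [xy|yx] := leP x y; first by apply: main => //; left.
have := main _ _ (ltW yx) Iy Ix (or_intror erefl).
by rewrite -normrN -[(x - y) ^+ 2]sqrrN; congr (`|_| <= _ * _ ^+ 2); ring.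
Qed.

Lemma segment_closure_le f C : {within I, continuous f} ->
  (forall x, a < x < b -> f x <= C) -> forall x, I x -> f x <= C.
Proof.
move=> fc fC x Ix; apply/ler_addgt0Pr => e e0.
have [d d0 Hd] := within_continuousE fc Ix e0.
move: (Ix); rewrite /= in_itv/= => /andP[ax xb].
have [y [yab yx]] : exists y, a < y < b /\ `|y - x| < d.
  pose r := Num.min (d / 2) ((b - a) / 4).
  have r0 : 0 < r by rewrite lt_min !divr_gt0// subr_gt0.
  have rd : r < d by rewrite gt_min ltr_pdivrMr// ltr_pMr// ltr1n.
  have rab : r <= (b - a) / 4 by rewrite ge_min lexx orbT.
  have [xm|mx] := leP x ((a + b) / 2).
    by exists (x + r); split; [lra|rewrite addrC addKr gtr0_norm].
  by exists (x - r); split; [lra|rewrite addrC addKr normrN gtr0_norm].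
have Iy : I y by case/andP: yab => ay yb; rewrite /= in_itv/= !ltW.
have := Hd y Iy yx; rewrite ler_norml => /andP[H _].
by have := fC y yab; lra.
Qed.

(** Under the differential inequality, [f x * expR (D * x)] is nondecreasing and
    [f x * expR (- D * x)] is nonincreasing. *)
Lemma segment_gronwall f df D : 0 <= D ->
  (forall z, I z -> has_der I f z (df z)) ->
  (forall z, a < z < b -> `|df z| <= D * f z) ->
  (forall z, I z -> 0 <= f z) ->
  forall x y, I x -> I y -> f x <= expR (D * `|x - y|) * f y.
Proof.
move=> D0 fder dfD f0.
have fc : {within I, continuous f} := has_der_within_continuous fder.
have expder c z : is_derive z 1 (fun u : R => expR (c * u)) (c * expR (c * z)).
  have H1 : is_derive z 1 (fun u : R => c * u) c.
    apply/is_derive_has_der => e e0; exists 1 => // y _ _.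
    by rewrite -mulrBr subrr normr0 mulr_ge0// ltW.
  have := @is_derive1_comp R expR (fun u => c * u) z _ _ (is_derive_expR _) H1.
  by rewrite mulrC.
have prodder c z : a < z < b ->
    is_derive z 1 (fun u : R => f u * expR (c * u)) ((df z + c * f z) * expR (c * z)).
  move=> zab; have H1 : is_derive z 1 f (df z).
    apply: segment_is_derive => //; apply: fder; rewrite /= in_itv/=.
    by case/andP: zab => /ltW -> /ltW ->.
  have := is_deriveM H1 (expder c z).
  by congr is_derive; rewrite /GRing.scale/=; ring.
have prodc c : {within I, continuous (fun u : R => f u * expR (c * u))}.
  move=> z; apply: cvgM; first exact: fc.
  apply: continuous_subspaceT => u; apply: continuous_comp.
    by apply: cvgM; [exact: cvg_cst|exact: cvg_id].
  exact: continuous_expR.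
have down x y : I x -> I y -> x <= y -> f y * expR (- D * y) <= f x * expR (- D * x).
  move=> Ix Iy xy; move: (Ix) (Iy); rewrite /= !in_itv/= => /andP[ax xb] /andP[ay yb].
  apply: (@ler0_derive1_nincr R (fun u => f u * expR (- D * u)) a b) => //.
  - by move=> z; rewrite in_itv/= => /(prodder (- D))[].
  - move=> z; rewrite in_itv/= => zab; have [_] := prodder (- D) z zab.
    rewrite derive1E => ->; rewrite pmulr_lle0 ?expR_gt0//.
    by have := dfD z zab; rewrite ler_norml; lra.
have up x y : I x -> I y -> x <= y -> f x * expR (D * x) <= f y * expR (D * y).
  move=> Ix Iy xy; move: (Ix) (Iy); rewrite /= !in_itv/= => /andP[ax xb] /andP[ay yb].
  apply: (@ger0_derive1_le_cc R (fun u => f u * expR (D * u)) a b) => //;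
    rewrite ?in_itv/= ?ax ?ay//.
  - by move=> z; rewrite in_itv/= => /(prodder D)[].
  - move=> z; rewrite in_itv/= => zab; have [_] := prodder D z zab.
    rewrite derive1E => ->; rewrite mulr_ge0 ?expR_ge0//.
    by have := dfD z zab; rewrite ler_norml; lra.
move=> x y Ix Iy; have [xy|yx] := leP x y.
  have := up x y Ix Iy xy; rewrite -ler_pdivlMr ?expR_gt0// -mulrA -expRN -expRD.
  move/le_trans; apply; rewrite mulrC ler_wpM2r ?f0// ler_expR.
  by rewrite ler0_norm ?subr_le0//; lra.
have := down y x Iy Ix (ltW yx); rewrite -ler_pdivlMr ?expR_gt0// -mulrA -expRN -expRD.
move/le_trans; apply; rewrite mulrC ler_wpM2r ?f0// ler_expR.
by rewrite gtr0_norm ?subr_gt0//; lra.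
Qed.

End SegmentCalculus.

(** * The inverse branches of the unperturbed map *)

Section Geometry.
Context {R : realType} {V : set R} {gamma : R} {F : map_family R}.
Hypothesis HF : standing_assumptions V gamma F.
Implicit Types (e x y z : R) (n k : nat).

Let V0 := V_0 HF.

Lemma I01P x : I01 x <-> 0 <= x <= 1.
Proof. by rewrite /I01/= in_itv. Qed.

Lemma Delta_I01 x : Delta x -> I01 x.
Proof. by move=> /DeltaP ?; apply/I01P; lra. Qed.

Lemma g0_has_der e x : V e -> I01 x -> has_der I01 (g0 F e) x (der I01 (g0 F e) x).
Proof.
move=> Ve Ix; apply: derivable_in_has_der.
by have [/(_ 0%N isT)[]] := (g0_smooth HF).1 e x Ve Ix.
Qed.

Lemma g1_has_der e x : V e -> I01 x -> has_der I01 (g1 F e) x (der I01 (g1 F e) x).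
Proof.
move=> Ve Ix; apply: derivable_in_has_der.
by have [/(_ 0%N isT)[]] := (g1_smooth HF).1 e x Ve Ix.
Qed.

Lemma g0_continuous e : V e -> {within I01, continuous (g0 F e)}.
Proof. by move=> Ve; apply: has_der_within_continuous => x; exact: g0_has_der. Qed.

Lemma g1_continuous e : V e -> {within I01, continuous (g1 F e)}.
Proof. by move=> Ve; apply: has_der_within_continuous => x; exact: g1_has_der. Qed.

Lemma g0_range e x : V e -> I01 x -> 0 <= g0 F e x <= 2^-1.
Proof. by move=> Ve Ix; have [] := g0_inverse HF Ve Ix. Qed.

Lemma g1_range e x : V e -> I01 x -> 2^-1 <= g1 F e x <= 1.
Proof. by move=> Ve Ix; have [] := g1_inverse HF Ve Ix. Qed.

Lemma g0_I01 e x : V e -> I01 x -> I01 (g0 F e x).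
Proof. by move=> Ve Ix; have := g0_range Ve Ix => ?; apply/I01P; lra. Qed.

Lemma iter_g0_I01 e n x : V e -> I01 x -> I01 (iter n (g0 F e) x).
Proof. by move=> Ve Ix; elim: n => //= n; exact: g0_I01. Qed.

Lemma g0_inj e : V e -> {in `[0, 1] &, injective (g0 F e)}.
Proof.
move=> Ve x y Ix Iy E; have [_ <-] := g0_inverse HF Ve Ix.
by have [_ <-] := g0_inverse HF Ve Iy; rewrite E.
Qed.

Lemma g1_inj e : V e -> {in `[0, 1] &, injective (g1 F e)}.
Proof.
move=> Ve x y Ix Iy E; have [_ <-] := g1_inverse HF Ve Ix.
by have [_ <-] := g1_inverse HF Ve Iy; rewrite E.
Qed.

Lemma g0_surj e z : V e -> 0 <= z <= 2^-1 -> exists2 x, I01 x & g0 F e x = z.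
Proof.
move=> Ve Hz; have [fI inj _] := branch0_bij HF Ve.
have Dz : `[0, 2^-1]%classic z by rewrite /= in_itv.
have Ib : I01 (branch0 F e z) := fI _ Dz.
have [r1 r2] := g0_inverse HF Ve Ib.
by exists (branch0 F e z) => //; apply: inj; rewrite ?inE//= in_itv.
Qed.

Lemma g1_surj e z : V e -> 2^-1 <= z <= 1 -> exists2 x, I01 x & g1 F e x = z.
Proof.
move=> Ve Hz; have [fI inj _] := branch1_bij HF Ve.
have Dz : `[2^-1, 1]%classic z by rewrite /= in_itv.
have Ib : I01 (branch1 F e z) := fI _ Dz.
have [r1 r2] := g1_inverse HF Ve Ib.
by exists (branch1 F e z) => //; apply: inj; rewrite ?inE//= in_itv.
Qed.

Lemma g_word_continuous n e : V e -> {within I01, continuous (g_word F n e)}.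
Proof.
move=> Ve.
have gI x d : I01 x -> 0 < d -> exists2 r : R, 0 < r & forall y, I01 y -> `|y - x| < r ->
    `|iter n (g0 F e) y - iter n (g0 F e) x| < d.
  elim: n x d => [|n IH] x d Ix d0; first by exists d.
  have [r r0 Hr] := within_continuousE (g0_continuous Ve) (iter_g0_I01 n Ve Ix) (divr_gt0 d0 (ltr0n R 2)).
  have [r' r'0 Hr'] := IH x r Ix r0; exists r' => // y Iy yx /=.
  apply: le_lt_trans (Hr _ (iter_g0_I01 n Ve Iy) (Hr' _ Iy yx)) _.
  by rewrite ltr_pdivrMr// ltr_pMr// ltr1n.
apply/subspace_continuousP => x Ix; apply/cvgrPdist_le => d d0.
have [r r0 Hr] := within_continuousE (g1_continuous Ve) (iter_g0_I01 n Ve Ix) d0.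
have [r' r'0 Hr'] := gI x r Ix r0; rewrite near_withinE.
exists r' => //= y; rewrite /= distrC => yx Iy; rewrite distrC /g_word.
by apply: Hr; [exact: iter_g0_I01|exact: Hr'].
Qed.

Lemma g_word_inj n e : V e -> {in `[0, 1] &, injective (g_word F n e)}.
Proof.
move=> Ve x y Ix Iy /(g1_inj Ve) H.
have {H} : iter n (g0 F e) x = iter n (g0 F e) y.
  by apply: H; apply: iter_g0_I01.
elim: n => //= n IH /(g0_inj Ve) H; apply: IH; apply: H; exact: iter_g0_I01.
Qed.

Lemma near_half k (d : R) : 0 < d ->
  exists n y, [/\ (k <= n)%N, Delta y & `|g_word F n 0 y - 2^-1| < d].
Proof.
move=> d0; have [z [[n kn [y Dy yz]] zd]] := half_in_closure HF k (nbhsx_ballx _ _ d0).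
exists n, y; split => //; rewrite yz distrC; exact: zd.
Qed.

Let incr (f : R -> R) := {in `[0, 1] &, {homo f : x y / x < y}}.

Let i0 : (0 : R) \in `[0, 1]. Proof. by rewrite in_itv/= lexx ler01. Qed.
Let i1 : (1 : R) \in `[0, 1]. Proof. by rewrite in_itv/= lexx ler01. Qed.
Let ih : (2^-1 : R) \in `[0, 1]. Proof. by rewrite in_itv/=; lra. Qed.
Let hI x : 0 <= x <= 2^-1 -> x \in `[0, 1]. Proof. by rewrite in_itv/=; lra. Qed.

Let iter_g0_half n x : I01 x -> 0 <= iter n.+1 (g0 F 0) x <= 2^-1.
Proof. by move=> Ix /=; apply: g0_range => //; exact: iter_g0_I01. Qed.

Let decr_le (f : R -> R) : {in `[0, 1] &, {homo f : x y /~ x < y}} ->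
  {in `[0, 1] &, {homo f : x y /~ x <= y}}.
Proof.
move=> df x y Ix Iy; rewrite le_eqVlt => /predU1P[->//|yx].
by apply/ltW; exact: df.
Qed.

(** The words [1 0^n] accumulate at [1/2] only if both inverse branches are
    increasing, since a decreasing branch keeps the cylinders away from [1/2]. *)
Lemma g1_increasing : incr (g1 F 0).
Proof.
have [//|decr] := itv_continuous_inj_mono (@g1_continuous 0 V0) (g1_inj V0).
have dle := decr_le decr.
have g11 : g1 F 0 1 = 2^-1.
  have H : 2^-1 <= (2^-1 : R) <= 1 by lra.
  have [x Ix xE] := g1_surj V0 H.
  have := dle 1 x i1 Ix; rewrite xE.
  move: (Ix) => /I01P/andP[_ x1] /(_ x1).
  by have /andP[+ _] := g1_range V0 i1; move=> ? ?; lra.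
have gh : 2^-1 < g1 F 0 2^-1 by rewrite -{1}g11; apply: decr => //; lra.
have [n [y [n1 Dy]]] : exists n y, [/\ (1 <= n)%N, Delta y &
    `|g_word F n 0 y - 2^-1| < g1 F 0 2^-1 - 2^-1].
  by apply: near_half; rewrite subr_gt0.
case: n n1 => // n _; have := iter_g0_half n (Delta_I01 Dy).
rewrite /g_word => u01; set u := iter _ _ _ in u01 *.
have := dle 2^-1 u ih (hI u01); case/andP: (u01) => _ uh /(_ uh).
by rewrite ltr_norml; lra.
Qed.

Let incr_le (f : R -> R) : incr f -> {in `[0, 1] &, {homo f : x y / x <= y}}.
Proof.
move=> df x y Ix Iy; rewrite le_eqVlt => /predU1P[->//|yx].
by apply/ltW; exact: df.
Qed.

Lemma g1_0 : g1 F 0 0 = 2^-1.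
Proof.
have H : 2^-1 <= (2^-1 : R) <= 1 by lra.
have [x Ix xE] := g1_surj V0 H.
have := incr_le g1_increasing i0 Ix; rewrite xE.
move: (Ix) => /I01P/andP[x0 _] /(_ x0).
by have /andP[+ _] := g1_range V0 i0; move=> ? ?; lra.
Qed.

Lemma g1_1 : g1 F 0 1 = 1.
Proof.
have H : 2^-1 <= (1 : R) <= 1 by lra.
have [x Ix xE] := g1_surj V0 H.
have := incr_le g1_increasing Ix i1; rewrite xE.
move: (Ix) => /I01P/andP[_ x1] /(_ x1).
by have /andP[_ +] := g1_range V0 i1; move=> ? ?; lra.
Qed.

Lemma g0_increasing : incr (g0 F 0).
Proof.
have [//|decr] := itv_continuous_inj_mono (@g0_continuous 0 V0) (g0_inj V0).
have dle := decr_le decr.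
have g01 : g0 F 0 1 = 0.
  have H : 0 <= (0 : R) <= 2^-1 by lra.
  have [x Ix xE] := g0_surj V0 H.
  have := dle 1 x i1 Ix; rewrite xE.
  move: (Ix) => /I01P/andP[_ x1] /(_ x1).
  by have /andP[+ _] := g0_range V0 i1; move=> ? ?; lra.
have gh : 0 < g0 F 0 2^-1 by rewrite -{1}g01; apply: decr => //; lra.
have gI : g0 F 0 2^-1 \in `[0, 1] by apply: g0_I01.
have ggh : 2^-1 < g1 F 0 (g0 F 0 2^-1).
  by rewrite -[ltLHS]g1_0; apply: g1_increasing.
have [n [y [n1 Dy]]] : exists n y, [/\ (2 <= n)%N, Delta y &
    `|g_word F n 0 y - 2^-1| < g1 F 0 (g0 F 0 2^-1) - 2^-1].
  by apply: near_half; rewrite subr_gt0.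
case: n n1 => // -[//|n] _; have := iter_g0_half n (Delta_I01 Dy).
have -> : g_word F n.+2 0 y = g1 F 0 (g0 F 0 (iter n.+1 (g0 F 0) y)) by [].
move: (iter n.+1 _ _) => u u01.
have gu := dle 2^-1 u ih (hI u01); case/andP: (u01) => _ /gu {}gu.
have uI : g0 F 0 u \in `[0, 1] by apply: g0_I01 => //; exact: hI.
have := incr_le g1_increasing gI uI gu.
by rewrite ltr_norml; lra.
Qed.

Lemma g0_0 : g0 F 0 0 = 0.
Proof.
have H : 0 <= (0 : R) <= 2^-1 by lra.
have [x Ix xE] := g0_surj V0 H.
have := incr_le g0_increasing i0 Ix; rewrite xE.
move: (Ix) => /I01P/andP[x0 _] /(_ x0).
by have /andP[+ _] := g0_range V0 i0; move=> ? ?; lra.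
Qed.

Lemma g0_1 : g0 F 0 1 = 2^-1.
Proof.
have H : 0 <= (2^-1 : R) <= 2^-1 by lra.
have [x Ix xE] := g0_surj V0 H.
have := incr_le g0_increasing Ix i1; rewrite xE.
move: (Ix) => /I01P/andP[_ x1] /(_ x1).
by have /andP[_ +] := g0_range V0 i1; move=> ? ?; lra.
Qed.

Lemma g_word_increasing n : {in `[0, 1] &, {homo g_word F n 0 : x y / x < y}}.
Proof.
move=> x y Ix Iy xy; apply: g1_increasing; try exact: iter_g0_I01.
by elim: n => //= n IH; apply: g0_increasing => //; exact: iter_g0_I01.
Qed.

Lemma g_word_le n : {in `[0, 1] &, {homo g_word F n 0 : x y / x <= y}}.
Proof. exact: incr_le (@g_word_increasing n). Qed.

(** The cylinder of [1 0^n] is the segment between [endpoint n.+1] and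
    [endpoint n]. *)
Definition endpoint n : R := g_word F n 0 1.

Lemma g_word_half n : g_word F n 0 2^-1 = endpoint n.+1.
Proof. by rewrite /endpoint /g_word iterSr g0_1. Qed.

Lemma endpoint0 : endpoint 0 = 1.
Proof. by rewrite /endpoint /g_word/= g1_1. Qed.

Lemma g_word_0 n : g_word F n 0 0 = 2^-1.
Proof.
rewrite /g_word (_ : iter n _ 0 = 0) ?g1_0//.
by elim: n => //= n ->; exact: g0_0.
Qed.

Lemma endpoint_gt n : 2^-1 < endpoint n.
Proof. by rewrite -(g_word_0 n); apply: g_word_increasing. Qed.

Lemma endpointS n : endpoint n.+1 < endpoint n.
Proof. by rewrite -g_word_half; apply: g_word_increasing => //; lra. Qed.

Lemma endpoint_le n k : (n <= k)%N -> endpoint k <= endpoint n.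
Proof.
move=> /subnK <-; elim: (k - n)%N => //= i IH; rewrite addSn.
by apply: le_trans IH; exact/ltW/endpointS.
Qed.

Lemma endpoint_le1 n : endpoint n <= 1.
Proof. by rewrite -endpoint0; exact: endpoint_le. Qed.

Lemma endpoint_small (d : R) : 0 < d ->
  exists N, forall n, (N <= n)%N -> endpoint n < 2^-1 + d.
Proof.
move=> d0; have [n [y [_ Dy yd]]] := near_half 0 d0.
exists n.+1 => k nk; apply: le_lt_trans (endpoint_le nk) _.
rewrite -g_word_half; move: (Dy) => /DeltaP/andP[hy y1].
have Iy : y \in `[0, 1] by apply: Delta_I01.
have := g_word_le n ih Iy hy; move: yd; rewrite ltr_norml; lra.
Qed.

Lemma Delta_in01 y : Delta y -> y \in `[0, 1].
Proof. exact: Delta_I01. Qed.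

Lemma g_word_Delta_range n y : Delta y ->
  endpoint n.+1 <= g_word F n 0 y <= endpoint n.
Proof.
move=> Dy; have Iy := Delta_in01 Dy; move: (Dy) => /DeltaP/andP[hy y1].
by rewrite -g_word_half !g_word_le.
Qed.

Lemma g_word_surj n z : endpoint n.+1 <= z <= endpoint n ->
  exists2 y, Delta y & g_word F n 0 y = z.
Proof.
rewrite -g_word_half => zI.
have hle1 : (2^-1 : R) <= 1 by lra.
have [||y yI <-] := @IVT R (g_word F n 0) 2^-1 1 z hle1.
- apply: (@continuous_subspaceW _ _ _ I01); last exact: g_word_continuous.
  by move=> x; exact: Delta_I01.
- rewrite min_l ?max_r ?g_word_le//.
- by exists y => //; apply/DeltaP; rewrite in_itv in yI.
Qed.

Lemma g_word_surj_open n z : endpoint n.+1 < z < endpoint n ->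
  exists2 y, 2^-1 < y < 1 & g_word F n 0 y = z.
Proof.
move=> /andP[z1 z2]; have zI : endpoint n.+1 <= z <= endpoint n by rewrite !ltW.
have [y Dy yz] := g_word_surj zI; exists y => //.
move: (Dy) => /DeltaP/andP[hy y1]; rewrite !lt_neqAle hy y1 !andbT.
apply/andP; split; apply/eqP => E.
  by move: z1; rewrite -yz -E g_word_half ltxx.
by move: z2; rewrite -yz E ltxx.
Qed.

Lemma cylE n : cyl F n 0 = `[endpoint n.+1, endpoint n]%classic.
Proof.
apply/seteqP; split => z /=; rewrite in_itv/=.
  by move=> [y Dy <-]; exact: g_word_Delta_range.
by move=> /g_word_surj[y Dy <-]; exists y.
Qed.

(** The end points decrease to [1/2]: the index sought is the last one whose end
    point is at least [z]. *)
Lemma endpoint_locate k z : 2^-1 < z <= endpoint k ->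
  exists n, (k <= n)%N /\ endpoint n.+1 < z <= endpoint n.
Proof.
move=> /andP[hz zk].
have [N HN] : exists N, forall n, (N <= n)%N -> endpoint n < z.
  have z0 : 0 < z - 2^-1 by rewrite subr_gt0.
  by have [N HN] := endpoint_small z0; exists N => n /HN; lra.
have exP : exists n, endpoint n < z by exists N; exact: HN.
case: (ex_minnP exP) => m mz mmin.
case: m => [|m] in mz mmin *.
  by move: mz; rewrite endpoint0 ltNge (le_trans zk (endpoint_le1 k)).
exists m; rewrite mz; split.
  rewrite leqNgt; apply/negP => mk.
  by have := endpoint_le mk; rewrite leNgt (lt_le_trans mz zk).
by rewrite leNgt; apply/negP => /mmin; rewrite ltnn.
Qed.

Lemma tail_cylinders k :
  \bigcup_(n in [set n | (k <= n)%N]) cyl F n 0 = `]2^-1, endpoint k]%classic.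
Proof.
apply/seteqP; split => z /=; rewrite in_itv/=.
  move=> [n /= kn]; rewrite cylE/= in_itv/= => /andP[z1 z2].
  by rewrite (lt_le_trans (endpoint_gt n.+1) z1) (le_trans z2 (endpoint_le kn)).
move=> /endpoint_locate[n [kn /andP[z1 z2]]]; exists n => //.
by rewrite cylE/= in_itv/= z2 ltW.
Qed.

Lemma deltaE k : delta F k = endpoint k - 2^-1.
Proof.
rewrite /delta tail_cylinders /mu lebesgue_measure_itv/= lte_fin endpoint_gt.
by rewrite -EFinD.
Qed.

End Geometry.

(** * Regularity of the induced inverse branches *)

Section WordRegularity.
Context {R : realType} {V : set R} {gamma : R} {F : map_family R}.
Hypothesis gamma01 : 0 < gamma < 1.
Hypothesis HF : standing_assumptions V gamma F.
Implicit Types (e x y z : R) (n k : nat).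

Let V0 := V_0 HF.
Let Vne : V !=set0. Proof. by exists 0. Qed.
Let h1 : (2^-1 : R) < 1. Proof. by lra. Qed.

Local Notation gd j n e := (dern Delta j (g_word F n e)).
Local Notation ad j n e := (dern Delta j (pd (g_word F n) e)).

Lemma Delta_limit_pt x : Delta x -> limit_pt Delta x.
Proof. exact: (segment_limit_pt h1). Qed.

Lemma word_has_der0 n e x : V e -> Delta x ->
  has_der Delta (g_word F n e) x (gd 1 n e x).
Proof.
move=> Ve Dx; apply: derivable_in_has_der.
by have [/(_ 0%N isT)[]] := g_word_smooth HF n Ve Dx.
Qed.

Lemma word_has_der1 n e x : V e -> Delta x ->
  has_der Delta (gd 1 n e) x (gd 2 n e x).
Proof.
move=> Ve Dx; apply: derivable_in_has_der.
by have [/(_ 1%N isT)[]] := g_word_smooth HF n Ve Dx.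
Qed.

Lemma word_has_der2 n e x : V e -> Delta x ->
  has_der Delta (gd 2 n e) x (gd 3 n e x).
Proof.
by move=> Ve Dx; apply: derivable_in_has_der; exact: (g_word_derivable3 HF).
Qed.

Lemma pd_word_has_der0 n e x : V e -> Delta x ->
  has_der Delta (pd (g_word F n) e) x (ad 1 n e x).
Proof.
move=> Ve Dx; apply: derivable_in_has_der.
by have [/(_ 0%N isT)[]] := g_word_smooth HF n Ve Dx.
Qed.

Lemma pd_word_has_der1 n e x : V e -> Delta x ->
  has_der Delta (ad 1 n e) x (ad 2 n e x).
Proof.
move=> Ve Dx; apply: derivable_in_has_der.
by have [/(_ 1%N isT)[]] := g_word_smooth HF n Ve Dx.
Qed.

Lemma pderivable_has_der (u : R -> R -> R) e x : pderivable u e x ->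
  has_der setT (fun e' => u e' x) e (pd u e x).
Proof.
move=> du; apply/is_derive_has_der; rewrite /pd derive1E.
exact: DeriveDef.
Qed.

Lemma has_der_pd (u : R -> R -> R) e x l :
  has_der setT (fun e' => u e' x) e l -> pd u e x = l.
Proof. by move=> /is_derive_has_der[_ <-]; rewrite /pd derive1E. Qed.

Lemma word_pd j n e x : (j <= 2)%N -> V e -> Delta x ->
  has_der setT (fun e' => gd j n e' x) e (ad j n e x).
Proof.
move=> j2 Ve Dx; have [_ /(_ j j2)[H <-]] := g_word_smooth HF n Ve Dx.
exact: (pderivable_has_der H).
Qed.

(** Away from [1/2] the derivatives relative to [0, 1] and to [Delta] are limits
    along the same filter. *)
Lemma der_I01_Delta (f : R -> R) x : 2^-1 < x -> der I01 f x = der Delta f x.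
Proof.
move=> hx; rewrite /der; suff -> : within I01 (x^') = within Delta (x^') by [].
apply/seteqP; split => A; rewrite /within/= => -[d /= d0 Hd].
  by exists d => //= y yx yx0 /Delta_I01; exact: Hd.
exists (Num.min d (x - 2^-1)); first by rewrite /= lt_min d0 subr_gt0.
move=> y /=; rewrite lt_min => /andP[yd yh] yx0 /I01P Iy; apply: Hd => //.
by apply/DeltaP; move: yh; rewrite ltr_norml; lra.
Qed.

Lemma dg_word_continuous n e : V e -> {within `]0, 1]%classic, continuous (dg_word F n e)}.
Proof. by move=> Ve; have [] := dg_word_in_B HF n Ve. Qed.

Lemma Delta_pos x : Delta x -> `]0, 1]%classic x.
Proof. by move=> /DeltaP; rewrite /= in_itv/=; lra. Qed.

Lemma dg_word_continuous_Delta n e : V e -> {within Delta, continuous (dg_word F n e)}.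
Proof.
by move=> Ve; exact: (continuous_subspaceW Delta_pos (@dg_word_continuous n e Ve)).
Qed.

(** At [1/2] the two derivatives are relative to different sets, but both are
    continuous along [Delta]. *)
Lemma dg_wordE n e x : V e -> Delta x -> dg_word F n e x = gd 1 n e x.
Proof.
move=> Ve Dx; have [hx|] := ltP 2^-1 x; first exact: der_I01_Delta.
move=> xh; have {xh} -> : x = 2^-1 by move: Dx => /DeltaP; lra.
have Dh : Delta (2^-1 : R) by apply/DeltaP; lra.
apply/eqP; rewrite -subr_eq0 -normr_le0; apply/ler_addgt0Pr => d d0.
have [r1 r10 H1] := within_continuousE (@dg_word_continuous_Delta n e Ve) Dh (divr_gt0 d0 (ltr0n R 2)).
have [r2 r20 H2] := has_der_continuous (word_has_der1 n Ve Dh) (divr_gt0 d0 (ltr0n R 2)).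
pose r := Num.min (4^-1) (Num.min (r1 / 2) (r2 / 2)).
have r0 : 0 < r by rewrite !lt_min invr_gt0 ltr0n !divr_gt0.
have [r4 [rr1 rr2]] : r <= 4^-1 /\ (r < r1 /\ r < r2).
  have := lexx r; rewrite {2}/r !le_min => /and3P[? ? ?]; split => //.
  by split; lra.
have Dy : Delta (2^-1 + r) by apply/DeltaP; lra.
have yr : `|2^-1 + r - 2^-1| = r by rewrite addrC addKr gtr0_norm.
have := H1 _ Dy; rewrite yr => /(_ rr1).
have := H2 _ Dy; rewrite yr => /(_ rr2).
have -> : dg_word F n e (2^-1 + r) = gd 1 n e (2^-1 + r).
  by apply: der_I01_Delta; lra.
set u := gd 1 n e (2^-1 + r); rewrite add0r.
move=> A B; rewrite (_ : _ - _ = (u - gd 1 n e 2^-1) - (u - dg_word F n e 2^-1)); last by ring.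
by apply: (le_trans (ler_normB _ _)); lra.
Qed.

Lemma word_strict_mono n e : V e ->
  {in `[2^-1, 1] &, {homo g_word F n e : x y / x < y}} \/
  {in `[2^-1, 1] &, {homo g_word F n e : x y /~ x < y}}.
Proof.
move=> Ve; apply: itv_continuous_inj_mono.
  apply: (@continuous_subspaceW _ _ _ I01); last exact: g_word_continuous HF _ _ Ve.
  exact: Delta_I01.
by move=> x y Dx Dy; apply: (g_word_inj HF Ve); exact: Delta_in01.
Qed.

Lemma word_cont_Delta n e : V e -> {within Delta, continuous (g_word F n e)}.
Proof.
move=> Ve; apply: (@continuous_subspaceW _ _ _ I01); last exact: g_word_continuous HF _ _ Ve.
exact: Delta_I01.
Qed.

(** The branch is strictly monotone, and the intermediate value theorem applies
    between two points on both sides of [y]. *)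
Lemma word_open n e y (d : R) : V e -> 2^-1 < y < 1 -> 0 < d ->
  exists2 r : R, 0 < r & forall z, `|z - g_word F n e y| < r ->
    exists y', [/\ 2^-1 < y' < 1, `|y' - y| < d & g_word F n e y' = z].
Proof.
move=> Ve yI d0.
pose t := Num.min (d / 2) (Num.min ((y - 2^-1) / 2) ((1 - y) / 2)).
have t0 : 0 < t by case/andP: yI => ? ?; rewrite !lt_min !divr_gt0// subr_gt0.
have [td [ty1 ty2]] : t <= d / 2 /\ (t <= (y - 2^-1) / 2 /\ t <= (1 - y) / 2).
  by have := lexx t; rewrite {2}/t !le_min => /and3P[].
have DI u : y - t <= u <= y + t -> u \in `[2^-1, 1].
  by rewrite in_itv/=; case/andP: yI => ? ?; lra.
have Dm : y - t \in `[2^-1, 1] by apply: DI; lra.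
have Dp : y + t \in `[2^-1, 1] by apply: DI; lra.
have Dy : y \in `[2^-1, 1] by apply: DI; lra.
pose f := g_word F n e.
have IVTf v : Num.min (f (y - t)) (f (y + t)) <= v <= Num.max (f (y - t)) (f (y + t)) ->
    exists y', [/\ 2^-1 < y' < 1, `|y' - y| < d & f y' = v].
  move=> Hv; have [||y' y'I <-] := @IVT R f (y - t) (y + t) v _ _ Hv.
  - by lra.
  - apply: (@continuous_subspaceW _ _ _ Delta); last exact: word_cont_Delta.
    by move=> u; rewrite /= in_itv/= => /DI.
  - exists y'; move: y'I; rewrite in_itv/= ltr_norml => y'I; split => //.
      by case/andP: yI => ? ?; lra.
    by lra.
have [incr|decr] := word_strict_mono n Ve.
- have f1 : f (y - t) < f y by apply: incr => //; lra.
  have f2 : f y < f (y + t) by apply: incr => //; lra.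
  exists (Num.min (f y - f (y - t)) (f (y + t) - f y)).
    by rewrite lt_min !subr_gt0 f1.
  move=> z; rewrite lt_min !ltr_norml => zI; apply: IVTf.
  have f12 := lt_trans f1 f2; rewrite (min_l (ltW f12)) (max_r (ltW f12)).
  by rewrite -/(f y) in zI; lra.
- have f1 : f y < f (y - t) by apply: decr => //; lra.
  have f2 : f (y + t) < f y by apply: decr => //; lra.
  exists (Num.min (f (y - t) - f y) (f y - f (y + t))).
    by rewrite lt_min !subr_gt0 f1.
  move=> z; rewrite lt_min !ltr_norml => zI; apply: IVTf.
  have f12 := lt_trans f2 f1; rewrite (min_r (ltW f12)) (max_l (ltW f12)).
  by rewrite -/(f y) in zI; lra.
Qed.

Lemma open_Delta y : 2^-1 < y < 1 -> Delta y.
Proof. by move=> ?; apply/DeltaP; lra. Qed.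

Lemma Delta_interior y : 2^-1 < y < 1 -> (Delta°)%classic y.
Proof.
move=> yI; have [r r0 Hr] := segment_interior yI.
exists r => //= z; rewrite /= distrC => /Hr; exact: open_Delta.
Qed.

Lemma cyl_interior n e y : V e -> 2^-1 < y < 1 ->
  ((cyl F n e)°)%classic (g_word F n e y).
Proof.
move=> Ve yI; have [r r0 Hr] := word_open n Ve yI ltr01.
exists r => //= z; rewrite /= distrC => /Hr[y' [y'I _ <-]].
by exists y' => //; exact: open_Delta.
Qed.

Lemma word_inverse n e y : V e -> 2^-1 < y < 1 -> Defs.induced F e (g_word F n e y) = y.
Proof. by move=> Ve /Delta_interior yI; exact: (g_word_inverse HF). Qed.

Lemma word_is_derive n e y : V e -> 2^-1 < y < 1 ->
  is_derive y 1 (g_word F n e) (gd 1 n e y).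
Proof.
move=> Ve yI; apply: (segment_is_derive yI); apply: word_has_der0 => //.
exact: open_Delta.
Qed.

Lemma induced_is_derive n e y : V e -> 2^-1 < y < 1 ->
  is_derive (g_word F n e y) 1 (Defs.induced F e) (derive1 (Defs.induced F e) (g_word F n e y)).
Proof.
move=> Ve yI; rewrite derive1E.
have [/(_ 0%N isT) H _] := induced_C3 HF Ve (cyl_interior n Ve yI).
exact: (DeriveDef H erefl).
Qed.

Lemma induced_chain n e y : V e -> 2^-1 < y < 1 ->
  derive1 (Defs.induced F e) (g_word F n e y) * gd 1 n e y = 1.
Proof.
move=> Ve yI.
have H1 := is_derive1_comp (induced_is_derive n Ve yI) (word_is_derive n Ve yI).
have H2 : is_derive y 1 (Defs.induced F e \o g_word F n e) 1.
  apply/is_derive_has_der; apply: (@eq_has_der _ _ id).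
  - have [r r0 Hr] := segment_interior yI; exists r => // z _ /Hr zI /=.
    by rewrite word_inverse.
  - by rewrite /= word_inverse.
  - by move=> d d0; exists 1 => // z _ _; rewrite mul1r subrr normr0 mulr_ge0// ltW.
by have [_ <-] := H1; have [_ ->] := H2.
Qed.

Lemma gd1_neq0 n e y : V e -> 2^-1 < y < 1 -> gd 1 n e y != 0.
Proof.
move=> Ve yI; apply/eqP => g0; have := induced_chain n Ve yI.
by rewrite g0 mulr0 => /eqP; rewrite eq_sym oner_eq0.
Qed.

Lemma has_der_nondecreasing (D : set R) (f : R -> R) x l : limit_pt D x ->
  has_der D f x l -> {in D &, {homo f : u v / u <= v}} -> D x -> 0 <= l.
Proof.
move=> accx H fmono Dx; rewrite leNgt; apply/negP => l0.
have l20 : 0 < - l / 2 by rewrite divr_gt0// oppr_gt0.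
have [d d0 Hd] := H _ l20; have [y [Dy yx ydx]] := accx d d0.
have n0 : 0 < `|y - x| by rewrite normr_gt0 subr_eq0.
have := Hd y Dy ydx; have [xy|xy] := leP x y.
  have fxy : f x <= f y by apply: fmono => //; rewrite inE.
  rewrite (ger0_norm (_ : 0 <= y - x)) ?subr_ge0// ler_norml => /andP[_].
  have : 0 < y - x by move: n0; rewrite ger0_norm ?subr_ge0.
  by nra.
have fxy : f y <= f x by apply: fmono; rewrite ?inE//; exact: ltW.
rewrite (ltr0_norm (_ : y - x < 0)) ?subr_lt0// ler_norml => /andP[+ _].
have : 0 < x - y by rewrite subr_gt0.
by nra.
Qed.

Lemma gd1_ge0 n x : Delta x -> 0 <= gd 1 n 0 x.
Proof.
move=> Dx; apply: (has_der_nondecreasing (Delta_limit_pt Dx)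
  (word_has_der0 n V0 Dx)) => //.
move=> u v /set_mem Du /set_mem Dv.
by apply: (g_word_le HF); exact: Delta_in01.
Qed.

Lemma gd1_gt0_open n y : 2^-1 < y < 1 -> 0 < gd 1 n 0 y.
Proof.
by move=> yI; rewrite lt_neqAle eq_sym gd1_neq0//= gd1_ge0//; exact: open_Delta.
Qed.

Lemma gd1_contract : exists2 rho : R, 0 <= rho < 1 &
  forall n x, Delta x -> gd 1 n 0 x <= rho.
Proof.
have [lambda lambda1 Hl] := induced_expanding HF V0.
have l0 : 0 < lambda by exact: lt_trans lambda1.
exists lambda^-1; first by rewrite invr_ge0 ltW//= invf_lt1.
move=> n x; apply: (@segment_closure_le _ _ _ h1).
  by apply: (@has_der_within_continuous _ _ _ (gd 2 n 0)) => y; exact: word_has_der1.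
move=> y yI; have := induced_chain n V0 yI.
have := Hl n _ (cyl_interior n V0 yI).
set T' := derive1 _ _ => lT E.
have g0 := gd1_gt0_open n yI.
rewrite -[leRHS]mul1r ler_pdivlMr// -[leRHS](ger0_norm ler01) -E normrM.
by rewrite [`|gd 1 n 0 y|]gtr0_norm// mulrC ler_wpM2r// ltW.
Qed.

(** The bound on [g'' / g'] integrates to a bound on the ratios of [g']; it
    extends to the end points, where [g'] is positive for the same reason. *)
Lemma distortion_cst : exists2 D : R, 0 <= D &
  (forall n x y, Delta x -> Delta y ->
    gd 1 n 0 x <= expR (D * `|x - y|) * gd 1 n 0 y) /\
  (forall n x, Delta x -> `|gd 2 n 0 x| <= D * gd 1 n 0 x).
Proof.
have [D D0 HD] := bounded_sup_norm (bounded_distortion HF).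
exists D => //.
have open_bound n y : 2^-1 < y < 1 -> `|gd 2 n 0 y| <= D * gd 1 n 0 y.
  move=> yI; have g0 := gd1_gt0_open n yI; have := HD n 0 y V0 (open_Delta yI).
  by rewrite normrM normfV (gtr0_norm g0) ler_pdivrMr.
have dist n x y : Delta x -> Delta y ->
    gd 1 n 0 x <= expR (D * `|x - y|) * gd 1 n 0 y.
  pose f : R -> R := gd 1 n 0.
  have fder z : Delta z -> has_der Delta f z (gd 2 n 0 z) by exact: word_has_der1.
  have f0 z : Delta z -> 0 <= f z by exact: gd1_ge0.
  have H := @segment_gronwall R 2^-1 1 f (gd 2 n 0) D D0 fder (open_bound n) f0.
  exact: (H x y).
split => // n x Dx.
have m1 : 2^-1 < (3 / 4 : R) < 1 by lra.
have g0 : 0 < gd 1 n 0 x.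
  have := dist n _ _ (open_Delta m1) Dx.
  have := gd1_gt0_open n m1.
  move=> Hm Hle; rewrite lt_neqAle gd1_ge0// andbT.
  by apply/eqP => E; move: Hle; rewrite -E mulr0 => /(lt_le_trans Hm); rewrite ltxx.
have := HD n 0 x V0 Dx.
by rewrite normrM normfV (gtr0_norm g0) ler_pdivrMr.
Qed.

Lemma weighted_bound (f : nat -> R -> R -> R) :
  (\sum_(0 <= n <oo) sup_on V (fun e => B_norm gamma (f n e)) < +oo)%E ->
  exists p : nat -> R, [/\ forall n, 0 <= p n, cvgn (series p) &
    forall n e x, V e -> 0 < x <= 1 -> `|f n e x| <= p n * x `^ (- gamma)].
Proof.
move=> Hsum.
have pos0 : (`]0, 1]%classic : set R) !=set0 by exists 1; rewrite /= in_itv/= ltr01 lexx.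
have [p [p0 cp Hp]] := @summable_sup_norm _ V `]0, 1]%classic
  (fun n e x => x `^ gamma * f n e x) Vne pos0 Hsum.
exists p; split => // n e x Ve x01.
have xg : 0 < x `^ gamma by rewrite powR_gt0//; case/andP: x01.
have := Hp n e x Ve; rewrite /= in_itv/= => /(_ x01).
by rewrite normrM gtr0_norm// powRN ler_pdivlMr// mulrC.
Qed.

Lemma powRN_le2 x : Delta x -> x `^ (- gamma) <= 2.
Proof.
move=> /DeltaP/andP[hx x1]; have x0 : 0 < x by lra.
rewrite powRN -[leRHS]invrK lef_pV2 ?posrE ?powR_gt0// ?invr_gt0//.
apply: (le_trans hx); rewrite -[leLHS]powRr1 ?(ltW x0)//.
by apply: ger_powR; [rewrite x0|case/andP: gamma01 => _ /ltW].
Qed.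

Lemma expanding_words : exists (s : nat -> R) (rho D : R),
  [/\ 0 <= rho < 1, 0 <= D, (forall n, 0 <= s n), cvgn (series s) &
   [/\ (forall n x, Delta x -> gd 1 n 0 x <= rho),
   (forall n x, Delta x -> gd 1 n 0 x <= s n),
   (forall n x, Delta x -> `|gd 2 n 0 x| <= s n),
   (forall n x, Delta x -> `|gd 3 n 0 x| <= s n) &
   (forall n x y, Delta x -> Delta y ->
     gd 1 n 0 x <= expR (D * `|x - y|) * gd 1 n 0 y) /\
   (forall n x, Delta x -> `|gd 2 n 0 x| <= D * gd 1 n 0 x)]].
Proof.
have Dne : (@Delta R) !=set0 by exists 1; exact: Delta1.
have [rho rho01 Hrho] := gd1_contract.
have [D D0 HD] := distortion_cst.
have [p [p0 cp Hp]] := weighted_bound (sum_dg_word HF).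
have [s2 [s20 cs2 Hs2]] := summable_sup_norm Vne Dne (sum_dern_g_word HF (isT : 2 <= 2 <= 3)%N).
have [s3 [s30 cs3 Hs3]] := summable_sup_norm Vne Dne (sum_dern_g_word HF (isT : 2 <= 3 <= 3)%N).
exists (fun n => 2 * p n + (s2 n + s3 n)), rho, D; split => //.
- by move=> n; rewrite !addr_ge0// mulr_ge0.
- by apply: cvg_seriesD; [exact: cvg_seriesZ|exact: cvg_seriesD].
split => // n x Dx.
- rewrite -dg_wordE//; apply: (le_trans (ler_norm _)).
  have x01 : 0 < x <= 1 by move: Dx => /DeltaP; lra.
  apply: (le_trans (Hp n 0 x V0 x01)).
  have := ler_wpM2l (p0 n) (powRN_le2 Dx); have := s20 n; have := s30 n; lra.
- by have := Hs2 n 0 x V0 Dx; have := p0 n; have := s30 n; lra.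
- by have := Hs3 n 0 x V0 Dx; have := p0 n; have := s20 n; lra.
Qed.

End WordRegularity.

(** * Change of variables along the inverse branches *)

Section WordIntegrals.
Context {R : realType} {V : set R} {gamma : R} {F : map_family R}.
Hypothesis HF : standing_assumptions V gamma F.
Implicit Types (e x y z t : R) (n k : nat).

Let V0 := V_0 HF.

Local Notation G n := (g_word F n 0).
Local Notation G1 n := (dg_word F n 0).
Local Notation endpoint := (@endpoint R F).

Lemma has_der_comp (D E : set R) (f g : R -> R) x l l' :
  has_der D f x l -> (forall y, D y -> E (f y)) -> has_der E g (f x) l' ->
  has_der D (fun y => g (f y)) x (l' * l).
Proof.
move=> Hf fE Hg e e0.
pose c : R := `|l| + `|l'| + 1.
have c0 : 0 < c by rewrite ltr_wpDl// addr_ge0.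
pose e1 : R := Num.min 1 (e / (2 * c)).
have e10 : 0 < e1 by rewrite lt_min ltr01 divr_gt0// mulr_gt0.
have [e11 e1e] : e1 <= 1 /\ e1 * (2 * c) <= e.
  split; first by rewrite ge_min lexx.
  by rewrite -ler_pdivlMr ?mulr_gt0// ge_min lexx orbT.
have [d1 d10 H1] := Hf e1 e10.
have [d2 d20 H2] := Hg e1 e10.
have [d3 d30 H3] := has_der_continuous Hf (divr_gt0 d20 (ltr0n R 2)).
exists (Num.min d1 d3); first by rewrite lt_min d10.
move=> y Dy; rewrite lt_min => /andP[yd1 yd3].
have A1 := H1 y Dy yd1.
have A3 : `|f y - f x| < d2 by apply: le_lt_trans (H3 y Dy yd3) _; lra.
have A2 := H2 _ (fE _ Dy) A3.
set u : R := `|y - x| in A1 *.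
have fyx : `|f y - f x| <= (`|l| + 1) * u.
  rewrite (_ : f y - f x = (f y - f x - l * (y - x)) + l * (y - x)); last by ring.
  apply: (le_trans (ler_normD _ _)); rewrite normrM -/u.
  by have := ler_wpM2r (normr_ge0 (y - x)) e11; rewrite -/u; lra.
rewrite (_ : _ - _ = (g (f y) - g (f x) - l' * (f y - f x)) +
  l' * (f y - f x - l * (y - x))); last by ring.
apply: (le_trans (ler_normD _ _)); rewrite normrM.
apply: (@le_trans _ _ (e1 * ((`|l| + 1) * u) + `|l'| * (e1 * u))).
  by apply: lerD; [apply: (le_trans A2); rewrite ler_wpM2l// ltW|rewrite ler_wpM2l].
have u0 : 0 <= u by exact: normr_ge0.
apply: (@le_trans _ _ (e1 * (2 * c) * u)); last by rewrite ler_wpM2r.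
have -> : e1 * ((`|l| + 1) * u) + `|l'| * (e1 * u) = e1 * c * u by rewrite /c; ring.
have : 0 <= e1 * c * u by rewrite !mulr_ge0// ltW.
lra.
Qed.

Lemma iter_g0_has_der n x : I01 x ->
  has_der I01 (iter n (g0 F 0)) x (der I01 (iter n (g0 F 0)) x).
Proof.
move=> Ix; have accx : limit_pt I01 x := segment_limit_pt ltr01 Ix.
suff [l Hl] : exists l, has_der I01 (iter n (g0 F 0)) x l.
  by have [_ ->] := has_der_der accx Hl.
elim: n => [|n [l Hl]].
  by exists 1 => d d0; exists 1 => // y _ _; rewrite /= mul1r subrr normr0 mulr_ge0// ltW.
exists (der I01 (g0 F 0) (iter n (g0 F 0) x) * l).
apply: (has_der_comp Hl (fun y => iter_g0_I01 HF n V0)).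
exact: (g0_has_der HF V0 (iter_g0_I01 HF n V0 Ix)).
Qed.

Lemma g_word_has_der n x : I01 x -> has_der I01 (G n) x (G1 n x).
Proof.
move=> Ix; have accx : limit_pt I01 x := segment_limit_pt ltr01 Ix.
have H := has_der_comp (iter_g0_has_der n Ix) (fun y => iter_g0_I01 HF n V0)
  (g1_has_der HF V0 (iter_g0_I01 HF n V0 Ix)).
by have [_ E] := has_der_der accx H; rewrite /dg_word E.
Qed.

Lemma dg_word_ge0 n x : I01 x -> 0 <= G1 n x.
Proof.
move=> Ix; have accx : limit_pt I01 x := segment_limit_pt ltr01 Ix.
apply: (has_der_nondecreasing accx (g_word_has_der n Ix)) => //.
by move=> u v /set_mem Du /set_mem Dv; exact: (g_word_le HF).
Qed.

Lemma word_change_of_variables n t (phi : R -> \bar R) : 0 < t < 1 ->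
  measurable_fun `]G n t, endpoint n]%classic phi ->
  (forall y, y \in `]G n t, endpoint n] -> 0 <= phi y)%E ->
  (\int[mu]_(x in `]t, 1%R]) (phi (G n x) * (G1 n x)%:E) =
   \int[mu]_(y in `]G n t, endpoint n]) phi y)%E.
Proof.
move=> /andP[t0 t1] mphi phi0.
have tI x : x \in `[t, 1] -> x \in `[0, 1].
  by rewrite !in_itv/= => /andP[tx ->]; rewrite (le_trans (ltW t0) tx).
apply: ge0_change_of_variables => //.
- by move=> x y /tI Ix /tI Iy; exact: (g_word_increasing HF).
- by apply: continuous_subspaceW (@g_word_continuous _ _ _ _ HF n 0 V0) => x; exact: tI.
- apply: continuous_subspaceW (@dg_word_continuous _ _ _ _ HF n 0 V0) => x.
  by rewrite /= !in_itv/= => /andP[tx ->]; rewrite (lt_le_trans t0 tx).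
- by move=> x /tI Ix; exact: dg_word_ge0.
- move=> x; rewrite in_itv/= => /andP[tx x1].
  have x01 : 0 < x < 1 by rewrite (lt_trans t0 tx).
  apply: (segment_is_derive x01); apply: g_word_has_der.
  by apply/I01P; case/andP: x01 => /ltW -> /ltW ->.
Qed.

Lemma word_Delta n x : Delta x -> Delta (G n x).
Proof. by move=> Dx; apply: (cyl_sub HF (n := n) V0); exists x. Qed.

Lemma measurable_word n (phi : R -> \bar R) : measurable_fun (@Delta R) phi ->
  measurable_fun (@Delta R) (fun x => phi (G n x) * (G1 n x)%:E)%E.
Proof.
move=> mphi; apply: emeasurable_funM.
  apply: (measurable_comp measurable_Delta) => //.
    by move=> _ [x Dx <-]; exact: word_Delta.
  apply: subspace_continuous_measurable_fun; first exact: measurable_Delta.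
  exact: (@word_cont_Delta _ _ _ _ HF n 0 V0).
apply/measurable_EFinP; apply: subspace_continuous_measurable_fun.
  exact: measurable_Delta.
exact: (@dg_word_continuous_Delta _ _ _ _ HF n 0 V0).
Qed.

Lemma dg_word_Delta_ge0 n x : Delta x -> 0 <= G1 n x.
Proof. by move=> /Delta_I01; exact: dg_word_ge0. Qed.

Lemma integral_Delta_open (phi : R -> \bar R) : measurable_fun (@Delta R) phi ->
  (\int[mu]_(x in Delta) phi x = \int[mu]_(x in `]2^-1%R, 1%R]) phi x)%E.
Proof.
move=> mphi; rewrite /mu /Delta -integral_itv_obnd_cbnd//.
apply: (measurable_funS _ _ mphi); first exact: measurable_Delta.
exact: subset_itv_oc_cc.
Qed.

(** The transfer operator is dual to the composition with the induced map: each
    branch carries [Delta] onto its cylinder and the cylinders partition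
    [Delta]. *)
Lemma transfer_integral (phi : R -> \bar R) : measurable_fun (@Delta R) phi ->
  (forall x, Delta x -> 0 <= phi x)%E ->
  (\int[mu]_(x in Delta) (\sum_(0 <= n <oo) phi (G n x) * (G1 n x)%:E) =
   \int[mu]_(x in Delta) phi x)%E.
Proof.
move=> mphi phi0.
pose cell n : set R := `]endpoint n.+1, endpoint n]%classic.
have cellE : \bigcup_n cell n = `]2^-1, 1]%classic.
  apply/seteqP; split => z.
    move=> [n _]; rewrite /cell/= !in_itv/= => /andP[z1 z2].
    by rewrite (lt_trans (endpoint_gt HF _) z1) (le_trans z2 (endpoint_le1 HF n)).
  rewrite /= in_itv/= => zI; have {}zI : 2^-1 < z <= endpoint 0 by rewrite (endpoint0 HF).
  by have [n [_ zn]] := endpoint_locate HF zI; exists n => //; rewrite /cell/= in_itv.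
have halfD : `]2^-1, 1]%classic `<=` (@Delta R) by exact: subset_itv_oc_cc.
have cellD n : cell n `<=` (@Delta R).
  by apply: subset_trans halfD; rewrite -cellE; exact: bigcup_sup.
rewrite integral_nneseries; last 3 first.
- exact: measurable_Delta.
- by move=> n; exact: measurable_word.
- by move=> n x Dx; rewrite mule_ge0 ?phi0 ?lee_fin ?dg_word_Delta_ge0//; exact: word_Delta.
rewrite [RHS]integral_Delta_open// -cellE ge0_integral_bigcup.
- apply: eq_eseriesr => n _.
  rewrite integral_Delta_open; last exact: measurable_word.
  have h01 : 0 < (2^-1 : R) < 1 by lra.
  rewrite (@word_change_of_variables n 2^-1) ?(g_word_half HF)//.
    by apply: measurable_funS mphi; [exact: measurable_Delta|exact: cellD].
  by move=> y yc; apply: phi0; apply: cellD yc.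
- by move=> n; exact: measurable_itv.
- by apply: measurable_funS mphi; [exact: measurable_Delta|rewrite cellE].
- by move=> x [n _ /cellD]; exact: phi0.
- have disj i j : (i < j)%N -> cell i `&` cell j = set0.
    move=> ij; rewrite -subset0 => z []; rewrite /cell/= !in_itv/= => /andP[z1 _] /andP[_ z2].
    by have := lt_le_trans z1 (le_trans z2 (endpoint_le HF ij)); rewrite ltxx.
  apply/trivIsetP => i j _ _; case: ltngtP => // ij _; first exact: disj.
  by rewrite setIC; exact: disj.
Qed.

End WordIntegrals.

(** * The transfer operator on integrable functions *)

#[global] Instance ae_mu_filter (R : realType) :
  Filter (nbhs (almost_everywhere (@mu R))).
Proof. exact: ae_filter_ringOfSetsType. Qed.

Section IntegrableFunctions.
Context {R : realType}.
Implicit Types (f g : R -> R) (x y : R).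

Let mD := @measurable_Delta R.

Lemma L1_measurable f : L1 f -> measurable_fun (@Delta R) f.
Proof. by move=> /integrableP[+ _] => /measurable_EFinP. Qed.

Lemma ae_eq_mean f g : measurable_fun (@Delta R) f -> measurable_fun (@Delta R) g ->
  L1_eq f g -> mean f = mean g.
Proof.
move=> mf mg fg; rewrite /mean /Rintegral; congr fine.
apply: ae_eq_integral => //; try exact/measurable_EFinP.
by apply: filterS fg => x H Dx /=; rewrite H.
Qed.

Lemma L1_norm f : L1 f -> L1 (fun x => `|f x|).
Proof. by move=> /integrable_abse. Qed.

Lemma L1_half f : L1 f -> L1 (fun x => f x / 2).
Proof. by move=> /(@L1Z _ (2^-1)); apply: eq_integrable => // x _ /=; rewrite mulrC. Qed.

Lemma mean_EFin f : L1 f -> (\int[mu]_(x in Delta) (f x)%:E = (mean f)%:E)%E.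
Proof. by move=> f1; rewrite /mean /Rintegral fineK//; exact: integrable_fin_num. Qed.

Lemma mean_eq0 f : L1 f -> {ae mu, forall x : R, Delta x -> 0 <= f x} ->
  mean f = 0 -> {ae mu, forall x : R, Delta x -> f x = 0}.
Proof.
move=> f1 f0 m0.
have mf := L1_measurable f1.
have E : mean (fun x => `|f x|) = 0.
  rewrite -m0; apply: ae_eq_mean => //.
    by apply: measurableT_comp => //.
  by apply: filterS f0 => x H Dx; rewrite ger0_norm// H.
have /(ae_eq_integral_abs mu mD) H : measurable_fun (@Delta R) (EFin \o f) by exact/measurable_EFinP.
have /H : (\int[mu]_(x in Delta) `|(EFin \o f) x| = 0)%E.
  by have := mean_EFin (L1_norm f1); rewrite E.
by apply: filterS => x Hx Dx; have [] := Hx Dx.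
Qed.

Lemma continuous_Delta_bounded f : {within Delta, continuous f} ->
  exists B, bounded_by B f.
Proof.
move=> fc; have h1 : (2^-1 : R) <= 1 by lra.
have [c _ cmax] := EVT_max h1 fc; have [d _ dmin] := EVT_min h1 fc.
exists (Num.max (f c) (- f d)) => x Dx.
by rewrite ler_norml lerNl !le_max lerN2 cmax// dmin// orbT.
Qed.

End IntegrableFunctions.

Section InducedTransfer.
Context {R : realType} {V : set R} {gamma : R} {F : map_family R}.
Hypothesis gamma01 : 0 < gamma < 1.
Hypothesis HF : standing_assumptions V gamma F.
Implicit Types (f g : R -> R) (e x y z t : R) (n k : nat).

Let V0 := V_0 HF.
Let h1 : (2^-1 : R) < 1. Proof. by lra. Qed.
Let mD := @measurable_Delta R.

Local Notation G n := (g_word F n 0).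
Local Notation G1 n := (dg_word F n 0).
Local Notation G2 n := (dern Delta 2 (g_word F n 0)).

Lemma Lhat_nonneg f : L1 f -> (forall x, Delta x -> 0 <= f x) ->
  exists g, [/\ L1 g, mean g = mean f & {ae mu, forall x : R, Delta x ->
    cvgn (series (fun n => f (G n x) * G1 n x)) /\ Lhat F f x = g x}].
Proof.
move=> f1 f0.
pose S x : \bar R := (\sum_(0 <= n <oo) (f (G n x) * G1 n x)%:E)%E.
have fG0 n x : Delta x -> 0 <= f (G n x) * G1 n x.
  by move=> Dx; rewrite mulr_ge0 ?(dg_word_Delta_ge0 HF)// f0//; exact: (word_Delta HF).
have S0 x : Delta x -> (0 <= S x)%E.
  by move=> Dx; apply: nneseries_ge0 => n _ _; rewrite lee_fin fG0.
have mf : measurable_fun (@Delta R) (EFin \o f).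
  by apply/measurable_EFinP; exact: L1_measurable.
have mS : measurable_fun (@Delta R) S.
  apply: (@ge0_emeasurable_sum _ _ _ _ _ xpredT) => [n x Dx _|n _].
    by rewrite lee_fin fG0.
  by have := measurable_word HF n mf; apply: eq_measurable_fun => x _; rewrite /= EFinM.
have intS : (\int[mu]_(x in Delta) S x = (mean f)%:E)%E.
  rewrite -(mean_EFin f1) -(transfer_integral HF mf).
    by apply: eq_integral => x _; apply: eq_eseriesr => n _; rewrite EFinM.
  by move=> x /f0; rewrite lee_fin.
have iS : mu.-integrable (@Delta R) S.
  apply/integrableP; split => //.
  under eq_integral => x /set_mem Dx do rewrite gee0_abs ?S0//.
  by rewrite intS ltry.
have finS := integrable_ae mD iS.
have mg : measurable_fun (@Delta R) (fine \o S).
  by apply: measurableT_comp => //; exact: fine_measurable.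
have gS : {ae mu, forall x : R, Delta x -> (fine (S x))%:E = S x}.
  by apply: filterS finS => x H Dx; rewrite fineK// H.
have intg : (\int[mu]_(x in Delta) (fine (S x))%:E = (mean f)%:E)%E.
  by rewrite -intS; apply: ae_eq_integral => //; exact/measurable_EFinP.
exists (fine \o S); split.
- apply/integrableP; split; first exact/measurable_EFinP.
  under eq_integral => x /set_mem Dx do rewrite /= ger0_norm ?fine_ge0 ?S0//.
  by rewrite intg ltry.
- by rewrite {1}/mean /Rintegral intg.
- apply: filterS finS => x H Dx.
  have Soo : (S x < +oo)%E by rewrite -ge0_fin_numE ?H ?S0.
  have cx : cvgn (series (fun n => f (G n x) * G1 n x)).
    by apply: nnseries_is_cvg => // n; exact: fG0.
  split => //; rewrite /Lhat /= /S nneseries_total_sum//.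
  by move=> n; exact: fG0.
Qed.

(** The positive and negative parts of [f] give two series of nonnegative terms
    of finite integral; hence the series of [Lhat F f] converges absolutely
    almost everywhere and its sum has the integral of [f]. *)
Lemma Lhat_L1 f : L1 f -> exists g, [/\ L1 g, mean g = mean f &
  {ae mu, forall x : R, Delta x ->
    cvgn (series (fun n => `|f (G n x)| * G1 n x)) /\ Lhat F f x = g x}].
Proof.
move=> f1; have n1 := L1_norm f1.
pose p x : R := (`|f x| + f x) / 2; pose m x : R := (`|f x| - f x) / 2.
have p1 : L1 p by apply: L1_half; exact: L1D.
have m1 : L1 m by apply: L1_half; exact: L1B.
have p0 x : Delta x -> 0 <= p x.
  by move=> _; rewrite divr_ge0//; have := ler_norm (- f x); rewrite normrN; lra.
have m0 x : Delta x -> 0 <= m x.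
  by move=> _; rewrite divr_ge0// subr_ge0 ler_norm.
have [gp [gp1 mgp Hp]] := Lhat_nonneg p1 p0.
have [gm [gm1 mgm Hm]] := Lhat_nonneg m1 m0.
exists (fun x => gp x - gm x); split; first exact: L1B.
  rewrite meanB// mgp mgm -meanB//; apply: eq_mean => x _; rewrite /p /m; lra.
apply: filterS2 Hp Hm => x Hp Hm Dx.
have [cp <-] := Hp Dx; have [cm <-] := Hm Dx; split.
  rewrite (_ : (fun n => _) = (fun n => p (G n x) * G1 n x + m (G n x) * G1 n x)).
    exact: cvg_seriesD.
  by apply/funext => n; rewrite /p /m; lra.
by rewrite -total_sumB//; apply: eq_total_sum => n; rewrite /p /m; lra.
Qed.

Lemma Lhat_measurable (B : nat -> R) f : (forall n, 0 <= B n) -> cvgn (series B) ->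
  {within Delta, continuous f} ->
  (forall n x, Delta x -> `|f (G n x) * G1 n x| <= B n) ->
  measurable_fun (@Delta R) (Lhat F f).
Proof.
move=> B0 cB fc fB.
apply: (@measurable_fun_cvg _ _ R Delta
  (fun N x => \sum_(n < N) f (G n x) * G1 n x)).
  move=> N; apply: measurable_sum => n.
  apply: measurable_funM; last first.
    apply: subspace_continuous_measurable_fun; first exact: measurable_Delta.
    exact: (@dg_word_continuous_Delta _ _ _ _ HF n 0 V0).
  apply: (measurable_comp measurable_Delta).
  - by move=> _ [x Dx <-]; exact: (word_Delta HF).
  - exact: subspace_continuous_measurable_fun.
  - apply: subspace_continuous_measurable_fun; first exact: measurable_Delta.
    exact: (@word_cont_Delta _ _ _ _ HF n 0 V0).
move=> x Dx; have : cvgn (series (fun n => f (G n x) * G1 n x)).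
  by apply: (@dominated_cvg_series _ _ B) => // n; exact: fB.
rewrite /Lhat /total_sum; set u := series _ => cu.
rewrite (_ : (fun N => _) = u); first exact: cu.
by apply/funext => N; rewrite /u /series/= big_mkord.
Qed.

Lemma words_expanding : exists (s : nat -> R) (rho D : R),
  expanding_system (fun n => G n) (fun n => G1 n) (fun n => G2 n) s rho D.
Proof.
have [s [rho [D [rho01 D0 s0 cs [Hrho Hs1 Hs2 Hs3 [Hdist HD]]]]]] := expanding_words gamma01 HF.
have E n x : Delta x -> G1 n x = dern Delta 1 (g_word F n 0) x by exact: (dg_wordE HF n V0).
have d0 n z : Delta z -> has_der Delta (G n) z (G1 n z).
  by move=> Dz; rewrite E//; exact: (word_has_der0 HF).
have d1 n z : Delta z -> has_der Delta (G1 n) z (G2 n z).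
  move=> Dz; apply: (eq_has_der _ _ (word_has_der1 HF n V0 Dz)); last by rewrite E.
  by exists 1 => // y Dy _; rewrite E.
have G10 n x : Delta x -> 0 <= G1 n x by exact: (dg_word_Delta_ge0 HF).
have lip n : lipschitz_by (s n) (G1 n).
  by move=> x y; apply: (segment_lipschitz (d1 n)) => z; exact: Hs2.
have lip2 n : lipschitz_by (s n) (G2 n).
  move=> x y; apply: (segment_lipschitz (fun z => word_has_der2 HF n V0 (x := z))) => z.
  exact: Hs3.
exists s, rho, D; split => //.
- by move=> n x; exact: (word_Delta HF).
- move=> n x y; apply: (segment_lipschitz (d0 n)) => z Dz.
  by rewrite ger0_norm ?G10// E// Hrho.
- by move=> n x Dx; rewrite E// Hrho.
- by move=> n x Dx; rewrite E// Hs1.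
- by move=> n x y Dx Dy; rewrite !E//; exact: Hdist.
- by move=> n x Dx; rewrite E//; exact: HD.
- by move=> n; exact: (segment_taylor (s0 n) (d0 n) (@lip n)).
- by move=> n; exact: (segment_taylor (s0 n) (d1 n) (@lip2 n)).
- move=> f fc; have f1 := continuous_Delta_integrable fc.
  have [B fB] := continuous_Delta_bounded fc.
  have [g [g1 <- Hg]] := Lhat_L1 f1.
  have B0 : 0 <= B by apply: le_trans (fB _ Delta1).
  apply: ae_eq_mean; last by apply: filterS Hg => x H /H[].
    apply: (@Lhat_measurable (fun n => B * s n)) => //.
    + by move=> n; rewrite mulr_ge0.
    + exact: cvg_seriesZ.
    + move=> n x Dx; rewrite normrM ler_pM//; first by apply: fB; exact: (word_Delta HF).
      by rewrite ger0_norm ?G10// E// Hs1.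
  exact: L1_measurable.
Qed.

End InducedTransfer.

(** * Dependence of the induced map on the parameter *)

Section ImplicitDifferentiation.
Context {R : realType}.
Implicit Types (u : R -> R -> R) (w : R -> R) (y p l P e x : R) (D : set R).

(** The mixed bound makes the variation of [u] in the parameter almost
    independent of the point, so that the increment along a curve splits into
    its variations in the parameter and in space. *)
Lemma expansion_along_curve u w D y p l P :
  has_der D (u 0) y l -> has_der setT (fun e => u e y) 0 p ->
  (exists2 r : R, 0 < r & forall e x, `|e| < r -> D x ->
    `|(u e x - u 0 x) - (u e y - u 0 y)| <= P * `|e| * `|x - y|) ->
  (forall d : R, 0 < d -> exists2 r : R, 0 < r & forall e, `|e| < r ->
    D (w e) /\ `|w e - y| < d) ->
  forall d : R, 0 < d -> exists2 r : R, 0 < r & forall e, `|e| < r ->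
    `|u e (w e) - u 0 y - p * e - l * (w e - y)| <= d * (`|e| + `|w e - y|).
Proof.
move=> Hl Hp [r1 r10 HP] Hw d d0.
have d20 : 0 < d / 2 by rewrite divr_gt0.
have [rl rl0 Hrl] := Hl d d0.
have [rp rp0 Hrp] := Hp (d / 2) d20.
have P0 : 0 < `|P| + 1 by rewrite ltr_wpDl.
have m0 : 0 < Num.min rl (d / 2 / (`|P| + 1)) by rewrite lt_min rl0 divr_gt0.
have [rw rw0 Hrw] := Hw _ m0.
exists (Num.min r1 (Num.min rp rw)); first by rewrite !lt_min r10 rp0.
move=> e; rewrite !lt_min => /and3P[e1 ep ew].
have [Dw] := Hrw e ew; rewrite lt_min => /andP[wl wd].
have A := HP e _ e1 Dw.
have B := Hrp e I; rewrite subr0 in B; have {}B := B ep.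
have C := Hrl _ Dw wl.
set t : R := `|w e - y| in A C wl wd *.
have t0 : 0 <= t by exact: normr_ge0.
have Pt : P * `|e| * t <= d / 2 * `|e|.
  rewrite ltr_pdivlMr// in wd; rewrite mulrAC ler_wpM2r//.
  apply: le_trans (ltW wd); rewrite mulrC ler_wpM2l//.
  by apply: (le_trans (ler_norm P)); rewrite lerDl.
rewrite (_ : _ - _ = ((u e (w e) - u 0 (w e)) - (u e y - u 0 y)) +
   ((u e y - u 0 y - p * e) + (u 0 (w e) - u 0 y - l * (w e - y)))); last by ring.
apply: (le_trans (ler_normD _ _)).
have := ler_normD (u e y - u 0 y - p * e) (u 0 (w e) - u 0 y - l * (w e - y)).
lra.
Qed.

(** Implicit differentiation: when [u e (w e)] is constant, the expansion along
    the curve is a linear relation between [e] and [w e - y], up to terms of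
    higher order. *)
Lemma implicit_has_der u w y p l : l != 0 -> w 0 = y ->
  (forall d : R, 0 < d -> exists2 r : R, 0 < r & forall e, `|e| < r ->
    `|u e (w e) - u 0 y - p * e - l * (w e - y)| <= d * (`|e| + `|w e - y|)) ->
  (exists2 r : R, 0 < r & forall e, `|e| < r -> u e (w e) = u 0 y) ->
  has_der setT w 0 (- (p / l)).
Proof.
move=> l0 w0 Hexp [r0 r00 Hu] d d0.
pose c : R := `|l|; have c0 : 0 < c by rewrite normr_gt0.
pose k : R := `|p / l|; have k0 : 0 <= k by exact: normr_ge0.
pose d1 : R := Num.min (c / 2) (d * c / (2 * (1 + k))).
have k1 : 0 < 2 * (1 + k) by lra.
have d10 : 0 < d1 by rewrite lt_min !divr_gt0// mulr_gt0.
have [d1c d1d] : d1 <= c / 2 /\ d1 * (2 * (1 + k)) <= d * c.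
  by rewrite -ler_pdivlMr// /d1 !ge_min !lexx orbT.
have [r1 r10 H1] := Hexp d1 d10.
exists (Num.min r0 r1); first by rewrite lt_min r00.
move=> e _; rewrite subr0 lt_min w0 => /andP[er0 er1].
have := H1 e er1; rewrite Hu// subrr add0r.
rewrite (_ : - (p * e) - l * (w e - y) = - l * (w e - y - - (p / l) * e)); last first.
  by field.
rewrite normrM normrN -/c; set E : R := `|_ - _ * e|.
have E0 : 0 <= E by exact: normr_ge0.
have wE : `|w e - y| <= E + k * `|e|.
  rewrite /k -normrM (_ : w e - y = (w e - y - - (p / l) * e) - p / l * e); last by ring.
  exact: ler_normB.
set t : R := `|e| in wE *; have t0 : 0 <= t by exact: normr_ge0.
move=> cE.
have : c * E <= c / 2 * E + d1 * (1 + k) * t.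
  apply: (le_trans cE); apply: (@le_trans _ _ (d1 * ((1 + k) * t + E))).
    by rewrite ler_wpM2l ?(ltW d10)//; lra.
  by have := ler_wpM2r E0 d1c; lra.
have : d1 * (2 * (1 + k)) * t <= d * c * t by rewrite ler_wpM2r.
move=> X Y; rewrite -(ler_pM2l c0); lra.
Qed.

Lemma curve_has_der u w y p l m : w 0 = y ->
  (forall d : R, 0 < d -> exists2 r : R, 0 < r & forall e, `|e| < r ->
    `|u e (w e) - u 0 y - p * e - l * (w e - y)| <= d * (`|e| + `|w e - y|)) ->
  has_der setT w 0 m -> has_der setT (fun e => u e (w e)) 0 (p + l * m).
Proof.
move=> w0 Hexp Hw d d0.
pose c : R := `|l| + `|m| + 2; have c0 : 0 < c by rewrite ltr_wpDl// addr_ge0.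
pose d1 : R := Num.min 1 (d / (2 * c)).
have d10 : 0 < d1 by rewrite lt_min ltr01 divr_gt0// mulr_gt0.
have [d11 d1d] : d1 <= 1 /\ d1 * (2 * c) <= d.
  by rewrite -ler_pdivlMr ?mulr_gt0// /d1 !ge_min !lexx orbT.
have [r1 r10 H1] := Hexp d1 d10.
have [r2 r20 H2] := Hw d1 d10.
exists (Num.min r1 r2); first by rewrite lt_min r10.
move=> e _; rewrite subr0 lt_min => /andP[e1 e2].
have := H1 e e1; have := H2 e I; rewrite subr0 w0 => /(_ e2).
set t : R := `|e|; have t0 : 0 <= t by exact: normr_ge0.
set s : R := w e - y => A B.
have st : `|s| <= (`|m| + 1) * t.
  rewrite (_ : s = (s - m * e) + m * e); last by ring.
  apply: (le_trans (ler_normD _ _)); rewrite normrM -/t.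
  by have := ler_wpM2r t0 d11; lra.
rewrite (_ : _ - _ = (u e (w e) - u 0 y - p * e - l * s) + l * (s - m * e)); last by ring.
apply: (le_trans (ler_normD _ _)); rewrite normrM.
apply: (@le_trans _ _ (d1 * (t + (`|m| + 1) * t) + `|l| * (d1 * t))).
  apply: lerD; last by rewrite ler_wpM2l.
  by apply: (le_trans B); rewrite ler_wpM2l ?(ltW d10)//; lra.
have -> : d1 * (t + (`|m| + 1) * t) + `|l| * (d1 * t) = d1 * c * t by rewrite /c; ring.
have := ler_wpM2r t0 d1d.
have : 0 <= d1 * c * t by rewrite !mulr_ge0// ltW.
lra.
Qed.

Lemma has_derB D (f g : R -> R) x l m : has_der D f x l -> has_der D g x m ->
  has_der D (fun z => f z - g z) x (l - m).
Proof.
move=> Hf Hg d d0; have d20 : 0 < d / 2 by rewrite divr_gt0.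
have [r1 r10 H1] := Hf _ d20; have [r2 r20 H2] := Hg _ d20.
exists (Num.min r1 r2); first by rewrite lt_min r10.
move=> v Dv; rewrite lt_min => /andP[v1 v2].
have := H1 v Dv v1; have := H2 v Dv v2.
rewrite (_ : f v - g v - (f x - g x) - (l - m) * (v - x) =
  (f v - f x - l * (v - x)) - (g v - g x - m * (v - x))); last by ring.
by move=> A B; apply: (le_trans (ler_normB _ _)); lra.
Qed.

Lemma has_der_inv (f : R -> R) x l : f x != 0 -> has_der setT f x l ->
  has_der setT (fun z => (f z)^-1) x (- (l / (f x) ^+ 2)).
Proof.
move=> fx0 /is_derive_has_der H; apply/is_derive_has_der.
have := is_deriveV fx0 H.
by congr is_derive; rewrite /GRing.scale/= mulNr mulrC.
Qed.

End ImplicitDifferentiation.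

Section ParameterDerivatives.
Context {R : realType} {V : set R} {gamma : R} {F : map_family R}.
Hypothesis HF : standing_assumptions V gamma F.
Implicit Types (e x y z : R) (n k : nat).

Let V0 := V_0 HF.

Local Notation gd j n e := (dern Delta j (g_word F n e)).
Local Notation ad j n e := (dern Delta j (pd (g_word F n) e)).
Local Notation T := (Defs.induced F).

Lemma V_ball : exists2 r : R, 0 < r & forall e, `|e| < r -> V e.
Proof.
have : nbhs (0 : R) V by apply: open_nbhs_nbhs; split; [exact: (V_open HF)|exact: V0].
move=> [r /= r0 Hr]; exists r => // e er; apply: Hr => /=.
by rewrite sub0r normrN.
Qed.

Lemma pd_word_bound i : (1 <= i <= 2)%N -> exists p : nat -> R,
  [/\ forall n, 0 <= p n, cvgn (series p) &
    forall n e x, V e -> Delta x -> `|ad i n e x| <= p n].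
Proof.
move=> i12; have Vne : V !=set0 by exists 0.
have Dne : (@Delta R) !=set0 by exists 1; exact: Delta1.
have [p [p0 cp Hp]] := summable_sup_norm Vne Dne (sum_pd_dern_g_word HF i12).
exists p; split => // n e x Ve Dx; have [_ i2] := andP i12.
have <- := @has_der_pd _ (fun e' => gd i n e') e x _ (word_pd HF n i2 Ve Dx).
exact: Hp.
Qed.

(** The mixed derivative of a branch is the space derivative of its parameter
    derivative, bounded on [Delta] uniformly in the parameter. *)
Lemma word_mixed_bound n j : (j <= 1)%N -> exists (P : R), exists2 r : R, 0 < r &
  forall y e x, `|e| < r -> Delta y -> Delta x ->
  `|(gd j n e x - gd j n 0 x) - (gd j n e y - gd j n 0 y)| <= P * `|e| * `|x - y|.
Proof.
move=> j1; have j2 : (1 <= j.+1 <= 2)%N by [].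
have [p [p0 _ Hp]] := pd_word_bound j2.
have [r r0 Hr] := V_ball.
exists (p n), (r / 2); first by rewrite divr_gt0.
move=> y e x er Dy Dx.
have rr : - (r / 2) < r / 2 by lra.
have Vr e' : `[- (r / 2), r / 2]%classic e' -> V e'.
  by rewrite /= in_itv/= -ler_norml => He; apply: Hr; lra.
have er' : `[- (r / 2), r / 2]%classic e by rewrite /= in_itv/= -ler_norml ltW.
have Ve := Vr _ er'.
have r0' : `[- (r / 2), r / 2]%classic (0 : R) by rewrite /= in_itv/=; lra.
have slope z : Delta z -> `|gd j.+1 n e z - gd j.+1 n 0 z| <= p n * `|e|.
  move=> Dz; rewrite -[in leRHS](subr0 e).
  apply: (@segment_lipschitz _ _ _ (fun e' => gd j.+1 n e' z) (fun e' => ad j.+1 n e' z)) => //.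
  - move=> e' /Vr Ve'; apply: has_der_subset (word_pd HF n _ Ve' Dz); last by case/andP: j2.
    by exists 1.
  - by move=> e' /Vr Ve'; exact: Hp.
  - exact: er'.
  - exact: r0'.
apply: (@segment_lipschitz _ 2^-1 1 (fun z => gd j n e z - gd j n 0 z)
  (fun z => gd j.+1 n e z - gd j.+1 n 0 z)) => // z Dz.
have der e' : V e' -> has_der Delta (gd j n e') z (gd j.+1 n e' z).
  move=> Ve'; case: j j1 {j2 Hp slope} => [_|[_|//]].
    exact: (word_has_der0 HF).
  exact: (word_has_der1 HF).
exact: has_derB (der _ Ve) (der _ V0).
Qed.

(** For small parameters the point [G n y] stays in the open cylinder of the
    same word, so that the induced map moves it near [y]. *)
Lemma induced_near n y : 2^-1 < y < 1 -> forall d : R, 0 < d ->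
  exists2 r : R, 0 < r & forall e, `|e| < r ->
    [/\ V e, 2^-1 < T e (g_word F n 0 y) < 1, `|T e (g_word F n 0 y) - y| < d &
        g_word F n e (T e (g_word F n 0 y)) = g_word F n 0 y].
Proof.
move=> yI d d0.
pose t := Num.min (d / 2) (Num.min ((y - 2^-1) / 2) ((1 - y) / 2)).
have t0 : 0 < t by case/andP: yI => ? ?; rewrite !lt_min !divr_gt0// subr_gt0.
have [td [ty1 ty2]] : t <= d / 2 /\ (t <= (y - 2^-1) / 2 /\ t <= (1 - y) / 2).
  by have := lexx t; rewrite {2}/t !le_min => /and3P[].
have DI (u : R) : y - t <= u <= y + t -> 2^-1 < u < 1 by case/andP: yI => ? ?; lra.
have Dm : 2^-1 < y - t < 1 by apply: DI; lra.
have Dp : 2^-1 < y + t < 1 by apply: DI; lra.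
have I01D (u : R) : 2^-1 < u < 1 -> u \in `[0, 1] by rewrite in_itv/=; lra.
set z := g_word F n 0 y.
have zm : g_word F n 0 (y - t) < z by apply: (g_word_increasing HF); rewrite ?I01D//; lra.
have zp : z < g_word F n 0 (y + t) by apply: (g_word_increasing HF); rewrite ?I01D//; lra.
have cont (u c : R) : 2^-1 < u < 1 -> 0 < c -> exists2 r : R, 0 < r & forall e, `|e| < r ->
    `|g_word F n e u - g_word F n 0 u| <= c.
  move=> uI c0; have Du := open_Delta uI.
  have [r r0 Hr] := has_der_continuous (word_pd HF n (leq0n 2) V0 Du) c0.
  by exists r => // e er; apply: Hr => //; rewrite subr0.
have cm0 : 0 < (z - g_word F n 0 (y - t)) / 2 by rewrite divr_gt0// subr_gt0.
have cp0 : 0 < (g_word F n 0 (y + t) - z) / 2 by rewrite divr_gt0// subr_gt0.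
have [r1 r10 H1] := cont _ _ Dm cm0.
have [r2 r20 H2] := cont _ _ Dp cp0.
have [r3 r30 H3] := V_ball.
exists (Num.min r1 (Num.min r2 r3)); first by rewrite !lt_min r10 r20.
move=> e; rewrite !lt_min => /and3P[/H1 e1 /H2 e2 /H3 Ve].
move: e1 e2; rewrite !ler_norml => e1 e2.
have [|||y' y'I zE] := @IVT R (g_word F n e) (y - t) (y + t) z.
- lra.
- apply: continuous_subspaceW (@g_word_continuous _ _ _ _ HF n e Ve) => u.
  by rewrite /= in_itv/= => /DI/I01D.
- have lt1 : g_word F n e (y - t) <= z by lra.
  have lt2 : z <= g_word F n e (y + t) by lra.
  by rewrite min_l ?max_r ?lt1//; exact: le_trans lt2.
move: y'I; rewrite in_itv/= => y'I; have yI' := DI _ y'I.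
have TE : T e z = y' by rewrite -zE (word_inverse HF).
rewrite TE; split => //.
by rewrite ltr_norml; lra.
Qed.

Section AtPoint.
Variables (n : nat) (y : R).
Hypothesis yI : 2^-1 < y < 1.

Local Notation z := (g_word F n 0 y).
Local Notation w := (fun e => T e z).
Local Notation a := (pd (g_word F n) 0 y).
Local Notation b := (ad 1 n 0 y).
Local Notation g' := (gd 1 n 0 y).
Local Notation g'' := (gd 2 n 0 y).

Let Dy : Delta y. Proof. exact: open_Delta. Qed.
Let g0 : g' != 0. Proof. exact: (gd1_neq0 HF n V0 yI). Qed.
Let w0 : w 0 = y. Proof. exact: (word_inverse HF n V0 yI). Qed.

Let w_near d : 0 < d -> exists2 r : R, 0 < r & forall e, `|e| < r ->
  Delta (w e) /\ `|w e - y| < d.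
Proof.
move=> d0; have [r r0 Hr] := induced_near n yI d0; exists r => // e /Hr[_ wI wd _].
by split => //; exact: open_Delta.
Qed.

Let expansion j : (j <= 1)%N ->
  forall d : R, 0 < d -> exists2 r : R, 0 < r & forall e, `|e| < r ->
    `|gd j n e (w e) - gd j n 0 y - ad j n 0 y * e - gd j.+1 n 0 y * (w e - y)|
      <= d * (`|e| + `|w e - y|).
Proof.
move=> j1; have [P [r r0 HP]] := word_mixed_bound n j1.
apply: (@expansion_along_curve _ (fun e x => gd j n e x) w Delta y _ _ P) => //.
- case: j j1 {HP} => [_|[_|//]].
    exact: (word_has_der0 HF).
  exact: (word_has_der1 HF).
- by apply: (word_pd HF) => //; case: j j1 {HP} => [|[]].
- by exists r => // e x er Dx; apply: HP.
Qed.

Let w_has_der : has_der setT w 0 (- (a / g')).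
Proof.
apply: (@implicit_has_der _ (fun e x => g_word F n e x) w y a g' g0 w0 (@expansion 0%N isT)).
have [r r0 Hr] := induced_near n yI ltr01.
by exists r => // e /Hr[].
Qed.

Lemma pd_induced : pd T 0 z = - (a / g').
Proof. exact: (has_der_pd w_has_der). Qed.

Lemma derive_induced : derive1 (T 0) z = g'^-1.
Proof.
by apply: (mulIf g0); rewrite mulVf// (induced_chain HF n V0 yI).
Qed.

Lemma derive2_induced : derive1n 2 (T 0) z = - (g'' / g' ^+ 3).
Proof.
have Tder : has_der setT (T 0) z g'^-1.
  by apply/is_derive_has_der; rewrite -derive_induced; exact: (induced_is_derive HF n V0 yI).
have gder : has_der setT (gd 1 n 0) y g''.
  apply/is_derive_has_der; apply: (segment_is_derive yI).
  exact: (word_has_der1 HF n V0 Dy).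
have H1 := has_der_comp Tder (fun _ _ => I) (_ : has_der setT (gd 1 n 0) (T 0 z) g'').
have {}H1 := H1 _; rewrite w0 in H1; have {}H1 := H1 gder.
have gTz : gd 1 n 0 (T 0 z) != 0 by rewrite w0.
have H2 := has_der_inv (f := fun x => gd 1 n 0 (T 0 x)) gTz H1; rewrite w0 in H2.
have H3 : has_der setT (derive1 (T 0)) z (- (g'' / g' ^+ 3)).
  have -> : g'' / g' ^+ 3 = g'' * g'^-1 / g' ^+ 2 by field.
  apply: (eq_has_der _ _ H2); last by rewrite /= w0 derive_induced.
  have [r r0 Hr] := word_open HF n V0 yI ltr01.
  exists r => // x _ /Hr[y' [y'I _ <-]].
  rewrite (word_inverse HF n V0 y'I).
  have g'0 := gd1_neq0 HF n V0 y'I.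
  by apply: (mulIf g'0); rewrite mulVf// (induced_chain HF n V0 y'I).
by move/is_derive_has_der : H3 => [_ <-]; rewrite /derive1n/= [LHS]derive1E.
Qed.

Lemma pd_derive_induced :
  pd (fun e => derive1 (T e)) 0 z = - ((b - g'' * (a / g')) / g' ^+ 2).
Proof.
have H1 := @curve_has_der _ (fun e x => gd 1 n e x) w y b g'' _ w0 (@expansion 1%N isT) w_has_der.
have g0' : gd 1 n 0 (w 0) != 0 by rewrite w0.
have H2 := has_der_inv (f := fun e => gd 1 n e (w e)) g0' H1; rewrite w0 in H2.
apply: has_der_pd; rewrite -[X in b + X]mulrN; apply: (eq_has_der _ _ H2).
  have [r r0 Hr] := induced_near n yI ltr01.
  exists r => // e _; rewrite subr0 => /Hr[Ve wI _ gw].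
  have gw0 := gd1_neq0 HF n Ve wI.
  apply: (mulIf gw0); rewrite mulVf//.
  by have := induced_chain HF n Ve wI; rewrite gw => ->.
by rewrite /= w0 derive_induced.
Qed.

(** The relation [T e (g_word F n e y) = y] expresses the derivatives of the
    induced map through those of the branch. *)
Lemma A0_word : A0 F z = a_word F n y.
Proof. by rewrite /A0 pd_induced derive_induced invrK mulNr opprK divfK. Qed.

(** The terms with the second derivative of the branch cancel. *)
Lemma B0_word : B0 F z * g' = b.
Proof.
rewrite /B0 pd_induced derive_induced derive2_induced pd_derive_induced.
by move: g0; move: (gd 1 n 0 y) (gd 2 n 0 y) b a => A B C D A0; field.
Qed.

End AtPoint.

End ParameterDerivatives.

(** * Fixed points of the transfer operator *)

Section NullSets.
Context {R : realType}.
Implicit Types (P : R -> Prop) (x y : R).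

Lemma ae_neq (c : R) : {ae @mu R, forall x : R, x != c}.
Proof.
exists [set c]; split; [exact: measurable_set1|exact: lebesgue_measure_set1|].
by move=> x /= /negP; rewrite negbK => /eqP.
Qed.

Lemma ae_Delta_open : {ae @mu R, forall x : R, Delta x -> 2^-1 < x < 1}.
Proof.
apply: filterS2 (ae_neq 2^-1) (ae_neq 1) => x xh x1 /DeltaP/andP[hx xl].
by rewrite !lt_neqAle eq_sym xh x1 hx.
Qed.

Lemma ae_dense P a b : a < b -> {ae @mu R, forall x, P x} ->
  exists x, a < x < b /\ P x.
Proof.
move=> ab [N [mN N0 HN]]; apply: contrapT => H.
have sub : `]a, b[%classic `<=` N.
  by move=> x; rewrite /= in_itv/= => xab; apply: HN => Px; apply: H; exists x.
have : (mu `]a, b[%classic <= mu N)%E by apply: le_measure; rewrite ?inE.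
rewrite N0 /mu lebesgue_measure_itv/= lte_fin ab -EFinD lee_fin.
by rewrite leNgt subr_gt0 ab.
Qed.

(** A null set contains no interval. *)
Lemma continuous_ae_eq (f g : R -> R) : {within Delta, continuous f} ->
  {within Delta, continuous g} -> L1_eq f g -> forall x, Delta x -> f x = g x.
Proof.
move=> fc gc fg x Dx; apply/eqP; rewrite -subr_eq0 -normr_le0.
apply/ler_addgt0Pr => e e0; rewrite add0r.
have e20 : 0 < e / 2 by rewrite divr_gt0.
have [r1 r10 H1] := within_continuousE fc Dx e20.
have [r2 r20 H2] := within_continuousE gc Dx e20.
pose r := Num.min (4^-1) (Num.min r1 r2).
have r0 : 0 < r by rewrite !lt_min invr_gt0 ltr0n r10.
have [r4 [rr1 rr2]] : r <= 4^-1 /\ (r <= r1 /\ r <= r2).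
  by have := lexx r; rewrite {2}/r !le_min => /and3P[].
have [a [b [ab abD]]] : exists a b, a < b /\ forall y, a < y < b -> Delta y /\ `|y - x| < r.
  move: Dx => /DeltaP/andP[hx x1]; have [xm|mx] := leP x (3 / 4).
    exists x, (x + r); split; first by lra.
    move=> y /andP[xy yx]; split; first by apply/DeltaP; lra.
    by rewrite ltr_norml; lra.
  exists (x - r), x; split; first by lra.
  move=> y /andP[xy yx]; split; first by apply/DeltaP; lra.
  by rewrite ltr_norml; lra.
have [y [/abD[Dy yx] Ey]] := ae_dense ab fg.
have A := H1 y Dy (lt_le_trans yx rr1); have B := H2 y Dy (lt_le_trans yx rr2).
rewrite -(Ey Dy) in B.
rewrite (_ : _ - _ = (f y - g x) - (f y - f x)); last by ring.
by apply: (le_trans (ler_normB _ _)); lra.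
Qed.

End NullSets.

Section FixedPoints.
Context {R : realType} {V : set R} {gamma : R} {F : map_family R}.
Hypothesis HF : standing_assumptions V gamma F.
Implicit Types (d f g w : R -> R) (e x y z t : R) (n k : nat).

Let V0 := V_0 HF.
Let mD := @measurable_Delta R.
Let h1 : (2^-1 : R) < 1. Proof. by lra. Qed.

Local Notation G n := (g_word F n 0).
Local Notation G1 n := (dg_word F n 0).
Local Notation G2 n := (dern Delta 2 (g_word F n 0)).
Local Notation T := (Defs.induced F 0).
Local Notation endpoint := (@endpoint R F).
Local Notation L := (Lhat F).

(** The induced map is continuous inside the cylinders, and only countably many
    end points remain. *)
Lemma measurable_induced : measurable_fun (@Delta R) T.
Proof.
pose U n : set (measurableTypeR R) := `]endpoint n.+1, endpoint n[%classic.
pose C n : set (measurableTypeR R) := [set endpoint n].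
have mU n : measurable_fun (U n) T.
  apply: open_continuous_measurable_fun; first exact: interval_open.
  move=> z /set_mem; rewrite /U/= in_itv/= => /(g_word_surj_open HF)[y yI <-].
  apply: differentiable_continuous; apply/derivable1_diffP.
  by have [] := induced_is_derive HF n V0 yI.
have DE : (@Delta R) = (\bigcup_n (U n `|` C n)) `|` [set (2^-1 : R)].
  apply/seteqP; split => z.
    move=> /DeltaP/andP[hz z1]; have [zh|zh] := eqVneq z 2^-1; first by right.
    left; have zI : 2^-1 < z <= endpoint 0.
      by rewrite (endpoint0 HF) lt_neqAle eq_sym zh hz.
    have [n [_ /andP[cz zc]]] := endpoint_locate HF zI; exists n => //.
    have [->|zn] := eqVneq z (endpoint n); first by right.
    by left; rewrite /U/= in_itv/= cz lt_neqAle zn.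
  move=> [[n _ zn]|->]; last by apply/DeltaP; lra.
  have := endpoint_gt HF n; have := endpoint_gt HF n.+1; have := endpoint_le1 HF n.
  move=> ? ? ?; apply/DeltaP; case: zn => [|->]; last by apply/andP; split => //; exact: ltW.
  by rewrite /U/= in_itv/= => ?; lra.
have mUC n : measurable (U n `|` C n).
  by apply: measurableU; [exact: measurable_itv|exact: measurable_set1].
rewrite DE; apply/measurable_funU => //; first exact: bigcupT_measurable.
split; last exact: measurable_fun_set1.
apply/measurable_fun_bigcup => // n; apply/measurable_funU => //.
- exact: measurable_itv.
- exact: measurable_set1.
- split; first exact: mU.
  by rewrite /C; apply: measurable_fun_set1.
Qed.

(** The integral of [d] over the preimage of [A] is that of [d * \1_A \o T]. By
    duality it is the integral of a sum over the branches, in which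
    [T (G n x) = x], so that the indicator of [A] comes out of the sum. *)
Lemma fixed_point_acim d : L1 d -> (forall x, Delta x -> 0 <= d x) -> 0 < mean d ->
  {ae mu, forall x : R, Delta x ->
    cvgn (series (fun n => d (G n x) * G1 n x)) /\ L d x = d x} ->
  acim Delta T d.
Proof.
move=> d1 d0 md Hd; split => //.
- exact: L1_measurable.
- by rewrite mean_EFin// lte_fin.
move=> A mA AD; pose chi x : R := \1_A x.
have mchi : measurable_fun [set: R] chi by exact: measurable_indic.
have chi0 x : 0 <= chi x by rewrite /chi indicE ler0n.
have md' := L1_measurable d1.
have mind : measurable_fun (@Delta R) (fun x => (d x * chi (T x))%:E).
  apply/measurable_EFinP; apply: measurable_funM => //.
  by apply: measurableT_comp => //; exact: measurable_induced.
have mres : measurable_fun (@Delta R) (fun x => (d x * chi x)%:E).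
  by apply/measurable_EFinP; apply: measurable_funM => //; exact: measurable_funTS.
have restr (B : set R) (f : R -> R) : (\int[mu]_(x in Delta `&` B) (f x)%:E =
    \int[mu]_(x in Delta) (f x * \1_B x)%:E)%E.
  rewrite integral_mkcond [RHS]integral_mkcond; apply: eq_integral => x _.
  rewrite !patchE indicE in_setI; case: (x \in Delta) => //=.
  by case: (x \in B); rewrite ?mulr1 ?mulr0.
have -> : (\int[mu]_(x in A) (d x)%:E = \int[mu]_(x in Delta) (d x * chi x)%:E)%E.
  by rewrite -restr setIidr.
have -> : (\int[mu]_(x in Delta `&` T @^-1` A) (d x)%:E =
    \int[mu]_(x in Delta) (d x * chi (T x))%:E)%E.
  by rewrite restr; apply: eq_integral => x _; rewrite /chi !indicE.
rewrite -(transfer_integral HF mind); last first.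
  by move=> x Dx; rewrite lee_fin mulr_ge0// d0.
apply: ae_eq_integral => //.
  apply: (@ge0_emeasurable_sum _ _ _ _ _ xpredT) => [n x Dx _|n _]; last first.
    exact: (measurable_word HF n mind).
  rewrite mule_ge0// lee_fin; last exact: (dg_word_Delta_ge0 HF).
  by rewrite mulr_ge0// d0//; exact: (word_Delta HF).
apply: filterS2 Hd ae_Delta_open => x Hd Dopen Dx.
have [cd Ld] := Hd Dx; have xI := Dopen Dx.
rewrite (eq_eseriesr (g := fun n => (chi x * (d (G n x) * G1 n x))%:E)); last first.
  by move=> n _; rewrite -EFinM (word_inverse HF n V0 xI); congr EFin; ring.
rewrite nneseries_total_sum.
- by rewrite total_sumZ// [total_sum _]Ld mulrC.
- move=> n; rewrite mulr_ge0// mulr_ge0 ?(dg_word_Delta_ge0 HF)//.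
  by apply: d0; exact: (word_Delta HF).
- exact: cvg_seriesZ.
Qed.

Context {s : nat -> R} {rho D : R}.
Hypothesis ES : expanding_system (fun n => G n) (fun n => G1 n) (fun n => G2 n) s rho D.

Local Notation h := (@density R (fun n => G n) (fun n => G1 n)).

Let h_lip := density_lipschitz ES.

Lemma density_pos x : Delta x -> 0 < h x.
Proof.
move=> Dx; apply: lt_le_trans (density_ge ES Dx).
by rewrite mulr_gt0// expR_gt0.
Qed.

Lemma density_bounded : exists B, bounded_by B h.
Proof.
have [Lam _ hL] := h_lip.
by apply: continuous_Delta_bounded; exact: lipschitz_by_continuous hL.
Qed.

Lemma density_acim : acim Delta T h.
Proof.
have [B hB] := density_bounded.
apply: fixed_point_acim.
- exact: density_L1 ES.
- by move=> x /density_pos/ltW.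
- by rewrite (density_mean ES).
- apply: aeW => x Dx; split; first exact: (transfer_cvg ES hB).
  exact: (density_transfer ES).
Qed.

Let hhat_h : L1_eq h (hhat F 0).
Proof.
have [c Hc] := hhat_unique HF V0 (density_L1 ES) density_acim.
have hhat1 : L1 (hhat F 0) := continuous_Delta_integrable (hhat_continuous HF V0).
have : mean h = c * mean (hhat F 0).
  rewrite -meanZ//; apply: ae_eq_mean => //; apply: L1_measurable; last exact: L1Z.
  exact: density_L1 ES.
rewrite (density_mean ES) [mean _](hhat_normalized HF) mulr1 => c1.
by apply: filterS Hc => x H Dx; rewrite H// -c1 mul1r.
Qed.

(** The uniqueness of the invariant density gives the equality almost
    everywhere, and continuity gives it everywhere. *)
Lemma hhat_density x : Delta x -> hhat F 0 x = h x.
Proof.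
move=> Dx; apply/esym; apply: (continuous_ae_eq _ _ hhat_h Dx).
  by have [Lam _ hL] := h_lip; exact: lipschitz_by_continuous hL.
exact: (hhat_continuous HF V0).
Qed.

Lemma fixed_point_unique d : L1 d -> (forall x, Delta x -> 0 <= d x) -> 0 < mean d ->
  {ae mu, forall x : R, Delta x ->
    cvgn (series (fun n => d (G n x) * G1 n x)) /\ L d x = d x} ->
  L1_eq d (fun x => mean d * h x).
Proof.
move=> d1 d0 md Hd.
have [c Hc] := hhat_unique HF V0 d1 (fixed_point_acim d1 d0 md Hd).
have h1' := density_L1 ES.
have dh : L1_eq d (fun x => c * h x).
  by apply: filterS Hc => x H Dx; rewrite H// hhat_density.
have -> : mean d = c; last exact: dh.
rewrite -[RHS]mulr1 -(density_mean ES) -meanZ//.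
by apply: ae_eq_mean => //; apply: L1_measurable => //; exact: L1Z.
Qed.

(** The positive part of a fixed point is again a fixed point; if it did not
    vanish, it would be a multiple of [h] and hence the whole fixed point
    would be positive. *)
Lemma zero_mean_fixed_le0 d : L1 d -> mean d = 0 ->
  {ae mu, forall x : R, Delta x -> L d x = d x} ->
  {ae mu, forall x : R, Delta x -> d x <= 0}.
Proof.
move=> d1 md Ld; have n1 := L1_norm d1.
pose p x : R := (`|d x| + d x) / 2.
have p1 : L1 p by apply: L1_half; exact: L1D.
have p0 x : Delta x -> 0 <= p x.
  by move=> _; rewrite divr_ge0//; have := ler_norm (- d x); rewrite normrN; lra.
have [g [g1 mg Hg]] := Lhat_nonneg HF p1 p0.
have [g' [_ _ Hn]] := Lhat_L1 HF d1.
have pg : {ae mu, forall x : R, Delta x -> 0 <= g x - p x}.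
  apply: filterS3 Hg Hn Ld => x Hg Hn Ld Dx.
  have [cp <-] := Hg Dx; have [cn _] := Hn Dx.
  have G10 n : 0 <= G1 n x by exact: (dg_word_Delta_ge0 HF).
  have cd : cvgn (series (fun n => d (G n x) * G1 n x)).
    by apply: dominated_cvg_series cn => n; rewrite normrM (ger0_norm (G10 n)).
  have Lp0 : 0 <= L p x.
    apply: total_sum_ge0 => // n; rewrite mulr_ge0// p0//; exact: (word_Delta HF).
  have dp : d x <= L p x.
    rewrite -(Ld Dx); apply: ler_total_sum => // n; rewrite ler_wpM2r//.
    by rewrite /p; have := ler_norm (d (G n x)); lra.
  rewrite subr_ge0 /p; have [d0|d0] := leP 0 (d x).
    by rewrite ger0_norm//; lra.
  by rewrite ltr0_norm// addNr mul0r.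
have gp : {ae mu, forall x : R, Delta x -> g x - p x = 0}.
  by apply: mean_eq0 => //; [exact: L1B|rewrite meanB// mg subrr].
have mp0 : 0 <= mean p.
  have -> : 0 = mean (fun=> 0 : R) by rewrite mean_cst mul0r.
  by apply: ler_mean => //; exact: L1_cst.
have [mp|] := ltP 0 (mean p); last first.
  move=> mp; have {}mp : mean p = 0 by apply/eqP; rewrite eq_le mp.
  have p0' : {ae mu, forall x : R, Delta x -> 0 <= p x} by apply: aeW.
  have := mean_eq0 p1 p0' mp; apply: filterS => x H Dx; have := H Dx; rewrite /p.
  by have := normr_ge0 (d x); lra.
have ph := fixed_point_unique p1 p0 mp _.
have {}ph : L1_eq p (fun x => mean p * h x).
  apply: ph; apply: filterS2 Hg gp => x Hg gp Dx.
  by have [cp ->] := Hg Dx; split => //; apply/eqP; rewrite -subr_eq0 gp.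
exfalso; move: md; have -> : mean d = mean p.
  apply: ae_eq_mean; [exact: L1_measurable|exact: L1_measurable|].
  apply: filterS ph => x H Dx; have px : 0 < p x by rewrite H// mulr_gt0// density_pos.
  move: px; rewrite /p; have [d0|d0] := leP 0 (d x); first by rewrite ger0_norm//; lra.
  by rewrite ltr0_norm//; lra.
by move=> E; rewrite E ltxx in mp.
Qed.

Lemma zero_mean_fixed d : L1 d -> mean d = 0 ->
  {ae mu, forall x : R, Delta x -> L d x = d x} ->
  {ae mu, forall x : R, Delta x -> d x = 0}.
Proof.
move=> d1 md Ld.
have le0 := zero_mean_fixed_le0 d1 md Ld.
have H : {ae mu, forall x : R, Delta x -> - d x = 0}; last first.
  by apply: filterS H => x H /H /eqP; rewrite oppr_eq0 => /eqP.
have N1 : L1 (fun x => - d x).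
  by have := L1Z (-1) d1; apply: eq_integrable => // x _ /=; rewrite mulN1r.
apply: mean_eq0 => //.
  by apply: filterS le0 => x H /H; rewrite oppr_ge0.
transitivity (mean (fun x => -1 * d x)); first by apply: eq_mean => x _; rewrite mulN1r.
by rewrite meanZ// md mulr0.
Qed.

End FixedPoints.

(** * The induced linear response *)

Section LipschitzSeries.
Context {R : realType}.
Implicit Types (f g : R -> R) (u : nat -> R -> R) (K B : nat -> R) (x y : R).

Lemma bounded_byM (B C : R) f g : bounded_by B f -> bounded_by C g ->
  bounded_by (B * C) (fun x => f x * g x).
Proof. by move=> fB gC x Dx; rewrite normrM ler_pM ?fB ?gC. Qed.

Lemma lipschitz_byM (B C K M : R) f g : bounded_by B f -> bounded_by C g ->
  lipschitz_by K f -> lipschitz_by M g ->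
  lipschitz_by (K * C + B * M) (fun x => f x * g x).
Proof.
move=> fB gC fK gM x y Dx Dy.
rewrite (_ : f x * g x - f y * g y = (f x - f y) * g x + f y * (g x - g y)); last by ring.
apply: (le_trans (ler_normD _ _)); rewrite !normrM.
rewrite (_ : (K * C + B * M) * `|x - y| = K * `|x - y| * C + B * (M * `|x - y|)); last by ring.
by apply: lerD; apply: ler_pM => //; [exact: fK|exact: gC|exact: fB|exact: gM].
Qed.

Lemma lipschitz_total_sum u K B : cvgn (series K) -> cvgn (series B) ->
  (forall n, bounded_by (B n) (u n)) -> (forall n, lipschitz_by (K n) (u n)) ->
  lipschitz_by (total_sum K) (fun x => total_sum (fun n => u n x)).
Proof.
move=> cK cB uB uK x y Dx Dy.
have cu z : Delta z -> cvgn (series (fun n => u n z)).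
  by move=> Dz; apply: dominated_cvg_series cB => n; exact: uB.
rewrite -total_sumB; [|exact: cu|exact: cu].
rewrite mulrC -total_sumZ//; apply: normr_total_sum_le; last exact: cvg_seriesZ.
by move=> n; rewrite mulrC; exact: uK.
Qed.

Lemma bounded_total_sum u B : cvgn (series B) -> (forall n, bounded_by (B n) (u n)) ->
  bounded_by (total_sum B) (fun x => total_sum (fun n => u n x)).
Proof. by move=> cB uB x Dx; apply: normr_total_sum_le => // n; exact: uB. Qed.

End LipschitzSeries.

Section InducedResponse.
Context {R : realType} {V : set R} {gamma : R} {F : map_family R}.
Hypothesis HF : standing_assumptions V gamma F.
Implicit Types (d f g w : R -> R) (e x y z t : R) (n k : nat).

Let V0 := V_0 HF.
Let h1 : (2^-1 : R) < 1. Proof. by lra. Qed.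

Local Notation G n := (g_word F n 0).
Local Notation G1 n := (dg_word F n 0).
Local Notation G2 n := (dern Delta 2 (g_word F n 0)).
Local Notation L := (Lhat F).
Local Notation h := (hhat F 0).
Local Notation h' := (der Delta (hhat F 0)).
Local Notation a n := (a_word F n).
Local Notation b n := (dern Delta 1 (pd (g_word F n) 0)).

(** The terms of the source after the substitutions [A0 (G n x) = a n x] and
    [B0 (G n x) * G1 n x = b n x]; they are defined and regular on the closed
    interval [Delta]. *)
Definition source_term n x : R :=
  h' (G n x) * (a n x * G1 n x) + h (G n x) * b n x.

Definition source x : R := total_sum (fun n => source_term n x).

Lemma a_word_bounded : exists2 C : R, 0 <= C &
  forall n x, I01 x -> `|a n x| <= C.
Proof.
have [C C0 HC] := bounded_sup_norm (sup_pd_g_word HF).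
by exists C => // n x Ix; exact: HC.
Qed.

Lemma a_word_lipschitz n (p : R) : bounded_by p (b n) -> lipschitz_by p (a n).
Proof.
move=> bp x y; apply: (segment_lipschitz (df := b n)) => // z.
exact: (pd_word_has_der0 HF n V0).
Qed.

Lemma b_word_lipschitz n (p : R) : bounded_by p (dern Delta 2 (pd (g_word F n) 0)) ->
  lipschitz_by p (b n).
Proof.
move=> bp x y; apply: (segment_lipschitz (df := dern Delta 2 (pd (g_word F n) 0))) => // z.
exact: (pd_word_has_der1 HF n V0).
Qed.

Section WithSystem.
Context {s : nat -> R} {rho D : R}.
Hypothesis ES : expanding_system (fun n => G n) (fun n => G1 n) (fun n => G2 n) s rho D.

Let hE := hhat_density HF ES.

Lemma hhat_lipschitz : exists2 Lam : R, 0 <= Lam & lipschitz_by Lam h.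
Proof.
have [Lam Lam0 H] := density_lipschitz ES; exists Lam => // x y Dx Dy.
by rewrite !hE//; exact: H.
Qed.

Lemma hhat_bounded : exists2 B : R, 0 <= B & bounded_by B h.
Proof.
have [B HB] := density_bounded ES.
have B0 : 0 <= B by apply: le_trans (HB _ Delta1).
by exists B => // x Dx; rewrite hE//; exact: HB.
Qed.

Lemma hhat_taylor : exists v (C : R), forall x y, Delta x -> Delta y ->
  `|h y - h x - v x * (y - x)| <= C * (y - x) ^+ 2.
Proof.
have [v [C H]] := density_taylor ES; exists v, C => x y Dx Dy.
by rewrite !hE//; exact: H.
Qed.

Lemma quadratic_has_der (C : R) (A : set R) f x l :
  (forall y, A y -> `|f y - f x - l * (y - x)| <= C * (y - x) ^+ 2) ->
  has_der A f x l.
Proof.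
move=> H d d0; have C0 : 0 < `|C| + 1 by rewrite ltr_wpDl.
exists (d / (`|C| + 1)); first by rewrite divr_gt0.
move=> y Ay; rewrite ltr_pdivlMr// => yx; apply: (le_trans (H y Ay)).
rewrite -real_normK ?num_real// expr2 mulrA ler_wpM2r//.
apply: le_trans (ltW yx); rewrite mulrC ler_wpM2l//.
by apply: (le_trans (ler_norm C)); rewrite lerDl.
Qed.

Lemma hhat_has_der x : Delta x -> has_der Delta h x (h' x).
Proof.
move=> Dx; have [v [C H]] := hhat_taylor.
have Hv : has_der Delta h x (v x).
  by apply: (@quadratic_has_der C) => y Dy; exact: H.
by have [_ ->] := has_der_der (segment_limit_pt h1 Dx) Hv.
Qed.

Lemma hhat_der_lipschitz : exists2 K : R, 0 <= K & lipschitz_by K h'.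
Proof.
have [v [C H]] := hhat_taylor.
have vE x : Delta x -> h' x = v x.
  move=> Dx; apply: (has_der_unique (segment_limit_pt h1 Dx) (hhat_has_der Dx)).
  by apply: (@quadratic_has_der C) => y Dy; exact: H.
exists (2 * `|C|); first by rewrite mulr_ge0.
move=> x y Dx Dy; have [->|xy] := eqVneq x y; first by rewrite !subrr normr0 mulr0.
have n0 : 0 < `|x - y| by rewrite normr_gt0 subr_eq0.
rewrite !vE// -(ler_pM2r n0) -normrM.
have A := H x y Dx Dy; have B := H y x Dy Dx.
rewrite (_ : (v x - v y) * (x - y) =
  (h y - h x - v x * (y - x)) + (h x - h y - v y * (x - y))); last by ring.
apply: (le_trans (ler_normD _ _)); apply: (le_trans (lerD A B)).
have -> : 2 * `|C| * `|x - y| * `|x - y| = `|C| * (x - y) ^+ 2 + `|C| * (x - y) ^+ 2.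
  by rewrite -[in RHS]real_normK ?num_real//; ring.
rewrite -[(y - x) ^+ 2]sqrrN opprB.
by apply: lerD; rewrite ler_wpM2r ?sqr_ge0 ?ler_norm.
Qed.

Lemma hhat_C1 : C1 Delta h.
Proof.
split; last by have [K _ HK] := hhat_der_lipschitz; exact: lipschitz_by_continuous HK.
move=> x Dx; have [] := has_der_der (segment_limit_pt h1 Dx) (hhat_has_der Dx).
by [].
Qed.

Lemma hhat_der_bounded : exists2 B : R, 0 <= B & bounded_by B h'.
Proof.
have [K _ HK] := hhat_der_lipschitz.
have [B HB] := continuous_Delta_bounded (lipschitz_by_continuous HK).
by exists B => //; exact: le_trans (HB _ Delta1).
Qed.

Lemma comp_word_lipschitz f n K : 0 <= K -> lipschitz_by K f -> lipschitz_by K (fun x => f (G n x)).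
Proof.
move=> K0 fK x y Dx Dy.
apply: (le_trans (fK _ _ (word_Delta HF n Dx) (word_Delta HF n Dy))).
rewrite ler_wpM2l//; apply: (le_trans (es_contract ES n Dx Dy)).
by rewrite ler_piMl//; case/andP: (es_rho ES) => _ /ltW.
Qed.

Lemma comp_word_bounded f n B : bounded_by B f -> bounded_by B (fun x => f (G n x)).
Proof. by move=> fB x Dx; apply: fB; exact: (word_Delta HF). Qed.

Lemma G1_bounded n : bounded_by (s n) (G1 n).
Proof. by move=> x Dx; exact: (normr_G1 ES). Qed.

(** Every factor of a term is bounded and Lipschitz, and in each product one
    factor, [G1 n] or [b n], carries summable constants. *)
Lemma source_regular : exists (B K : nat -> R),
  [/\ (forall n, 0 <= B n) /\ (forall n, 0 <= K n), cvgn (series B), cvgn (series K),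
      forall n, bounded_by (B n) (source_term n) &
      forall n, lipschitz_by (K n) (source_term n)].
Proof.
have [Kh Kh0 hK] := hhat_lipschitz; have [Bh Bh0 hB] := hhat_bounded.
have [Kv Kv0 vK] := hhat_der_lipschitz; have [Bv Bv0 vB] := hhat_der_bounded.
have [Ca Ca0 aC] := a_word_bounded.
have [p1 [p10 cp1 Hp1]] := pd_word_bound HF (isT : 1 <= 1 <= 2)%N.
have [p2 [p20 cp2 Hp2]] := pd_word_bound HF (isT : 1 <= 2 <= 2)%N.
have cs := es_s_cvg ES; have s0 := es_s_ge0 ES.
pose P := total_sum p1.
have P0 : 0 <= P by exact: total_sum_ge0.
have b1 n : bounded_by (p1 n) (b n) by move=> x; exact: Hp1.
have b2 n : bounded_by (p2 n) (dern Delta 2 (pd (g_word F n) 0)) by move=> x; exact: Hp2.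
have aB n : bounded_by Ca (a n) by move=> x /Delta_I01; exact: aC.
have aL n : lipschitz_by P (a n).
  move=> x y Dx Dy; apply: (le_trans (a_word_lipschitz (b1 n) Dx Dy)).
  by rewrite ler_wpM2r// term_le_total.
exists (fun n => Bv * (Ca * s n) + Bh * p1 n).
exists (fun n => (Kv * (Ca * s n) + Bv * (P * s n + Ca * s n)) +
                 (Kh * p1 n + Bh * p2 n)); split.
- split => n; first by rewrite addr_ge0// !mulr_ge0.
  by rewrite !addr_ge0// !mulr_ge0// addr_ge0// mulr_ge0.
- by apply: cvg_seriesD; apply: cvg_seriesZ => //; exact: cvg_seriesZ.
- apply: cvg_seriesD; apply: cvg_seriesD; apply: cvg_seriesZ => //.
    exact: cvg_seriesZ.
  by apply: cvg_seriesD; exact: cvg_seriesZ.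
- move=> n; apply: bounded_byD; apply: bounded_byM; try exact: comp_word_bounded.
    by apply: bounded_byM; [exact: aB|exact: G1_bounded].
  exact: b1.
- move=> n; apply: lipschitz_byD.
    apply: lipschitz_byM.
    + exact: comp_word_bounded.
    + by apply: bounded_byM; [exact: aB|exact: G1_bounded].
    + exact: comp_word_lipschitz.
    + apply: lipschitz_byM => //; first exact: G1_bounded.
      by move=> x y; exact: (es_G1_lip ES).
  apply: lipschitz_byM.
  + exact: comp_word_bounded.
  + exact: b1.
  + exact: comp_word_lipschitz.
  + exact: b_word_lipschitz.
Qed.

Lemma source_bounded : exists2 B : R, 0 <= B & bounded_by B source.
Proof.
have [B [K [[B0 K0] cB cK HB HK]]] := source_regular.
by exists (total_sum B); [exact: total_sum_ge0|exact: bounded_total_sum].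
Qed.

Lemma source_lipschitz : exists2 K : R, 0 <= K & lipschitz_by K source.
Proof.
have [B [K [[B0 K0] cB cK HB HK]]] := source_regular.
by exists (total_sum K); [exact: total_sum_ge0|exact: lipschitz_total_sum cK cB HB HK].
Qed.

Lemma Wsource_source x : 2^-1 < x < 1 -> Wsource F x = source x.
Proof.
move=> xI; apply: eq_total_sum => n; rewrite /source_term.
rewrite (A0_word HF n xI) -(B0_word HF n xI) -(dg_wordE HF n V0 (open_Delta xI)).
by ring.
Qed.

Section Response.
Variable hs : R -> R.
Hypothesis Hhs : is_induced_response F hs.

Let hs1 : L1 hs. Proof. by case: Hhs. Qed.
Let hs0 : mean hs = 0. Proof. by case: Hhs. Qed.
Let W1 : L1 source.
Proof. by have [K _ HK] := source_lipschitz; exact: lipschitz_by_L1 HK. Qed.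

Let hsW : {ae mu, forall x : R, Delta x -> hs x - L hs x = source x}.
Proof.
have [_ _ H] := Hhs; apply: filterS2 H (@ae_Delta_open R) => x H xI Dx.
by rewrite (H Dx) Wsource_source// xI.
Qed.

(** The transfer operator preserves integrals, so that the integral of
    [hs - Lhat F hs] vanishes. *)
Lemma source_mean : mean source = 0.
Proof.
have [g [g1 mg Hg]] := Lhat_L1 HF hs1.
transitivity (mean (fun x => hs x - g x)); last by rewrite meanB// mg subrr.
apply: ae_eq_mean; [exact: L1_measurable|by apply: L1_measurable; exact: L1B|].
apply: filterS2 Hg hsW => x Hg HW Dx; rewrite -HW//.
by have [_ ->] := Hg Dx.
Qed.

Local Notation u := (@potential R (fun n => G n) (fun n => G1 n) source).

Lemma source_decay : exists2 C : R, 0 <= C & forall n,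
  bounded_by (C * (@cone_rate R rho D) ^+ n) (iter n L source) /\
  lipschitz_by (C * (@cone_rate R rho D) ^+ n) (iter n L source).
Proof.
have [B _ WB] := source_bounded; have [K K0 WK] := source_lipschitz.
exact: (zero_mean_decay ES K0 WB WK source_mean).
Qed.

(** The difference of [hs] and of the sum of the series [L^n W] is a fixed point
    of zero average. *)
Lemma response_potential : {ae mu, forall x : R, Delta x -> hs x = u x}.
Proof.
have [C C0 HC] := source_decay.
have WB n := (HC n).1; have WL n := (HC n).2.
have uL := potential_lipschitz ES WB WL.
have uB := potential_bounded ES WB.
have u1 : L1 u := lipschitz_by_L1 uL.
have um := potential_mean ES WB WL source_mean.
have [g [g1 mg Hg]] := Lhat_L1 HF hs1.
suff : {ae mu, forall x : R, Delta x -> hs x - u x = 0}.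
  by apply: filterS => x H /H /eqP; rewrite subr_eq0 => /eqP.
apply: (zero_mean_fixed HF ES); first exact: L1B.
  by rewrite meanB// hs0 um subrr.
apply: filterS2 Hg hsW => x Hg HW Dx; have [cx _] := Hg Dx.
have chs : cvgn (series (fun n => hs (G n x) * G1 n x)).
  apply: dominated_cvg_series cx => n; rewrite normrM [`|G1 n x|]ger0_norm//.
  exact: (dg_word_Delta_ge0 HF).
have cu := transfer_cvg ES uB Dx.
have -> : L (fun y => hs y - u y) x = L hs x - L u x.
  by rewrite /Lhat -total_sumB//; apply: eq_total_sum => n; rewrite mulrBl.
have -> : L u x = u x - source x by exact: (potential_transfer ES C0 WB Dx).
by rewrite -(HW Dx); ring.
Qed.

End Response.
End WithSystem.

(** By the change of variables, the points that [G n] sends into a null set form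
    a null set for the measure of density [G1 n]. The intervals on which it
    applies stay away from 0 and exhaust [(0, 1]]. *)
Lemma ae_pullback (P : R -> Prop) : {ae @mu R, forall x, Delta x -> P x} ->
  {ae @mu R, forall x, 0 < x <= 1 -> forall n, G1 n x != 0 -> P (G n x)}.
Proof.
move=> [Z [mZ Z0 HZ]].
have main n (m : nat) : {ae @mu R, forall x, (m.+2%:R)^-1 < x <= 1 -> G1 n x != 0 -> P (G n x)}.
  set t : R := (m.+2%:R)^-1.
  have t01 : 0 < t < 1 by rewrite invr_gt0 ltr0n/= invf_lt1 ?ltr0n// ltr1n.
  have [t0 t1] := andP t01.
  have It (x : R) : t < x <= 1 -> I01 x.
    by move=> /andP[tx x1]; apply/I01P; rewrite (ltW (lt_trans t0 tx)).
  pose chi : R -> \bar R := fun z => (\1_Z z)%:E.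
  have mchi (E : set (measurableTypeR R)) : measurable_fun E chi.
    by apply/measurable_EFinP; exact: measurable_indic.
  have E0 : (\int[mu]_(x in `]t, 1%R]) (chi (G n x) * (G1 n x)%:E) = 0)%E.
    rewrite (word_change_of_variables HF t01); [|exact: mchi|]; last first.
      by move=> y _; rewrite lee_fin indicE ler0n.
    rewrite (_ : (fun=> _) = (EFin \o \1_Z))// integral_indic//.
    apply: (@subset_measure0 _ _ _ (@lebesgue_measure R) _ Z) => //.
    by apply: measurableI => //; exact: measurable_itv.
  have mf : measurable_fun (`]t, 1]%classic : set (measurableTypeR R))
      (fun x => chi (G n x) * (G1 n x)%:E)%E.
    have sub : `]t, 1]%classic `<=` (@I01 R) by move=> x /=; rewrite in_itv/= => /It.
    apply: emeasurable_funM.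
      apply: measurableT_comp; first exact: mchi.
      apply: (measurable_funS _ sub); first exact: measurable_itv.
      apply: subspace_continuous_measurable_fun; first exact: measurable_itv.
      exact: (@g_word_continuous _ _ _ _ HF n 0 V0).
    apply/measurable_EFinP.
    apply: (@measurable_funS _ _ _ _ (`]0, 1]%classic : set (measurableTypeR R))).
    - exact: measurable_itv.
    - by move=> x /=; rewrite !in_itv/= => /andP[tx ->]; rewrite (lt_trans t0 tx).
    - apply: subspace_continuous_measurable_fun; first exact: measurable_itv.
      exact: (@dg_word_continuous _ _ _ _ HF n 0 V0).
  have := E0; rewrite -[X in X = _](_ : (\int[mu]_(x in `]t, 1%R]) `|chi (G n x) * (G1 n x)%:E| = _)%E); last first.
    apply: eq_integral => x; rewrite inE/= in_itv/= => /It Ix.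
    by rewrite /= ger0_norm// mulr_ge0 ?indicE ?ler0n// (dg_word_ge0 HF).
  move/(ae_eq_integral_abs mu (measurable_itv _) mf).
  apply: filterS => x H tx G0; apply: contrapT => nP.
  have ZG : Z (G n x).
    apply: HZ => /=; apply: contra_not nP; apply.
    by apply/DeltaP; exact: (g1_range HF V0 (iter_g0_I01 HF n V0 (It _ tx))).
  have := H; rewrite /= in_itv/= => /(_ tx)/eqP; rewrite /chi indicE mem_set// mul1e eqe.
  by move/eqP => G00; move: G0; rewrite G00 eqxx.
have := ae_foralln (fun n => ae_foralln (main n)).
apply: filterS => x H /andP[x0 x1] n; have [m mx] : exists m : nat, (m.+2%:R)^-1 < x.
  have := archi_boundP (ltW (_ : 0 < x^-1)); rewrite invr_gt0 => /(_ x0).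
  set N := Num.bound _ => HN; exists N; rewrite invf_plt ?posrE ?ltr0n//.
  by apply: (lt_trans HN); rewrite ltr_nat.
by apply: (H n m); rewrite mx.
Qed.

End InducedResponse.

(** * The discretized transfer operator *)

Section Interpolation.
Context {R : realType}.
Implicit Types (f g : R -> R) (x y E : R) (i M : nat).

Lemma mesh_gt0 M : (0 < M)%N -> 0 < mesh M :> R.
Proof. by move=> M0; rewrite /mesh invr_gt0 mulr_gt0// ltr0n. Qed.

Lemma mesh_M M : (0 < M)%N -> M%:R * mesh M = 2^-1 :> R.
Proof. by move=> M0; rewrite /mesh; field; rewrite ?pnatr_eq0 -?lt0n. Qed.

Lemma nodeS M i : node M i.+1 = node M i + mesh M :> R.
Proof. by rewrite /node -natr1; ring. Qed.

Lemma node_Delta M i : (i <= M)%N -> Delta (node M i : R).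
Proof.
case: M => [|M]; first by rewrite leqn0 => /eqP->; apply/DeltaP; rewrite /node mul0r; lra.
move=> iM; have m0 : 0 < mesh M.+1 :> R by exact: mesh_gt0.
apply/DeltaP; rewrite /node lerDl mulr_ge0 ?(ltW m0)//=.
have : i%:R * mesh M.+1 <= M.+1%:R * mesh M.+1 :> R by rewrite ler_wpM2r ?(ltW m0)// ler_nat.
by rewrite mesh_M//; lra.
Qed.

Lemma cellP M i x : cell M i x <-> node M i <= x <= node M i + mesh M.
Proof. by rewrite /cell/= in_itv/= nodeS. Qed.

Lemma cell_Delta M i x : (i < M)%N -> cell M i x -> Delta x.
Proof.
move=> iM; rewrite /cell/= in_itv/= => /andP[x1 x2].
have /DeltaP/andP[n1 _] := @node_Delta M i (ltnW iM).
have /DeltaP/andP[_ n2] := @node_Delta M i.+1 iM.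
by apply/DeltaP; rewrite (le_trans n1 x1) (le_trans x2 n2).
Qed.

Lemma cell_locate M x : (0 < M)%N -> Delta x -> exists2 i, (i < M)%N & cell M i x.
Proof.
move=> M0 /DeltaP/andP[hx x1]; have m0 := mesh_gt0 M0.
have [i [iM xi]] : exists i, (i < M)%N /\ x <= node M i.+1.
  exists M.-1; rewrite prednK//; split => //.
  by rewrite /node mesh_M//; lra.
elim: i iM xi => [|i IH] iM xi.
  by exists 0%N => //; rewrite /cell/= in_itv/= xi andbT /node mul0r addr0.
have [le|lt] := leP x (node M i.+1); first by apply: IH => //; exact: ltnW.
by exists i.+1 => //; rewrite /cell/= in_itv/= (ltW lt).
Qed.

Lemma hat_far M i j x : (0 < M)%N -> cell M i x -> j != i -> j != i.+1 ->
  hat M j x = 0.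
Proof.
move=> M0 /cellP/andP[x1 x2] ji ji1; have m0 := mesh_gt0 M0.
rewrite /hat; apply/max_idPl; rewrite subr_le0 ler_pdivlMr// mul1r.
have [lt|gt|E] := ltngtP j i; last by rewrite E eqxx in ji.
  have : j.+1%:R * mesh M <= i%:R * mesh M :> R by rewrite ler_wpM2r ?(ltW m0)// ler_nat.
  rewrite -natr1 => H; apply: le_trans (ler_norm _).
  by move: x1; rewrite /node; lra.
have gt1 : (i.+2 <= j)%N by rewrite ltn_neqAle gt eq_sym ji1.
have : i.+2%:R * mesh M <= j%:R * mesh M :> R by rewrite ler_wpM2r ?(ltW m0)// ler_nat.
rewrite -addn2 natrD => H; rewrite distrC; apply: le_trans (ler_norm _).
by move: x2; rewrite /node; lra.
Qed.

Definition hat_sum M (c : nat -> R) x : R := \sum_(i < M.+1) c i * hat M i x.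

Lemma hat_sum_cell M i (c : nat -> R) x : (0 < M)%N -> (i < M)%N -> cell M i x ->
  exists2 t : R, 0 <= t <= 1 &
    hat_sum M c x = (1 - t) * c i + t * c i.+1.
Proof.
move=> M0 iM xc; have m0 := mesh_gt0 M0; have mn0 := gt_eqF m0.
have /cellP/andP[x1 x2] := xc.
pose t := (x - node M i) / mesh M.
have t01 : 0 <= t <= 1.
  rewrite /t divr_ge0 ?subr_ge0 ?(ltW m0)//= ler_pdivrMr// mul1r; lra.
exists t => //; have [t0 t1] := andP t01.
have iM1 : (i < M.+1)%N by exact: ltnW.
rewrite /hat_sum (bigD1 (Ordinal iM1))//= (bigD1 (Ordinal (iM : i.+1 < M.+1)%N))/=; last first.
  by apply/eqP => /(congr1 val)/= /eqP; rewrite gtn_eqF.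
rewrite big1 ?addr0; last first.
  move=> j /andP[j1 j2]; rewrite (@hat_far M i)// ?mulr0//.
have -> : hat M i x = 1 - t.
  rewrite /hat ger0_norm ?subr_ge0// -/t; apply/max_idPr; lra.
have -> : hat M i.+1 x = t.
  rewrite /hat ler0_norm; last by rewrite nodeS; lra.
  have -> : 1 - - (x - node M i.+1) / mesh M = t by rewrite /t nodeS; field; rewrite mn0.
  by apply/max_idPr.
by ring.
Qed.

(** The hat functions form a partition of unity, and only those of the two
    neighbouring nodes are nonzero at [x]. *)
Lemma hat_sum_near M (c : nat -> R) x v E : (0 < M)%N -> Delta x ->
  (forall i, (i <= M)%N -> `|x - node M i| <= mesh M -> `|c i - v| <= E) ->
  `|hat_sum M c x - v| <= E.
Proof.
move=> M0 Dx H; have [i iM xc] := cell_locate M0 Dx.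
have [t /andP[t0 t1] ->] := hat_sum_cell c M0 iM xc.
have /cellP/andP[x1 x2] := xc; have m0 := mesh_gt0 M0.
have A : `|c i - v| <= E by apply: H; [exact: ltnW|rewrite ler_norml; lra].
have B : `|c i.+1 - v| <= E by apply: H => //; rewrite nodeS ler_norml; lra.
have -> : (1 - t) * c i + t * c i.+1 - v =
  (1 - t) * (c i - v) + t * (c i.+1 - v) by ring.
apply: (le_trans (ler_normD _ _)); rewrite !normrM (ger0_norm t0) ger0_norm ?subr_ge0//.
have -> : E = (1 - t) * E + t * E by ring.
by apply: lerD; rewrite ler_wpM2l// subr_ge0.
Qed.

Lemma hat_lipschitz M i : exists K, lipschitz_by K (@hat R M i).
Proof.
exists (`|(mesh M)^-1|) => x y _ _.
have maxl (u v : R) : `|Num.max 0 u - Num.max 0 v| <= `|u - v|.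
  by case: (leP 0 u) => ?; case: (leP 0 v) => ?; rewrite ?subrr ?normr0// ler_norml;
    have := ler_norm (u - v); have := ler_norm (v - u); rewrite (distrC v u); lra.
apply: (le_trans (maxl _ _)).
rewrite (_ : _ - _ = (`|y - node M i| - `|x - node M i|) * (mesh M)^-1); last by ring.
rewrite normrM mulrC ler_wpM2l//; apply: (le_trans (ler_dist_dist _ _)).
by rewrite (_ : _ - _ = - (x - y)) ?normrN//; ring.
Qed.

Lemma hat_sum_continuous M (c : nat -> R) : {within Delta, continuous (hat_sum M c)}.
Proof.
suff [K HK] : exists K, lipschitz_by K (hat_sum M c) by exact: lipschitz_by_continuous HK.
rewrite /hat_sum; elim: (index_enum _) => [|j r [K HK]].
  by exists 0 => x y _ _; rewrite !big_nil subrr normr0 mul0r.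
have [K' HK'] := hat_lipschitz M j.
exists (`|c j| * K' + K) => x y Dx Dy; rewrite !big_cons opprD addrACA -mulrBr.
apply: (le_trans (ler_normD _ _)); rewrite normrM mulrDl -mulrA.
by apply: lerD; [rewrite ler_wpM2l// HK'|exact: HK].
Qed.

Lemma interp_near M f x v E : (0 < M)%N -> Delta x ->
  (forall i, (i <= M)%N -> `|x - node M i| <= mesh M -> `|f (node M i) - v| <= E) ->
  `|interp M f x - v| <= E.
Proof. exact: (@hat_sum_near M (fun i => f (node M i))). Qed.

Lemma interp_continuous M f : {within Delta, continuous (interp M f)}.
Proof. exact: (@hat_sum_continuous M (fun i => f (node M i))). Qed.

End Interpolation.

Section DiscreteTransfer.
Context {R : realType} {V : set R} {gamma : R} {F : map_family R}.
Hypothesis HF : standing_assumptions V gamma F.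
Implicit Types (d f g w : R -> R) (e x y z t B K E : R) (n k M : nat).


Local Notation G n := (g_word F n 0).
Local Notation G1 n := (dg_word F n 0).
Local Notation G2 n := (dern Delta 2 (g_word F n 0)).
Local Notation L := (Lhat F).
Local Notation Ld := (Lhat_delta F).

Context {s : nat -> R} {rho D : R}.
Hypothesis ES : expanding_system (fun n => G n) (fun n => G1 n) (fun n => G2 n) s rho D.
Local Notation S := (total_sum s).

Let s0 := es_s_ge0 ES.
Let cs := es_s_cvg ES.
Let S0 : 0 <= S. Proof. exact: S_ge0 ES. Qed.

Lemma delta_ge0 k : 0 <= delta F k.
Proof. by rewrite (deltaE HF) subr_ge0 ltW// (endpoint_gt HF). Qed.

Lemma delta_le k : delta F k <= 2^-1.
Proof. by rewrite (deltaE HF); have := endpoint_le1 HF k; lra. Qed.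

Lemma affine_branch_Delta k x : Delta x -> Delta (affine_branch F k x).
Proof.
move=> /DeltaP/andP[hx x1]; have d0 := delta_ge0 k; have d1 := delta_le k.
apply/DeltaP; rewrite /affine_branch; apply/andP; split.
  by rewrite lerDr mulr_ge0//; lra.
have : delta F k * (2 * x - 1) <= delta F k * 1 by rewrite ler_wpM2l//; lra.
by lra.
Qed.

Lemma Lhat_delta_close B f k x : bounded_by B f -> Delta x ->
  `|Ld k f x - L f x| <= B * tail s k + 2 * delta F k * B.
Proof.
move=> fB Dx; have d0 := delta_ge0 k.
have B0 : 0 <= B by apply: le_trans (fB _ Dx).
pose u n := f (G n x) * G1 n x.
have ub n : `|u n| <= B * s n by exact: (transfer_term_bound ES).
have tl := tail_dominated k ub (@cvg_seriesZ _ B s cs).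
have tE : tail (fun n => B * s n) k = B * tail s k.
  rewrite /tail total_sumZ// mulrBr; congr (_ - _).
  by rewrite /partial_sum big_distrr.
rewrite tE in tl; rewrite /Lhat_delta -/(partial_sum k u) /Lhat -/u.
rewrite addrAC; apply: (le_trans (ler_normD _ _)); apply: lerD; first by rewrite distrC.
rewrite normrM ger0_norm ?mulr_ge0// ler_wpM2l ?mulr_ge0//.
by apply: fB; exact: affine_branch_Delta.
Qed.

Lemma Lhat_delta_diff E f g k x : (forall y, Delta y -> `|f y - g y| <= E) -> Delta x ->
  `|Ld k f x - Ld k g x| <= (S + 1) * E.
Proof.
move=> fgE Dx; have d0 := delta_ge0 k; have d1 := delta_le k.
have E0 : 0 <= E by apply: le_trans (fgE _ Dx).
rewrite /Lhat_delta opprD addrACA -sumrB -mulrBr [leRHS]mulrDl mul1r.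
apply: (le_trans (ler_normD _ _)); apply: lerD.
  apply: (le_trans (ler_norm_sum _ _ _)).
  apply: (@le_trans _ _ (partial_sum k s * E)); last first.
    by rewrite ler_wpM2r// partial_sum_le_total.
  rewrite mulrC /partial_sum big_distrr/=; apply: ler_sum => n _.
  rewrite -mulrBl normrM ler_pM//; first by apply: fgE; exact: (word_Delta HF).
  exact: (normr_G1 ES).
rewrite normrM ger0_norm ?mulr_ge0//.
apply: (@le_trans _ _ (2 * delta F k * E)).
  by rewrite ler_wpM2l ?mulr_ge0// fgE//; exact: affine_branch_Delta.
by rewrite ler_piMl//; lra.
Qed.

Section FixedMesh.
Variables (M k : nat).
Hypothesis M0 : (0 < M)%N.
Hypothesis k_tail : tail s k <= mesh M.
Hypothesis k_delta : delta F k <= mesh M.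

Let m0 : 0 < mesh M :> R. Proof. exact: mesh_gt0. Qed.

(** Each interpolation costs a Lipschitz constant times the mesh size; the tail
    of the series and the affine branch that replaces it cost [tail s k] and
    [delta F k]. *)
Lemma Lh_close B K E f g x : 0 <= K -> bounded_by B g -> lipschitz_by K g ->
  (forall y, Delta y -> `|f y - g y| <= E) -> Delta x ->
  `|Lh F M k f x - L g x| <= ((2 * S + 1) * K + (S + 3) * B) * mesh M + (S + 1) * E.
Proof.
move=> K0 gB gK fgE Dx.
have B0 : 0 <= B by apply: le_trans (gB _ Dx).
have iE y : Delta y -> `|interp M f y - g y| <= E + K * mesh M.
  move=> Dy; apply: interp_near => // i iM yi; have Di := @node_Delta R _ _ iM.
  rewrite (_ : _ - _ = (f (node M i) - g (node M i)) + (g (node M i) - g y)); last by ring.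
  apply: (le_trans (ler_normD _ _)); apply: lerD; first exact: fgE.
  by apply: (le_trans (gK _ _ Di Dy)); rewrite distrC ler_wpM2l.
apply: interp_near => // i iM xi; have Di := @node_Delta R _ _ iM.
have A := Lhat_delta_diff k iE Di.
have C := Lhat_delta_close k gB Di.
have H := transfer_lipschitz ES B0 K0 gB gK Di Dx.
have {}H : `|L g (node M i) - L g x| <= S * (K + B) * mesh M.
  by apply: (le_trans H); rewrite distrC ler_wpM2l// mulr_ge0// addr_ge0.
have T1 : B * tail s k <= B * mesh M by rewrite ler_wpM2l.
have T2 : delta F k * B <= mesh M * B by rewrite ler_wpM2r.
apply: (le_trans (ler_distD (Ld k g (node M i)) _ _)).
apply: (le_trans (lerD A (ler_distD (L g (node M i)) _ _))).
apply: (le_trans (lerD (lexx _) (lerD C H))).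
rewrite -subr_ge0 (_ : _ - _ = (B * mesh M - B * tail s k) +
  2 * (mesh M * B - delta F k * B)); last by ring.
by rewrite addr_ge0// ?mulr_ge0// subr_ge0.
Qed.

Lemma Ph_continuous f : {within Delta, continuous (Ph F M k f)}.
Proof.
by move=> x; apply: cvgD; [exact: interp_continuous|exact: cvg_cst].
Qed.

(** The exact operator preserves integrals: the constant that restores the
    integral is of the size of the error of [Lh]. *)
Lemma Ph_close B K E f g x : 0 <= K -> bounded_by B g -> lipschitz_by K g ->
  L1 f -> (forall y, Delta y -> `|f y - g y| <= E) -> Delta x ->
  `|Ph F M k f x - L g x| <=
    2 * ((2 * S + 1) * K + (S + 3) * B) * mesh M + (2 * S + 3) * E.
Proof.
move=> K0 gB gK f1 fgE Dx.
have B0 : 0 <= B by apply: le_trans (gB _ Dx).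
have g1 : L1 g := lipschitz_by_L1 gK.
have Lg1 : L1 (L g) := lipschitz_by_L1 (transfer_lipschitz ES B0 K0 gB gK).
have Lh1 : L1 (Lh F M k f) by apply: continuous_Delta_integrable; exact: interp_continuous.
pose E' : R := ((2 * S + 1) * K + (S + 3) * B) * mesh M + (S + 1) * E.
have close y : Delta y -> `|Lh F M k f y - L g y| <= E' by move=> Dy; exact: Lh_close.
rewrite /Ph; have -> : fine (mu (@Delta R)) = 2^-1.
  by transitivity (fine (2^-1)%:E : R) => //; congr fine; exact: mu_Delta.
rewrite invrK -/(mean f) -/(mean (Lh F M k f)).
have A := mean_bound (L1B f1 g1) fgE.
have C := mean_bound (L1B Lh1 Lg1) close.
rewrite !meanB// in A C.
have mE : mean (L g) = mean g by apply: (mean_transfer ES); exact: lipschitz_by_continuous gK.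
rewrite mE in C.
rewrite (_ : _ - _ = (Lh F M k f x - L g x) +
  2 * ((mean f - mean g) - (mean (Lh F M k f) - mean g))); last by ring.
apply: (le_trans (ler_normD _ _)); rewrite normrM (ger0_norm (ler0n _ 2)).
have := ler_normB (mean f - mean g) (mean (Lh F M k f) - mean g).
have := close x Dx; rewrite /E' in C * => X Y.
have : `|mean f - mean g - (mean (Lh F M k f) - mean g)| <= E / 2 + E' / 2.
  by apply: (le_trans Y); apply: lerD.
rewrite /E'; lra.
Qed.

End FixedMesh.

(** For a fixed number of steps the discretized iterates follow the exact ones
    up to a multiple of the mesh size; the multiple depends on the number of
    steps, not on the mesh. *)
Lemma iterates_close w C E0 : 0 <= C -> (forall n, bounded_by C (iter n L w)) ->
  (forall n, lipschitz_by C (iter n L w)) -> exists E : nat -> R,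
  forall M k f, (0 < M)%N -> tail s k <= mesh M -> delta F k <= mesh M ->
    {within Delta, continuous f} ->
    (forall y, Delta y -> `|f y - w y| <= E0 * mesh M) ->
    forall n, {within Delta, continuous (iter n (Ph F M k) f)} /\
      forall x, Delta x -> `|iter n (Ph F M k) f x - iter n L w x| <= E n * mesh M.
Proof.
move=> C0 wB wK.
exists (fun n => iter n (fun e => 2 * ((2 * S + 1) * C + (S + 3) * C) + (2 * S + 3) * e) E0).
move=> M k f M0 kt kd fc fw; elim => [|n [IHc IH]]; first by split.
split; first exact: Ph_continuous.
move=> x Dx; rewrite iterS mulrDl -[(2 * S + 3) * _ * _]mulrA [iter n.+1]lock -lock/=.
by apply: Ph_close => //; exact: continuous_Delta_integrable.
Qed.

End DiscreteTransfer.

(** * Discretization of the source *)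

Section IntegralBounds.
Context {R : realType}.
Implicit Types (f : R -> R) (g psi : R -> \bar R) (a b c p q K z e : R).

Lemma segment_ge0_integral_le a b g q : a < b -> 0 <= q ->
  (forall z, 0 <= g z)%E -> (forall z, (a < z < b)%R -> g z <= q%:E)%E ->
  (\int[mu]_(z in `[a, b]) g z <= (q * (b - a))%:E)%E.
Proof.
move=> ab q0 g0 gq.
have mI : measurable (`[a, b]%classic : set (measurableTypeR R)) by exact: measurable_itv.
apply: (@le_trans _ _ (\int[mu]_(z in `[a, b]) (cst q%:E z))%E); last first.
  by rewrite /mu integral_cst//= lebesgue_measure_itv/= lte_fin ab -EFinB -EFinM.
pose N : set (measurableTypeR R) := [set a] `|` [set b].
apply: (@le_ae_nonneg_integral _ _ _ _ _ _ _ N) => //.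
- by apply: measurableU; exact: measurable_set1.
- by rewrite /mu; apply: countable_lebesgue_measure0; apply: finite_set_countable; rewrite finite_setU; split; exact: finite_set1.
- move=> z; rewrite /= in_itv/= => /andP[az zb] /not_orP[za zb']; apply: gq.
  by rewrite !lt_neqAle az zb !andbT; apply/andP; split; apply/eqP => // /esym.
Qed.

Lemma segment_ge0_integral_ge a b g p : a < b ->
  (forall z, 0 <= g z)%E -> (forall z, (a < z < b)%R -> p%:E <= g z)%E ->
  0 <= p -> ((p * (b - a))%:E <= \int[mu]_(z in `[a, b]) g z)%E.
Proof.
move=> ab g0 gp p0.
have mI : measurable (`]a, b[%classic : set (measurableTypeR R)) by exact: measurable_itv.
apply: (@le_trans _ _ (\int[mu]_(z in `]a, b[) (cst p%:E z))%E).
  by rewrite /mu integral_cst//= lebesgue_measure_itv/= lte_fin ab -EFinB -EFinM.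
rewrite integral_mkcond [leRHS]integral_mkcond; apply: le_nonneg_integral => z _.
  by rewrite patchE; case: ifPn => // _; rewrite lee_fin.
rewrite !patchE; case: ifPn => [|_]; last by case: ifPn.
rewrite inE/= in_itv/= => zab; rewrite ifT; first exact: gp.
by rewrite inE/= in_itv/=; case/andP: zab => /ltW -> /ltW ->.
Qed.

(** The integrals of the positive and negative parts of [f] are suprema over
    simple functions, and are compared with those of constants. *)
Lemma Rintegral_segment_bound f a b c K : a < b ->
  (forall z, a < z < b -> `|f z - c| <= K) ->
  `|\int[mu]_(z in `[a, b]) f z - c * (b - a)| <= K * (b - a).
Proof.
move=> ab fK.
have fI z : a < z < b -> c - K <= f z <= c + K.
  by move/fK; rewrite ler_norml; lra.
have len0 : 0 < b - a by rewrite subr_gt0.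
set U := (\int[mu]_(z in `[a, b]) (EFin \o f)^\+ z)%E.
set W := (\int[mu]_(z in `[a, b]) (EFin \o f)^\- z)%E.
have pE z : ((EFin \o f)^\+ z = (Num.max (f z) 0)%:E)%E by rewrite funeposE/= EFin_max.
have nE z : ((EFin \o f)^\- z = (Num.max (- f z) 0)%:E)%E by rewrite funenegE/= EFin_max.
have U1 : (U <= (Num.max (c + K) 0 * (b - a))%:E)%E.
  apply: segment_ge0_integral_le => //; first by rewrite le_max lexx orbT.
  move=> z /fI/andP[_ H]; rewrite pE lee_fin ge_max !le_max H lexx/=.
  by rewrite orbT.
have U2 : ((Num.max (c - K) 0 * (b - a))%:E <= U)%E.
  apply: segment_ge0_integral_ge => //; last by rewrite le_max lexx orbT.
  by move=> z /fI/andP[H _]; rewrite pE lee_fin ge_max !le_max H lexx/= orbT.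
have W1 : (W <= (Num.max (K - c) 0 * (b - a))%:E)%E.
  apply: segment_ge0_integral_le => //; first by rewrite le_max lexx orbT.
  move=> z /fI/andP[H _]; rewrite nE lee_fin ge_max !le_max lexx orbT andbT.
  by apply/orP; left; lra.
have W2 : ((Num.max (- (c + K)) 0 * (b - a))%:E <= W)%E.
  apply: segment_ge0_integral_ge => //; last by rewrite le_max lexx orbT.
  move=> z /fI/andP[_ H]; rewrite nE lee_fin ge_max !le_max lexx orbT andbT.
  by apply/orP; left; lra.
have U0 : (0 <= U)%E by apply: integral_ge0.
have W0 : (0 <= W)%E by apply: integral_ge0.
have Ufin : U \is a fin_num by rewrite ge0_fin_numE//; apply: le_lt_trans U1 _; rewrite ltry.
have Wfin : W \is a fin_num by rewrite ge0_fin_numE//; apply: le_lt_trans W1 _; rewrite ltry.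
rewrite /Rintegral integralE -/U -/W fineB//.
move: U1 U2 W1 W2; rewrite -(fineK Ufin) -(fineK Wfin) !lee_fin/=.
move: (fine U) (fine W) => u w; move: (b - a) len0 => l len0.
have maxN (r : R) : Num.max r 0 = r + Num.max (- r) 0.
  by case: (leP 0 r) => hr; case: (leP 0 (- r)) => hr'; lra.
rewrite (maxN (c + K)) (maxN (c - K)) opprB.
move: (Num.max (- (c + K)) 0) (Num.max (K - c) 0) => m1 m2 U1 U2 W1 W2.
by rewrite ler_norml; apply/andP; split; lra.
Qed.

Lemma Rintegral_majorant f (D N : set (measurableTypeR R)) psi e :
  measurable D -> measurable N -> mu N = 0%E -> measurable_fun D psi ->
  (forall z, 0 <= psi z)%E -> (forall z, D z -> ~ N z -> (`|f z|%:E <= psi z)%E) ->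
  (\int[mu]_(z in D) psi z <= e%:E)%E -> `|\int[mu]_(z in D) f z| <= e.
Proof.
move=> mD mN N0 mpsi psi0 fpsi Ie.
have main g : (forall z, 0 <= g z)%E -> (forall z, g z <= `|f z|%:E)%E ->
    (0 <= \int[mu]_(z in D) g z <= e%:E)%E.
  move=> g0 gf; rewrite integral_ge0//=; apply: le_trans Ie.
  apply: (@le_ae_nonneg_integral _ _ _ _ _ _ _ N) => // z Dz Nz.
  exact: le_trans (gf z) (fpsi z Dz Nz).
set U := (\int[mu]_(z in D) (EFin \o f)^\+ z)%E.
set W := (\int[mu]_(z in D) (EFin \o f)^\- z)%E.
have /andP[U0 U1] : (0 <= U <= e%:E)%E.
  by apply: main => // z; rewrite funeposE ge_max/= !lee_fin ler_norm normr_ge0.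
have /andP[W0 W1] : (0 <= W <= e%:E)%E.
  by apply: main => // z; rewrite funenegE ge_max/= !lee_fin -normrN ler_norm normr_ge0.
have Ufin : U \is a fin_num by rewrite ge0_fin_numE//; apply: le_lt_trans U1 _; rewrite ltry.
have Wfin : W \is a fin_num by rewrite ge0_fin_numE//; apply: le_lt_trans W1 _; rewrite ltry.
rewrite /Rintegral integralE -/U -/W fineB//.
move: U0 U1 W0 W1; rewrite -(fineK Ufin) -(fineK Wfin) !lee_fin/= => U0 U1 W0 W1.
by rewrite ler_norml; apply/andP; split; lra.
Qed.

End IntegralBounds.

Section SourceCoefficients.
Context {R : realType} {V : set R} {gamma : R} {F : map_family R}.
Hypothesis HF : standing_assumptions V gamma F.
Implicit Types (f g w : R -> R) (x y z t B K E : R) (i n k M : nat).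

Let V0 := V_0 HF.

Local Notation G n := (g_word F n 0).
Local Notation G1 n := (dg_word F n 0).
Local Notation G2 n := (dern Delta 2 (g_word F n 0)).
Local Notation h := (hhat F 0).
Local Notation h' := (der Delta (hhat F 0)).
Local Notation a n := (a_word F n).
Local Notation b n := (dern Delta 1 (pd (g_word F n) 0)).
Local Notation endpoint := (@endpoint R F).
Local Notation source_term := (@source_term R F).
Local Notation source := (@source R F).

Context {s : nat -> R} {rho D : R}.
Hypothesis ES : expanding_system (fun n => G n) (fun n => G1 n) (fun n => G2 n) s rho D.

Let s0 := es_s_ge0 ES.
Let cs := es_s_cvg ES.
Let D0 := es_D ES.

Lemma G1_pos n x : Delta x -> 0 < G1 n x.
Proof.
move=> Dx; have m1 : 2^-1 < (3 / 4 : R) < 1 by lra.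
have gm := gd1_gt0_open HF n m1; rewrite -(dg_wordE HF n V0 (open_Delta m1)) in gm.
have := es_distortion ES n (open_Delta m1) Dx.
by move/(lt_le_trans gm); rewrite pmulr_rgt0 ?expR_gt0.
Qed.

(** Both exponentials of [D * `|x - y|] and of its opposite differ from 1 by at
    most [D * expR D * `|x - y|], the distance being at most 1. *)
Lemma G1_ratio n x y : Delta x -> Delta y ->
  `|G1 n x / G1 n y - 1| <= D * expR D * `|x - y|.
Proof.
move=> Dx Dy; have gx := G1_pos n Dx; have gy := G1_pos n Dy.
have d1 := Delta_dist Dx Dy.
have eb : expR (D * `|x - y|) - 1 <= D * expR D * `|x - y|.
  apply: (le_trans (expR_sub1_le _)); rewrite mulrAC ler_wpM2r// ler_wpM2l//.
  by rewrite ler_expR ler_piMr.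
have A := es_distortion ES n Dx Dy; have B := es_distortion ES n Dy Dx.
rewrite distrC in B.
have {}A : G1 n x / G1 n y <= expR (D * `|x - y|) by rewrite ler_pdivrMr.
have {}B : expR (- (D * `|x - y|)) <= G1 n x / G1 n y.
  by rewrite ler_pdivlMr// expRN mulrC ler_pdivrMr ?expR_gt0// mulrC.
rewrite ler_norml; apply/andP; split; last by lra.
have := expR_ge1Dx (- (D * `|x - y|)).
have : D * `|x - y| <= D * expR D * `|x - y|.
  by rewrite ler_wpM2r// ler_peMr// -[leLHS]expR0 ler_expR.
lra.
Qed.

Lemma G_mvt n x y : Delta x -> Delta y -> x < y ->
  exists z, [/\ Delta z, x <= z <= y & G n y - G n x = G1 n z * (y - x)].
Proof.
move=> Dx Dy xy.
have sub z : `[x, y]%classic z -> Delta z.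
  move: Dx Dy => /DeltaP/andP[? ?] /DeltaP/andP[? ?]; rewrite /= in_itv/= => ?.
  by apply/DeltaP; lra.
have der z : `[x, y]%classic z -> has_der `[x, y]%classic (G n) z (G1 n z).
  move=> xyz; rewrite (dg_wordE HF n V0 (sub _ xyz)).
  apply: has_der_subset (word_has_der0 HF n V0 (sub _ xyz)).
  by exists 1 => // u /sub.
have xI : `[x, y]%classic x by rewrite /= in_itv/= lexx ltW.
have yI : `[x, y]%classic y by rewrite /= in_itv/= lexx ltW.
have [z zI E] := segment_mvt der xI yI.
by exists z; split => //; exact: sub.
Qed.

Lemma word_image_segment n x y : Delta x -> Delta y -> x <= y ->
  g_word F n 0 @` `[x, y]%classic = `[G n x, G n y]%classic.
Proof.
move=> Dx Dy xy; apply/seteqP; split => z; rewrite /= in_itv/=.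
  move=> [t]; rewrite in_itv/= => /andP[xt ty] <-.
  have It : t \in `[0, 1].
    move: Dx Dy => /DeltaP/andP[? ?] /DeltaP/andP[? ?]; rewrite in_itv/=; lra.
  by rewrite !(g_word_le HF)//; exact: Delta_in01.
move=> zI; have Gle : G n x <= G n y by case/andP: zI; exact: le_trans.
have [||t tI <-] := @IVT R (g_word F n 0) x y z xy.
- apply: continuous_subspaceW (@g_word_continuous _ _ _ _ HF n 0 V0) => t.
  move: Dx Dy => /DeltaP/andP[? ?] /DeltaP/andP[? ?]; rewrite /I01/= !in_itv/=; lra.
- by rewrite min_l// max_r.
- by exists t.
Qed.

(** On the image of the cell the integrand is close to the source term divided
    by the ratio of the length of the image to that of the cell. This ratio is
    the value of [G1 n] at some point of the cell, and bounded distortion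
    compares it with the other values of [G1 n] on the cell. *)
Lemma coef_term_close : exists K : nat -> R, [/\ forall n, 0 <= K n, cvgn (series K) &
  forall n M i x zeta, (0 < M)%N -> (i < M)%N -> cell M i x ->
    (g_word F n 0 @` cell M i) zeta ->
    `|(mesh M)^-1 * (\int[mu]_(z in g_word F n 0 @` cell M i)
      (A0 F z * h' zeta + B0 F z * h zeta)) - source_term n x| <= K n * mesh M].
Proof.
have [Kh Kh0 hK] := hhat_lipschitz HF ES; have [Bh Bh0 hB] := hhat_bounded HF ES.
have [Kv Kv0 vK] := hhat_der_lipschitz HF ES; have [Bv Bv0 vB] := hhat_der_bounded HF ES.
have [Ca Ca0 aC] := a_word_bounded HF.
have [p1 [p10 cp1 Hp1]] := pd_word_bound HF (isT : 1 <= 1 <= 2)%N.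
have [p2 [p20 cp2 Hp2]] := pd_word_bound HF (isT : 1 <= 2 <= 2)%N.
pose P := total_sum p1; have P0 : 0 <= P by exact: total_sum_ge0.
pose La := D * expR D; have La0 : 0 <= La by rewrite mulr_ge0// expR_ge0.
have b1 n : bounded_by (p1 n) (b n) by move=> x; exact: Hp1.
have bL n : lipschitz_by (p2 n) (b n).
  by apply: (b_word_lipschitz HF) => x; exact: Hp2.
have aB n : bounded_by Ca (a n) by move=> x /Delta_I01; exact: aC.
have aL n : lipschitz_by P (a n).
  move=> x y Dx Dy; apply: (le_trans (a_word_lipschitz HF (b1 n) Dx Dy)).
  by rewrite ler_wpM2r// term_le_total.
exists (fun n => (Ca * Bv + P * Bv + Ca * Kv) * s n +
  ((Bh * La + Kh) * p1 n + Bh * p2 n)); split.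
- by move=> n; rewrite !addr_ge0// mulr_ge0// !addr_ge0// mulr_ge0.
- apply: cvg_seriesD; first exact: cvg_seriesZ.
  by apply: cvg_seriesD; exact: cvg_seriesZ.
move=> n M i x zeta M0 iM xc zetac.
have [x' x'c zE] := zetac.
have m0 := @mesh_gt0 R _ M0; have Dx := cell_Delta iM xc; have Dx' := cell_Delta iM x'c.
have D1 := @node_Delta R _ _ (ltnW iM); have D2 := @node_Delta R _ _ iM.
have cellm y y' : cell M i y -> cell M i y' -> `|y - y'| <= mesh M.
  by move=> /cellP ? /cellP ?; rewrite ler_norml; lra.
have n12 : node M i < node M i.+1 :> R by rewrite nodeS ltrDl.
rewrite /cell (word_image_segment n D1 D2 (ltW n12)).
have [xi [Dxi xic lE]] := G_mvt n D1 D2 n12.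
rewrite nodeS in xic; move/cellP: xic => xic.
have gxi := G1_pos n Dxi.
have Dzeta : Delta zeta by rewrite -zE; exact: (word_Delta HF).
pose f z := A0 F z * h' zeta + B0 F z * h zeta.
set T := source_term n x.
have l0 : G n (node M i) < G n (node M i.+1).
  by apply: (g_word_increasing HF) => //; exact: Delta_in01.
have mE : G n (node M i.+1) - G n (node M i) = G1 n xi * mesh M.
  by rewrite lE nodeS addrAC subrr add0r.
pose Kn := (Ca * Bv + P * Bv + Ca * Kv) * s n + ((Bh * La + Kh) * p1 n + Bh * p2 n).
rewrite -/Kn; have key z : G n (node M i) < z < G n (node M i.+1) ->
    `|f z - T / G1 n xi| <= Kn * mesh M / G1 n xi.
  move=> zI.
  have : (`[G n (node M i), G n (node M i.+1)]%classic : set R) z.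
    by rewrite /= in_itv/=; case/andP: zI => /ltW -> /ltW ->.
  rewrite -(word_image_segment n D1 D2 (ltW n12)) => -[y yc yz].
  have Dy := cell_Delta iM yc.
  have yI : 2^-1 < y < 1.
    have Gy u v : Delta u -> Delta v -> G n u < G n v -> u < v.
      move=> Du Dv; apply: contraTT; rewrite -!leNgt => vu.
      by apply: (g_word_le HF) => //; exact: Delta_in01.
    move: zI; rewrite -yz => /andP[/(Gy _ _ D1 Dy) y1 /(Gy _ _ Dy D2) y2].
    by move: D1 D2 => /DeltaP/andP[? _] /DeltaP/andP[_ ?]; apply/andP; split; lra.
  have gy := G1_pos n Dy; have gx := G1_pos n Dx.
  have -> : f z = a n y * h' zeta + b n y / G1 n y * h zeta.
    rewrite /f -yz (A0_word HF n yI) -(B0_word HF n yI) -(dg_wordE HF n V0 Dy).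
    by rewrite mulfK// gt_eqF.
  rewrite -(ler_pM2r gxi) -[X in _ * X <= _](gtr0_norm gxi) -normrM divfK ?gt_eqF//.
  set v' := h' zeta; pose v := h' (G n x).
  pose r := G1 n xi / G1 n y.
  have -> : (a n y * v' + b n y / G1 n y * h zeta - T / G1 n xi) * G1 n xi =
    ((a n y * v' * (G1 n xi - G1 n x) + (a n y - a n x) * v' * G1 n x) +
      a n x * (v' - v) * G1 n x) +
    ((b n y * h zeta * (r - 1) + b n y * (h zeta - h (G n x))) +
      (b n y - b n x) * h (G n x)).
    have TE : T = v * (a n x * G1 n x) + h (G n x) * b n x by [].
    rewrite TE /r; move: gxi gy; clear TE r; move: v' v (h zeta) (h (G n x)) (a n x) (a n y) (b n x) (b n y).
    move: (G1 n xi) (G1 n y) (G1 n x) => A B C A0 B0 v' v hz hx ax ay bx b_y.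
    by field; rewrite !gt_eqF.
  have DGx := word_Delta HF n Dx.
  have hzeta : `|h zeta - h (G n x)| <= Kh * mesh M.
    rewrite -zE; apply: (le_trans (@comp_word_lipschitz _ _ _ _ HF _ _ _ ES h n Kh Kh0 hK x' x Dx' Dx)).
    by rewrite ler_wpM2l//; exact: cellm.
  have vzeta : `|v' - v| <= Kv * mesh M.
    rewrite /v' -zE; apply: (le_trans (@comp_word_lipschitz _ _ _ _ HF _ _ _ ES h' n Kv Kv0 vK x' x Dx' Dx)).
    by rewrite ler_wpM2l//; exact: cellm.
  have t1 : `|a n y * v' * (G1 n xi - G1 n x)| <= Ca * Bv * (s n * mesh M).
    rewrite !normrM ler_pM ?mulr_ge0 ?ler_pM//; [exact: aB|exact: vB|].
    apply: (le_trans (es_G1_lip ES n Dxi Dx)); rewrite ler_wpM2l//; exact: cellm.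
  have t2 : `|(a n y - a n x) * v' * G1 n x| <= P * mesh M * Bv * s n.
    rewrite !normrM !ler_pM ?mulr_ge0//; [|exact: vB|exact: (normr_G1 ES)].
    apply: (le_trans (@aL n y x Dy Dx)); rewrite ler_wpM2l//; exact: cellm.
  have t3 : `|a n x * (v' - v) * G1 n x| <= Ca * (Kv * mesh M) * s n.
    by rewrite !normrM !ler_pM ?mulr_ge0//; [exact: aB|exact: (normr_G1 ES)].
  have t4 : `|b n y * h zeta * (r - 1)| <= p1 n * Bh * (La * mesh M).
    rewrite !normrM !ler_pM ?mulr_ge0//; [exact: b1|exact: hB|].
    apply: (le_trans (G1_ratio n Dxi Dy)); rewrite ler_wpM2l//; exact: cellm.
  have t5 : `|b n y * (h zeta - h (G n x))| <= p1 n * (Kh * mesh M).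
    by rewrite !normrM !ler_pM//; exact: b1.
  have t6 : `|(b n y - b n x) * h (G n x)| <= p2 n * mesh M * Bh.
    rewrite !normrM !ler_pM//; last exact: hB.
    apply: (le_trans (@bL n y x Dy Dx)); rewrite ler_wpM2l//; exact: cellm.
  have tri (u1 u2 u3 u4 u5 u6 : R) : `|((u1 + u2) + u3) + ((u4 + u5) + u6)| <=
      ((`|u1| + `|u2|) + `|u3|) + ((`|u4| + `|u5|) + `|u6|).
    by do ![apply: (le_trans (ler_normD _ _)); apply: lerD => //].
  apply: (le_trans (tri _ _ _ _ _ _)).
  apply: (le_trans (lerD (lerD (lerD t1 t2) t3) (lerD (lerD t4 t5) t6))).
  by rewrite /Kn le_eqVlt; apply/orP; left; apply/eqP; ring.
have := Rintegral_segment_bound l0 key; rewrite mE.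
have -> : T / G1 n xi * (G1 n xi * mesh M) = T * mesh M by field; rewrite gt_eqF.
have -> : Kn * mesh M / G1 n xi * (G1 n xi * mesh M) = Kn * mesh M * mesh M.
  by field; rewrite gt_eqF.
set I := Rintegral _ _ _ => HI.
rewrite -(ler_pM2r m0) -[X in _ * X <= _](gtr0_norm m0) -normrM.
by rewrite mulrBl mulrAC mulVf ?gt_eqF// mul1r.
Qed.

End SourceCoefficients.

(** * The discretized source is close to the source *)

Section SourceDiscretization.
Context {R : realType} {V : set R} {gamma : R} {F : map_family R}.
Hypothesis HF : standing_assumptions V gamma F.
Implicit Types (f g w : R -> R) (x y z t B K E : R) (i n k M : nat).

Let V0 := V_0 HF.

Local Notation G n := (g_word F n 0).
Local Notation G1 n := (dg_word F n 0).
Local Notation G2 n := (dern Delta 2 (g_word F n 0)).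
Local Notation h := (hhat F 0).
Local Notation h' := (der Delta (hhat F 0)).
Local Notation b n := (dern Delta 1 (pd (g_word F n) 0)).
Local Notation endpoint := (@endpoint R F).
Local Notation source_term := (@source_term R F).
Local Notation source := (@source R F).

Context {s : nat -> R} {rho D : R}.
Hypothesis ES : expanding_system (fun n => G n) (fun n => G1 n) (fun n => G2 n) s rho D.

Let s0 := es_s_ge0 ES.
Let cs := es_s_cvg ES.
Let D0 := es_D ES.

Lemma affine_image_cell k M i : (0 < M)%N ->
  affine_branch F k @` cell M i =
    `[affine_branch F k (node M i), affine_branch F k (node M i.+1)]%classic.
Proof.
move=> M0; have d0 : 0 < delta F k by rewrite (deltaE HF) subr_gt0 (endpoint_gt HF).
apply/seteqP; split => z; rewrite /cell /affine_branch /= !in_itv/=.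
  move=> [x]; rewrite in_itv/= => /andP[x1 x2] <-.
  by rewrite !lerD2r !ler_wpM2l// ?(ltW d0)//; lra.
pose t := (z - 2^-1) / delta F k.
have zE : z = delta F k * t + 2^-1 by rewrite /t mulrC divfK ?gt_eqF// subrK.
rewrite zE !lerD2r !ler_pM2l// => /andP[z1 z2]; exists ((t + 1) / 2); last by field.
by rewrite in_itv/=; lra.
Qed.

Lemma endpoint_length n : endpoint n - endpoint n.+1 <= expR D * G1 n 1.
Proof.
have Dh : Delta (2^-1 : R) by apply/DeltaP; lra.
have h1 : (2^-1 : R) < 1 by lra.
have [z [Dz _ E]] := G_mvt HF n Dh (@Delta1 R) h1.
rewrite -(g_word_half HF) E; have g0 := G1_pos HF ES n Dz.
have := es_distortion ES n Dz (@Delta1 R).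
have : expR (D * `|z - 1|) * G1 n 1 <= expR D * G1 n 1.
  rewrite ler_wpM2r ?(ltW (G1_pos HF ES n (@Delta1 R)))// ler_expR ler_piMr//.
  exact: Delta_dist Dz (@Delta1 R).
lra.
Qed.

(** In [Q n] the division by [G1 n 1] comes from [B0]; it is compensated by the
    length of the cylinder, which is comparable to [G1 n 1]. *)
Lemma source_density_bound : exists Q r : nat -> R,
  [/\ (forall n, 0 <= Q n) /\ (forall n, 0 <= r n), cvgn (series r),
      forall n, Q n * (endpoint n - endpoint n.+1) <= r n &
      forall n z, endpoint n.+1 < z < endpoint n ->
        `|A0 F z * h' z + B0 F z * h z| <= Q n].
Proof.
have [Bh Bh0 hB] := hhat_bounded HF ES; have [Bv Bv0 vB] := hhat_der_bounded HF ES.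
have [Ca Ca0 aC] := a_word_bounded HF.
have [p1 [p10 cp1 Hp1]] := pd_word_bound HF (isT : 1 <= 1 <= 2)%N.
have g1 n : 0 < G1 n 1 := G1_pos HF ES n (@Delta1 R).
have e0 : 0 <= expR D by exact: expR_ge0.
have eg n : 0 <= expR D / G1 n 1 by rewrite divr_ge0// ltW.
exists (fun n => Ca * Bv + p1 n * (expR D / G1 n 1) * Bh).
exists (fun n => (Ca * Bv * expR D) * s n + (expR D * expR D * Bh) * p1 n); split.
- split => n; last by rewrite addr_ge0// !mulr_ge0.
  by rewrite addr_ge0// mulr_ge0// mulr_ge0.
- by apply: cvg_seriesD; exact: cvg_seriesZ.
- move=> n; have len := endpoint_length n.
  have c0 : 0 <= Ca * Bv + p1 n * (expR D / G1 n 1) * Bh.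
    by rewrite addr_ge0// mulr_ge0// mulr_ge0.
  apply: (le_trans (ler_wpM2l c0 len)); rewrite mulrDl.
  apply: lerD.
    by rewrite !mulrA ler_wpM2l ?mulr_ge0//; exact: (es_G1_s ES n (@Delta1 R)).
  rewrite le_eqVlt; apply/orP; left; apply/eqP.
  by field; rewrite gt_eqF.
- move=> n z /(g_word_surj_open HF)[y yI yz]; have Dy := open_Delta yI.
  have gy := G1_pos HF ES n Dy.
  have Dz : Delta z by rewrite -yz; exact: (word_Delta HF).
  have -> : A0 F z * h' z + B0 F z * h z =
      a_word F n y * h' z + b n y / G1 n y * h z.
    rewrite -yz (A0_word HF n yI) -(B0_word HF n yI) -(dg_wordE HF n V0 Dy).
    by rewrite mulfK// gt_eqF.
  apply: (le_trans (ler_normD _ _)); rewrite !normrM normfV (gtr0_norm gy).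
  apply: lerD; apply: ler_pM => //; rewrite ?mulr_ge0 ?invr_ge0 ?(ltW gy)//.
  + exact/aC/Delta_I01.
  + exact: vB.
  + apply: ler_pM; rewrite ?invr_ge0 ?(ltW gy)//; first exact: Hp1.
    rewrite ler_pdivlMr// mulrC ler_pdivrMr//.
    apply: (le_trans (es_distortion ES n (@Delta1 R) Dy)).
    rewrite ler_wpM2r ?(ltW gy)// ler_expR ler_piMr//.
    exact: Delta_dist (@Delta1 R) Dy.
  + exact: hB.
Qed.

(** The segment meets only the cylinders of index at least [k]. The integrand
    may be unbounded near [1/2], but a majorant that is constant on each
    cylinder has a convergent series of integrals. *)
Lemma affine_term_small : exists r : nat -> R,
  [/\ forall n, 0 <= r n, cvgn (series r) & forall k M i, (0 < M)%N -> (i < M)%N ->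
    `|\int[mu]_(z in affine_branch F k @` cell M i) (A0 F z * h' z + B0 F z * h z)|
      <= tail r k].
Proof.
have [Q [r [[Q0 r0] cr Qr HQ]]] := source_density_bound.
exists r; split => // k M i M0 iM; rewrite affine_image_cell//.
set al := affine_branch F k _; set be := affine_branch F k _.
have alh : 2^-1 <= al.
  have /DeltaP/andP[H _] := affine_branch_Delta HF k (@node_Delta R _ _ (ltnW iM)).
  exact: H.
have bek : be <= endpoint k.
  have /DeltaP/andP[_ H] := @node_Delta R _ _ iM.
  have d0 := delta_ge0 HF k; rewrite /be /affine_branch.
  have : delta F k * (2 * node M i.+1 - 1) <= delta F k * 1 by rewrite ler_wpM2l//; lra.
  by rewrite mulr1 (deltaE HF); lra.
pose U n : set (measurableTypeR R) := `]endpoint n.+1, endpoint n[%classic.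
pose J : set (measurableTypeR R) := `[al, be]%classic.
have mU n : measurable (U n) by exact: measurable_itv.
have mJ : measurable J by exact: measurable_itv.
pose c n : R := if (n < k)%N then 0 else Q n.
have c0 n : 0 <= c n by rewrite /c; case: ifP.
pose psi (z : R) : \bar R := (\sum_(0 <= n <oo) (c n * \1_(U n) z)%:E)%E.
have t0 n z : (0 <= (c n * \1_(U n) z)%:E)%E by rewrite lee_fin mulr_ge0// indicE ler0n.
have mt n : measurable_fun J (fun z => (c n * \1_(U n) z)%:E).
  by apply/measurable_EFinP; apply: measurable_funM => //; exact: measurable_indic.
pose pt n : R := if n is m.+1 then endpoint m else 2^-1.
pose N : set (measurableTypeR R) := \bigcup_n [set pt n].
apply: (@Rintegral_majorant _ _ _ N psi) => //.
- by apply: bigcupT_measurable => n; exact: measurable_set1.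
- by rewrite /mu; apply: countable_lebesgue_measure0; exact: bigcup_countable.
- by apply: (@ge0_emeasurable_sum _ _ _ _ _ xpredT) => // n z _ _.
- by move=> z; apply: nneseries_ge0.
- move=> z; rewrite /J/= in_itv/= => /andP[zal zbe] zN.
  have zI : 2^-1 < z <= endpoint k.
    rewrite (le_trans zbe bek) andbT lt_neqAle (le_trans alh zal) andbT eq_sym.
    by apply/eqP => zh; apply: zN; exists 0%N.
  have [n [kn /andP[z1 z2]]] := endpoint_locate HF zI.
  have zU : endpoint n.+1 < z < endpoint n.
    rewrite z1 lt_neqAle z2 andbT; by apply/eqP => E; apply: zN; exists n.+1.
  apply: (@le_trans _ _ (Q n)%:E); first by rewrite lee_fin; exact: HQ.
  apply: le_trans (nneseries_lim_ge n.+1 (fun m _ _ => t0 m z)).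
  rewrite big_nat_recr//=.
  have -> : (c n * \1_(U n) z)%:E = (Q n)%:E.
    by rewrite /c ltnNge kn indicE mem_set ?mulr1.
  by apply: leeDr; apply: sume_ge0 => m _.
- rewrite integral_nneseries//.
  rewrite -nneseries_tail//; apply: lee_nneseries => n _.
    by move=> _; apply: integral_ge0 => z _.
  under eq_integral do rewrite EFinM.
  rewrite ge0_integralZl ?lee_fin//; last first.
    by apply/measurable_EFinP; exact: measurable_indic.
  rewrite integral_indic//.
  apply: (@le_trans _ _ ((c n)%:E * mu (U n))%E).
    apply: lee_wpmul2l; first by rewrite lee_fin.
    by apply: le_measure; rewrite ?inE ?subIsetl//; exact: measurableI.
  rewrite /mu /U lebesgue_measure_itv/= lte_fin (endpointS HF) -EFinB -EFinM lee_fin.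
  by rewrite /c; case: ifP => _; [rewrite mul0r|exact: Qr].
Qed.

(** The factor [(mesh M)^-1] in front of the integral over the image of the
    affine branch is the reason for a tail of the order of [mesh M ^+ 2]. *)
Lemma coef_close : exists (C : R) (r : nat -> R),
  [/\ 0 <= C, forall n, 0 <= r n, cvgn (series r) &
   forall M k zeta, (0 < M)%N -> tail r k <= mesh M ^+ 2 -> admissible F M k zeta ->
    forall i x, (i < M)%N -> cell M i x ->
      `|coef F M k h zeta i - source x| <= C * mesh M].
Proof.
have [Bs [_ [[Bs0 _] cB _ HB _]]] := source_regular HF ES.
have [K [K0 cK HK]] := coef_term_close HF ES.
have [r [r0 cr Hr]] := affine_term_small.
have c' : cvgn (series (fun n => r n + Bs n)) by exact: cvg_seriesD.
exists (total_sum K + 2), (fun n => r n + Bs n); split => //.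
- by rewrite addr_ge0// total_sum_ge0.
- by move=> n; rewrite addr_ge0.
move=> M k zeta M0 tk adm i x iM xc.
have m0 := @mesh_gt0 R _ M0; have Dx := cell_Delta iM xc.
have m1 : mesh M ^+ 2 <= mesh M :> R.
  rewrite expr2 ler_piMl ?(ltW m0)// /mesh invf_le1 ?mulr_gt0 ?ltr0n//.
  by rewrite -natrM ler1n muln_gt0 M0.
have tr : tail r k <= mesh M ^+ 2.
  by apply: le_trans tk; apply: tail_le => // n; rewrite lerDl.
have tB : tail Bs k <= mesh M.
  apply: le_trans m1; apply: le_trans tk; apply: tail_le => // n; rewrite lerDr//.
rewrite /coef.
pose I2 : R := \int[mu]_(z in affine_branch F k @` cell M i) (A0 F z * h' z + B0 F z * h z).
rewrite -/I2.
have I2b : `|(mesh M)^-1 * I2| <= mesh M.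
  rewrite normrM mulrC normfV (gtr0_norm m0) ler_pdivrMr// -expr2.
  exact: le_trans (Hr k M i M0 iM) tr.
rewrite (_ : _ - _ =
  \sum_(n < k) ((mesh M)^-1 * (\int[mu]_(z in g_word F n 0 @` cell M i)
      (A0 F z * h' (zeta n i) + B0 F z * h (zeta n i))) - source_term n x)
  + (mesh M)^-1 * I2 - (source x - partial_sum k (fun n => source_term n x))); last first.
  by rewrite sumrB /partial_sum; ring.
apply: (le_trans (ler_normB _ _)); rewrite mulrDl.
have S1 : `|source x - partial_sum k (fun n => source_term n x)| <= mesh M.
  by apply: le_trans tB; apply: tail_dominated => // n; exact: HB.
have S2 : `|\sum_(n < k) ((mesh M)^-1 * (\int[mu]_(z in g_word F n 0 @` cell M i)
      (A0 F z * h' (zeta n i) + B0 F z * h (zeta n i))) - source_term n x)|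
    <= total_sum K * mesh M.
  apply: (le_trans (ler_norm_sum _ _ _)).
  apply: (@le_trans _ _ (partial_sum k K * mesh M)); last first.
    by rewrite ler_wpM2r ?(ltW m0)// partial_sum_le_total.
  rewrite /partial_sum mulr_suml; apply: ler_sum => n _.
  exact: HK (adm _ _ (ltn_ord n) iM).
apply: (le_trans (lerD (ler_normD _ _) S1)).
by have := lerD S2 I2b; lra.
Qed.

Definition Wh_coef (c : nat -> R) M j : R :=
  if j == 0%N then c 0%N else if j == M then c M.-1 else (c j.-1 + c j) / 2.

Lemma Wh_hat_sum M k zeta x : (0 < M)%N ->
  Wh F M k h zeta x = hat_sum M (Wh_coef (coef F M k h zeta) M) x.
Proof.
move=> M0; rewrite /Wh /hat_sum; set c := coef F M k h zeta.
rewrite -(big_mkord xpredT (fun j => Wh_coef c M j * hat M j x)).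
rewrite [RHS]big_nat_recr//= [X in _ = X + _]big_ltn//=.
rewrite {1}/Wh_coef eqxx {2}/Wh_coef eqxx (gtn_eqF M0); congr (_ + _ + _).
apply: eq_big_nat => j /andP[j0 jM].
by rewrite /Wh_coef (gtn_eqF j0) (ltn_eqF jM).
Qed.

Lemma Wh_continuous M k zeta : (0 < M)%N -> {within Delta, continuous (Wh F M k h zeta)}.
Proof.
move=> M0; rewrite (_ : Wh F M k h zeta = hat_sum M (Wh_coef (coef F M k h zeta) M)).
  exact: hat_sum_continuous.
by apply/funext => x; exact: Wh_hat_sum.
Qed.

Lemma Wh_close : exists (C : R) (r : nat -> R),
  [/\ 0 <= C, forall n, 0 <= r n, cvgn (series r) &
   forall M k zeta, (0 < M)%N -> tail r k <= mesh M ^+ 2 -> admissible F M k zeta ->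
    forall x, Delta x -> `|Wh F M k h zeta x - source x| <= C * mesh M].
Proof.
have [C [r [C0 r0 cr HC]]] := coef_close.
have [Kw Kw0 wK] := source_lipschitz HF ES.
exists (C + Kw), r; split => //; first by rewrite addr_ge0.
move=> M k zeta M0 tk adm x Dx; rewrite Wh_hat_sum//.
have m0 := @mesh_gt0 R _ M0.
have left i : (i < M)%N -> `|coef F M k h zeta i - source (node M i)| <= C * mesh M.
  by move=> iM; apply: HC => //; apply/cellP; rewrite lexx lerDl ltW.
have right i : (i < M)%N -> `|coef F M k h zeta i - source (node M i.+1)| <= C * mesh M.
  by move=> iM; apply: HC => //; apply/cellP; rewrite nodeS lexx lerDl ltW.
apply: hat_sum_near => // i iM xi.
have Di := @node_Delta R _ _ iM.
apply: (le_trans (ler_distD (source (node M i)) _ _)); rewrite mulrDl.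
apply: lerD; last first.
  by apply: (le_trans (wK _ _ Di Dx)); rewrite distrC ler_wpM2l.
rewrite /Wh_coef; have [->|i0] := eqVneq i 0%N; first exact: left.
have [->|iM'] := eqVneq i M.
  by have := right M.-1; rewrite prednK//; apply.
have lt : (i < M)%N by rewrite ltn_neqAle iM'.
have A := left i lt; have := right i.-1; rewrite prednK ?lt0n// => B.
have {}B := B (leq_trans (leqnSn _) lt).
set u := source (node M i) in A B *.
rewrite (_ : _ - u = ((coef F M k h zeta i.-1 - u) + (coef F M k h zeta i - u)) / 2); last by field.
rewrite normrM (ger0_norm (_ : 0 <= 2^-1))// ler_pdivrMr//.
by apply: (le_trans (ler_normD _ _)); lra.
Qed.

End SourceDiscretization.

(** * From the induced response to the response *)

Section PowerIntegral.
Context {R : realType}.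
Implicit Types (x t : R) (n : nat).

(** The substitution [x = t ^ N] with a large [N] removes the singularity. *)
Lemma powRN_integrable (g : R) : 0 < g < 1 -> exists2 C : R, 0 <= C &
  (\int[mu]_(x in `]0%R, 1%R]) (x `^ (- g))%:E <= C%:E)%E.
Proof.
move=> /andP[g0 g1]; have B0 : 0 < 1 - g by rewrite subr_gt0.
have [N HN] : exists N : nat, (1 - g)^-1 <= N.+1%:R.
  exists (Num.bound (1 - g)^-1); have B1 : 0 <= (1 - g)^-1 by rewrite invr_ge0 ltW.
  by apply: (le_trans (ltW (archi_boundP B1))); rewrite ler_nat.
have {}HN : 1 <= N.+1%:R * (1 - g) by rewrite -ler_pdivrMr// mul1r.
pose p t : R := t ^+ N.+1; pose d t : R := N.+1%:R * t ^+ N.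
exists N.+1%:R => //.
have pder t : is_derive t 1 p (d t).
  have := @is_deriveX R R^o id N.+1 t 1 1 (is_derive_id _ _).
  rewrite (_ : id ^+ N.+1 = p); last by apply/funext => z; rewrite /p exprfctE.
  by move=> H; apply: is_derive_eq; rewrite /GRing.scale/= mulr1.
have p0 : p 0 = 0 by rewrite /p expr0n.
have p1 : p 1 = 1 by rewrite /p expr1n.
have Epow t : 0 < t <= 1 -> (p t) `^ (- g) * d t <= N.+1%:R.
  move=> /andP[t0 t1]; rewrite /p /d mulrCA ler_piMr//.
  rewrite -!powR_mulrn ?(ltW t0)// -powRrM -powRD; last by rewrite (gt_eqF t0) implybT.
  rewrite -[leRHS](powRr0 t); apply: ger_powR; first by rewrite t0.
  by move: HN; rewrite -[N.+1]addn1 natrD; lra.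
have contT (f : R -> R) : (forall t, derivable f t 1) -> continuous f.
  by move=> df t; apply: differentiable_continuous; apply/derivable1_diffP.
have H := @ge0_change_of_variables R p d 0 1 ltr01 _ _ _ _ _ (fun x => (x `^ (- g))%:E).
rewrite p0 p1 in H; rewrite -H {H}.
- apply: (@le_trans _ _ (\int[mu]_(x in `]0%R, 1%R]) (cst N.+1%:R%:E x))%E).
    apply: le_nonneg_integral => t; rewrite /= in_itv/= => tI.
      rewrite lee_fin mulr_ge0 ?powR_ge0// /d mulr_ge0// exprn_ge0//.
      by case/andP: tI => /ltW.
    by rewrite lee_fin; exact: Epow.
  by rewrite /mu integral_cst//= lebesgue_measure_itv/= lte_fin ltr01 oppr0 adde0 mule1.
- move=> x y; rewrite !in_itv/= => /andP[x0 _] /andP[y0 _] xy.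
  by rewrite /p ltrXn2r// ?nnegrE.
- apply: continuous_subspaceT; apply: contT => t; have [] := pder t; by [].
- apply: continuous_subspaceT => t; apply: cvgM; first exact: cvg_cst.
  exact: exprn_continuous.
- by move=> x; rewrite in_itv/= => /andP[x0 _]; rewrite mulr_ge0// exprn_ge0.

- by apply/measurable_EFinP; apply: measurable_funTS; exact: measurable_powR.
- by move=> y _; rewrite lee_fin powR_ge0.
Qed.

Lemma powRN_ge1 (g x : R) : 0 <= g -> 0 < x <= 1 -> 1 <= x `^ (- g).
Proof.
by move=> g0 xI; rewrite -[leLHS](powRr0 x); apply: ger_powR => //; rewrite oppr_le0.
Qed.

End PowerIntegral.

Section FiniteRank.
Context {R : realType}.
Implicit Types (f h : R -> R) (x : R).

(** When [h] has mean 1 it is the invariant density of this operator. *)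
Lemma rank_one_operator h : L1 h -> finite_rank_operator (fun f x => mean f * h x).
Proof.
move=> h1; split.
- by move=> f f1; exact: L1Z.
- move=> c f g f1 g1; apply: aeW => x _.
  by rewrite meanD//; [rewrite meanZ//; ring|exact: L1Z].
- exists (mean (fun x => `|h x|)) => f f1.
  have := mean_EFin (L1_norm (L1Z (mean f) h1)); rewrite /mu => ->.
  have := mean_EFin (L1_norm f1); rewrite /mu => ->.
  rewrite -EFinM lee_fin.
  have -> : mean (fun x => `|mean f * h x|) = `|mean f| * mean (fun x => `|h x|).
    rewrite -(meanZ _ (L1_norm h1)); apply: eq_mean => x _.
    exact: normrM.
  have h0 : 0 <= mean (fun x => `|h x|).
    have -> : 0 = mean (fun=> 0 : R) by rewrite mean_cst mul0r.
    by apply: ler_mean => //; [exact: L1_cst|exact: L1_norm].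
  rewrite mulrC ler_wpM2l// ler_norml; apply/andP; split.
    rewrite lerNl -mulN1r -meanZ//; apply: ler_mean; [exact: L1Z|exact: L1_norm|].
    by move=> x _; rewrite mulN1r -normrN ler_norm.
  by apply: ler_mean => //; [exact: L1_norm|move=> x _; exact: ler_norm].
- exists 1%N, (fun _ => h); split => // f f1.
  by exists (fun _ => mean f); apply: aeW => x _; rewrite big_ord1.
Qed.

End FiniteRank.

Section Response.
Context {R : realType} {V : set R} {gamma : R} {F : map_family R}.
Hypothesis gamma01 : 0 < gamma < 1.
Hypothesis HF : standing_assumptions V gamma F.
Implicit Types (f g w : R -> R) (x y z t B K E : R) (i n k l M N : nat).

Let V0 := V_0 HF.

Local Notation G n := (g_word F n 0).
Local Notation G1 n := (dg_word F n 0).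
Local Notation G2 n := (dern Delta 2 (g_word F n 0)).
Local Notation L := (Lhat F).
Local Notation h := (hhat F 0).
Local Notation h' := (der Delta (hhat F 0)).
Local Notation source := (@source R F).

Context {s : nat -> R} {rho D : R}.
Hypothesis ES : expanding_system (fun n => G n) (fun n => G1 n) (fun n => G2 n) s rho D.

Local Notation q := (@cone_rate R rho D).
Local Notation u := (@potential R (fun n => G n) (fun n => G1 n) source).

Lemma g_word_in_Delta n x : I01 x -> Delta (G n x).
Proof.
by move=> Ix; apply/DeltaP; exact: (g1_range HF V0 (iter_g0_I01 HF n V0 Ix)).
Qed.

Lemma tailZ (c : R) r N : cvgn (series r) -> tail (fun n => c * r n) N = c * tail r N.
Proof.
by move=> cr; rewrite /tail total_sumZ// mulrBr /partial_sum big_distrr.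
Qed.

Lemma partial_sum_diff (v w : nat -> R) N : partial_sum N v - total_sum w =
  partial_sum N (fun n => v n - w n) - (total_sum w - partial_sum N w).
Proof. by rewrite /partial_sum sumrB; ring. Qed.

(** Outside [Delta] the terms of all the sums are bounded by summable constants
    times the inverse [x `^ (- gamma)] of the weight of the norm of [B]. *)
Lemma response_pointwise : exists (P : R) (t : nat -> R),
  [/\ 0 <= P, (forall n, 0 <= t n), cvgn (series t) &
   forall Bu hs, 0 <= Bu -> bounded_by Bu u -> forall ha e x N, 0 <= e ->
    (forall y, Delta y -> `|ha y - u y| <= e) -> 0 < x <= 1 ->
    (Delta x -> hs x = u x) -> (forall n, G1 n x != 0 -> hs (G n x) = u (G n x)) ->
    `|(F0 F (partial_sum N) ha x + Q F (partial_sum N) h x) - response F hs x| <=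
      (e * (1 + P) + (1 + Bu) * tail t N) * x `^ (- gamma)].
Proof.
have [Bh Bh0 hB] := hhat_bounded HF ES; have [Bv Bv0 vB] := hhat_der_bounded HF ES.
have [Ca Ca0 aC] := a_word_bounded HF.
have [p [p0 cp Hp]] := weighted_bound HF (sum_dg_word HF).
have [r [r0 cr Hr]] := weighted_bound HF (sum_pd_dg_word HF).
have c1 : cvgn (series (fun n => (1 + Bv * Ca) * p n)) by exact: cvg_seriesZ.
have c2 : cvgn (series (fun n => Bh * r n)) by exact: cvg_seriesZ.
pose t n : R := (1 + Bv * Ca) * p n + Bh * r n.
have t0 n : 0 <= t n by rewrite addr_ge0 ?mulr_ge0// addr_ge0// mulr_ge0.
have ct : cvgn (series t) by exact: cvg_seriesD.
have BC0 : 0 <= Bv * Ca by rewrite mulr_ge0.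
have pt n : p n <= t n.
  by rewrite /t mulrDl mul1r -addrA lerDl addr_ge0// mulr_ge0.
exists (total_sum p), t; split => //; first exact: total_sum_ge0.
move=> Bu hs Bu0 uB ha e x N e0 hae xI hsx hsG.
have [x0 x1] := andP xI; have Ix : I01 x by apply/I01P; rewrite ltW.
have [g0 _] := andP gamma01.
set w := x `^ (- gamma).
have w1 : 1 <= w by apply: powRN_ge1 => //; exact: ltW.
have w0 : 0 <= w by exact: le_trans w1.
have tN0 : 0 <= tail t N by exact: tail_ge0.
have P0 : 0 <= total_sum p by exact: total_sum_ge0.
have gN n : `|G1 n x| <= p n * w by exact: Hp.
have GD n : Delta (G n x) by exact: g_word_in_Delta.
rewrite /response /F0 /Q; have [Dx|nDx] := pselect (Delta x).
  rewrite indicE mem_set// subrr !mul0r !addr0 !mul1r hsx//.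
  apply: (le_trans (hae x Dx)); rewrite -[leLHS]mulr1 ler_pM//.
  rewrite mulrDr mulr1 -addrA lerDl addr_ge0// mulr_ge0// addr_ge0//.
rewrite indicE memNset// subr0 !mul0r !add0r !mul1r.
set U := fun n => ha (G n x) * G1 n x.
set H := fun n => hs (G n x) * G1 n x.
set q' := fun n => h' (G n x) * (a_word F n x * G1 n x) + h (G n x) * b_word F n x.
have HE : H = fun n => u (G n x) * G1 n x.
  apply/funext => n; rewrite /H; have [->|gn] := eqVneq (G1 n x) 0; first by rewrite !mulr0.
  by rewrite hsG.
have Hb n : `|H n| <= Bu * w * t n.
  rewrite HE normrM -mulrA [w * _]mulrC; apply: ler_pM => //; first exact: uB.
  by apply: (le_trans (gN n)); rewrite ler_wpM2r.
have qb n : `|q' n| <= w * t n.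
  rewrite /q' /t; apply: (le_trans (ler_normD _ _)); rewrite !normrM.
  have A : `|h' (G n x)| * (`|a_word F n x| * `|G1 n x|) <= Bv * (Ca * (p n * w)).
    apply: ler_pM; rewrite ?mulr_ge0 ?normr_ge0//; first exact: vB.
    by apply: ler_pM => //; exact: aC.
  have C : `|h (G n x)| * `|b_word F n x| <= Bh * (r n * w).
    by apply: ler_pM => //; [exact: hB|exact: Hr].
  by apply: (le_trans (lerD A C)); have := mulr_ge0 w0 (p0 n); lra.
have cwt c : cvgn (series (fun n => c * t n)) by exact: cvg_seriesZ.
rewrite opprD addrACA; apply: (le_trans (ler_normD _ _)).
have T1 : `|partial_sum N U - total_sum H| <= e * total_sum p * w + Bu * w * tail t N.
  rewrite partial_sum_diff; apply: (le_trans (ler_normB _ _)); apply: lerD; last first.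
    by rewrite -tailZ//; apply: tail_dominated.
  apply: (le_trans (ler_norm_sum _ _ _)).
  apply: (@le_trans _ _ (e * partial_sum N p * w)); last first.
    by rewrite ler_wpM2r// ler_wpM2l// partial_sum_le_total.
  rewrite /partial_sum mulr_sumr mulr_suml; apply: ler_sum => n _.
  rewrite HE /U -mulrBl normrM -mulrA; apply: ler_pM => //.
  exact: hae.
have T2 : `|partial_sum N q' - total_sum q'| <= w * tail t N.
  by rewrite distrC -tailZ//; apply: tail_dominated.
apply: (le_trans (lerD T1 T2)).
by have := mulr_ge0 e0 w0; lra.
Qed.

Section Approximation.
Variable hs : R -> R.
Hypothesis Hhs : is_induced_response F hs.

(** The truncated Neumann series of the discretized operator approximates the
    sum of the exact one; the length of the series is chosen first. *)
Lemma induced_response_close : exists (B : R) (r : nat -> R),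
  [/\ [/\ 0 <= B, bounded_by B u, forall n, 0 <= r n & cvgn (series r)] &
   forall e : R, 0 < e -> exists (l : nat) (eta0 : R), 0 < eta0 /\
    forall M k zeta, (0 < M)%N -> mesh M < eta0 -> tail r k <= mesh M ^+ 2 ->
      delta F k <= mesh M -> admissible F M k zeta ->
      forall x, Delta x -> `|induced_response_approx F M k l h zeta x - u x| <= e].
Proof.
have [C C0 HC] := source_decay HF ES Hhs.
have WB n := (HC n).1; have WL n := (HC n).2.
have [q0 q1] := andP (cone_rate_itv ES).
have q1' : 0 < 1 - q by rewrite subr_gt0.
have C'0 : 0 <= C / (1 - q) by rewrite divr_ge0// ltW.
have qn n : C * q ^+ n <= C by rewrite ler_piMr// exprn_ile1// ltW.
have WBC n : bounded_by C (iter n L source).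
  by move=> x Dx; apply: le_trans (WB n x Dx) _.
have WLC n : lipschitz_by C (iter n L source).
  by move=> x y Dx Dy; apply: le_trans (WL n x y Dx Dy) _; rewrite ler_wpM2r.
have [E0 [r1 [E00 r10 cr1 HW]]] := Wh_close HF ES.
have [E HE] := iterates_close HF ES E0 C0 WBC WLC.
exists (C / (1 - q)), (fun n => r1 n + s n); split.
  have uB := potential_bounded ES WB; split => //.
  - by move=> n; rewrite addr_ge0// (es_s_ge0 ES).
  - by apply: cvg_seriesD => //; exact: (es_s_cvg ES).
move=> e e0; have e20 : 0 < e / 2 by rewrite divr_gt0.
have [l Hl] : exists l, C / (1 - q) * q ^+ l.+1 <= e / 2.
  have : C / (1 - q) * q ^+ n @[n --> \oo] --> (0 : R).
    rewrite -(mulr0 (C / (1 - q))); apply: cvgM; first exact: cvg_cst.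
    by apply: cvg_expr; rewrite ger0_norm.
  move=> /cvgrPdist_le/(_ _ e20)[l _ Hl]; exists l.
  have := Hl l.+1 (leqnSn l); rewrite sub0r normrN ger0_norm// mulr_ge0//.
  exact: exprn_ge0.
pose Et : R := `|\sum_(n < l.+1) E n| + 1.
have Et0 : 0 < Et by rewrite ltr_wpDl.
exists l, (e / 2 / Et); split; first by rewrite divr_gt0.
move=> M k zeta M0 meta tk dk adm x Dx.
have m0 := @mesh_gt0 R _ M0.
have m1 : mesh M ^+ 2 <= mesh M :> R.
  rewrite expr2 ler_piMl ?(ltW m0)// /mesh invf_le1 ?mulr_gt0 ?ltr0n//.
  by rewrite -natrM ler1n muln_gt0 M0.
have cr : cvgn (series (fun n => r1 n + s n)).
  by apply: cvg_seriesD => //; exact: (es_s_cvg ES).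
have t1 : tail r1 k <= mesh M ^+ 2.
  by apply: le_trans tk; apply: tail_le => // n; rewrite lerDl (es_s_ge0 ES).
have ts : tail s k <= mesh M.
  apply: le_trans m1; apply: le_trans tk; apply: tail_le => // n.
    exact: (es_s_ge0 ES).
  by rewrite lerDr.
have iter_close := HE M k _ M0 ts dk (Wh_continuous M0) (HW M k zeta M0 t1 adm).
apply: (le_trans (ler_distD (\sum_(n < l.+1) iter n L source x) _ _)).
rewrite [e]splitr; apply: lerD; last first.
  rewrite distrC; apply: le_trans Hl.
  exact: (potential_approx ES WB l.+1 Dx).
rewrite /induced_response_approx -sumrB; apply: (le_trans (ler_norm_sum _ _ _)).
apply: (@le_trans _ _ (\sum_(n < l.+1) E n * mesh M)).
  by apply: ler_sum => n _; have [_] := iter_close n; apply.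
rewrite -mulr_suml; apply: (@le_trans _ _ (Et * mesh M)).
  by rewrite ler_wpM2r ?(ltW m0)// (le_trans (ler_norm _))// lerDl.
by rewrite mulrC -ler_pdivlMr// ltW.
Qed.

Lemma truncation_levels (r : nat -> R) : cvgn (series r) -> exists k : nat -> nat,
  forall M, (0 < M)%N -> tail r (k M) <= mesh M ^+ 2 /\ delta F (k M) <= mesh M.
Proof.
move=> cr; suff : forall M, exists k, (0 < M)%N ->
    tail r k <= mesh M ^+ 2 /\ delta F k <= mesh M.
  by move=> H; have [k Hk] := choice H; exists k.
move=> M; have [->|M0] := posnP M; first by exists 0%N.
have m0 := @mesh_gt0 R _ M0; have m20 : 0 < mesh M ^+ 2 :> R by rewrite exprn_gt0.
have [N1 H1] := tail_small cr m20; have [N2 H2] := endpoint_small HF m0.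
exists (maxn N1 N2) => _; split; first by apply: H1; exact: leq_maxl.
by rewrite (deltaE HF); have := H2 _ (leq_maxr N1 N2); lra.
Qed.

(** The error is at most a small multiple of the integrable function
    [x `^ (- gamma)]. The number of steps is chosen first, then the mesh size,
    and the number of words does not depend on them. *)
Lemma response_approximation (tau : R) : 0 < tau ->
  exists (l : nat) (k : nat -> nat) (eta0 : R) (N0 : nat), 0 < eta0 /\
    forall (M N : nat) (zeta : nat -> nat -> R),
      (0 < M)%N -> mesh M < eta0 -> (N0 <= N)%N -> admissible F M (k M) zeta ->
      (\int[mu]_(x in I01) `|response_approx F M (k M) l N h zeta x
         - response F hs x|%:E <= tau%:E)%E.
Proof.
move=> tau0.
have [P [t [P0 t0 ct Hpt]]] := response_pointwise.
have [B [r [[B0 uB r0 cr] Hind]]] := induced_response_close.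
have [CI CI0 HCI] := powRN_integrable gamma01.
have C1 : 0 < CI + 1 by rewrite ltr_wpDl.
pose c : R := tau / (CI + 1); have c0 : 0 < c by rewrite divr_gt0.
pose e : R := c / 2 / (1 + P).
have P1 : 0 < 1 + P by rewrite ltr_pwDl.
have e0 : 0 < e by rewrite !divr_gt0.
have B1 : 0 < 1 + B by rewrite ltr_pwDl.
have [l [eta0 [eta00 Hl]]] := Hind e e0.
have [k Hk] := truncation_levels cr.
have d0 : 0 < c / 2 / (1 + B) by rewrite !divr_gt0.
have [N0 HN0] := tail_small ct d0.
exists l, k, eta0, N0; split => // M N zeta M0 meta N0N adm.
have [kt kd] := Hk M M0.
have Hae := response_potential HF ES Hhs.
have Hpull := ae_pullback HF Hae.
have [Z [mZ Z0 HZ]] : {ae @mu R, forall x, 0 < x <= 1 ->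
    `|response_approx F M (k M) l N h zeta x - response F hs x| <= c * x `^ (- gamma)}.
  apply: filterS2 Hae Hpull => x Hx HG xI.
  have := Hpt B hs B0 uB _ e x N (ltW e0) (Hl M (k M) zeta M0 meta kt kd adm) xI Hx (HG xI).
  move/le_trans; apply; rewrite ler_wpM2r ?powR_ge0//.
  have -> : c = e * (1 + P) + (1 + B) * (c / 2 / (1 + B)).
    by rewrite /e; field; rewrite !gt_eqF.
  by rewrite lerD2l ler_wpM2l ?(ltW B1)// HN0.
pose Z' : set (measurableTypeR R) := Z `|` [set 0].
have mI : measurable (@I01 R : set (measurableTypeR R)) by exact: measurable_itv.
have mw : measurable_fun (@I01 R) (fun x : R => (c * x `^ (- gamma))%:E).
  apply/measurable_EFinP; apply: measurable_funM => //.
  by apply: measurable_funTS; exact: measurable_powR.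
apply: (@le_trans _ _ (\int[mu]_(x in I01) (c * x `^ (- gamma))%:E)%E).
  apply: (@le_ae_nonneg_integral _ _ _ _ _ _ _ Z') => //.
  - by apply: measurableU => //; exact: measurable_set1.
  - apply: measure_negligible; first by apply: measurableU => //; exact: measurable_set1.
    apply: negligibleU; first by exists Z; split.
    exists [set 0]; split; [exact: measurable_set1|exact: lebesgue_measure_set1|by []].
  - by move=> x _; rewrite lee_fin mulr_ge0 ?powR_ge0// ltW.
  - move=> x /I01P/andP[x0 x1] /not_orP[nZ nx]; rewrite lee_fin.
    apply: contrapT => H; apply: nZ; apply: HZ => /= H'; apply: H; apply: H'.
    by rewrite x1 andbT lt_neqAle x0 andbT eq_sym; apply/eqP.
have -> : (\int[mu]_(x in I01) (c * x `^ (- gamma))%:E =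
    \int[mu]_(x in `]0%R, 1%R]) (c%:E * (x `^ (- gamma))%:E))%E.
  rewrite /mu /I01 -integral_itv_obnd_cbnd//.
  apply: (measurable_funS _ _ mw) => //; exact: subset_itv_oc_cc.
rewrite ge0_integralZl//; last 3 first.
- by apply/measurable_EFinP; apply: measurable_funTS; exact: measurable_powR.
- by move=> x _; rewrite lee_fin powR_ge0.
- by rewrite lee_fin ltW.
apply: (@le_trans _ _ (c%:E * CI%:E)%E); first by rewrite lee_pmul2l.
rewrite -EFinM lee_fin /c mulrAC ler_pdivrMr// ler_wpM2l ?(ltW tau0)//.
by rewrite lerDl.
Qed.

End Approximation.
End Response.


Theorem theorem2p1 (R : realType) (V : set R) (gamma : R) (F : map_family R)
    (hhat_star : R -> R) (tau : R)
    (gamma01 : 0 < gamma < 1)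
    (HF : standing_assumptions V gamma F)
    (Hhhat_star : is_induced_response F hhat_star)
    (tau_gt0 : 0 < tau) :
  exists (lstar : nat) (k : nat -> nat)
         (Leta : nat -> (R -> R) -> (R -> R)) (heta : nat -> R -> R),
    (forall M : nat, (0 < M)%N ->
       finite_rank_operator (Leta M) /\
       invariant_density (Leta M) (heta M)) /\
    exists (eta0 : R) (N0 : nat), 0 < eta0 /\
      forall (M N : nat) (zeta : nat -> nat -> R),
        (0 < M)%N -> mesh M < eta0 -> (N0 <= N)%N ->
        admissible F M (k M) zeta ->
        (\int[mu]_(x in I01)
           `|response_approx F M (k M) lstar N (heta M) zeta x
             - response F hhat_star x|%:E <= tau%:E)%E.
Proof.
have [s [rho [D ES]]] := words_expanding gamma01 HF.
have [l [k [eta0 [N0 [eta00 H]]]]] := response_approximation gamma01 HF ES Hhhat_star tau_gt0.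
have h1 : L1 (hhat F 0) := continuous_Delta_integrable (hhat_continuous HF (V_0 HF)).
have hmean : mean (hhat F 0) = 1 := hhat_normalized HF.
exists l, k, (fun _ f x => mean f * hhat F 0 x), (fun _ => hhat F 0).
split; last by exists eta0, N0.
move=> M _; split; first exact: rank_one_operator.
split; [exact: (hhat_C1 HF ES)| |exact: hmean].
by apply: aeW => x _; rewrite hmean mul1r.
Qed.
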